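(* Let $d\ge3$, $\beta\in(0,\infty)$, and let $(u_t(x))$ be the (real-valued) mild solution of $$\mathrm du_t(x)=\tfrac12\Delta u_t(x)\,\mathrm dt+\frac{\beta u_t(x)}{\sqrt{\log\rho^{-1}}}\,\mathrm dW^\rho_t(x),\qquad x\in\mathbb{R}^d,$$ with initial condition $u_0\equiv1$. Then, for any $T\in(0,\infty)$, there is a constant $C=C(\beta,T)<\infty$, independent of $\rho$, such that $$\sup_{t\in[0,T],\,x\in\mathbb{R}^d}\mathbb{E}|u_t(x)|^2\le C.$$
   Context: The parameter $\rho\in(0,1)$ is a regularization parameter; the regime of interest is $\rho\downarrow0$. $G_t(x)=(2\pi t)^{-d/2}e^{-|x|^2/(2t)}$ is the heat kernel on $\mathbb{R}^d$, $\mathcal{G}_tv=G_t*v$, $R(x)=|x|^{-2}$, $R^\rho=G_{2\rho}*R$. The real-valued Gaussian noise $(\mathrm dW^\rho_t(x))$ is white in time and adapted to a temporal filtration, with $\mathbb{E}[\mathrm dW^\rho_t(x)\,\mathrm dW^\rho_{t'}(x')]=\delta(t-t')R^\rho(x-x')$. The mild solution satisfies $u_t(x)=\mathcal{G}_tu_0(x)+\frac1{\sqrt{\log\rho^{-1}}}\int_0^t\mathcal{G}_{t-s}[\beta u_s\,\mathrm dW^\rho_s](x)$.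
   Formalization: The constant C is uniform over ρ in (0,ρ0] for each fixed ρ0<1 and may depend on ρ0 (and d); uniformity over all ρ in (0,1) fails because β/√(log ρ^{-1}) blows up as ρ↑1, making E|u_T|² unbounded. *)

(* Defs.v *)
From Stdlib Require List.
From HB Require Import structures.
From mathcomp Require Import all_boot all_order all_algebra.
From mathcomp Require Import all_classical all_reals all_analysis.

Set Implicit Arguments.
Unset Strict Implicit.
Unset Printing Implicit Defensive.

Import Order.TTheory GRing.Theory Num.Theory.
Import numFieldNormedType.Exports.

Local Open Scope classical_set_scope.
Local Open Scope ring_scope.

Notation euclidean R d := (d.-tuple (measurableTypeR R)).

(* Tuples carry the product sigma-algebra, but not yet a Lebesgue measure: it
   is built by pushing lebesgue_measure \x nu along
   (a, v) |-> a :: v, one coordinate at a time. *)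
Section cons_measure.
Context {R : realType} {n : nat}.
Variable nu : {sigma_finite_measure set (euclidean R n) -> \bar R}.

Definition space_cons (p : measurableTypeR R * euclidean R n) : euclidean R n.+1 :=
  [tuple of p.1 :: p.2].

Lemma measurable_space_cons : measurable_fun setT space_cons.
Proof. exact: measurable_cons. Qed.

Definition cons_measure : set (euclidean R n.+1) -> \bar R :=
  pushforward (@lebesgue_measure R \x nu)%E space_cons.

Let cons_measure0 : cons_measure set0 = 0%E.
Proof. by rewrite /cons_measure /pushforward preimage_set0 measure0. Qed.

Let cons_measure_ge0 A : (0 <= cons_measure A)%E.
Proof. by rewrite /cons_measure /pushforward; exact: measure_ge0. Qed.

Let cons_measure_sigma_additive : semi_sigma_additive cons_measure.
Proof.
move=> F mF tF mUF; rewrite /cons_measure /pushforward preimage_bigcup.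
apply: measure_semi_sigma_additive.
- by move=> k; rewrite -[_ @^-1` _]setTI; exact: measurable_space_cons.
- apply/trivIsetP => /= i j _ _ ij; rewrite -preimage_setI.
  by move/trivIsetP : tF => -> //; rewrite preimage_set0.
- by rewrite -preimage_bigcup -[_ @^-1` _]setTI; exact: measurable_space_cons.
Qed.

HB.instance Definition _ := isMeasure.Build _ _ _ cons_measure
  cons_measure0 cons_measure_ge0 cons_measure_sigma_additive.

Let sigma_finite_cons_measure : sigma_finite setT cons_measure.
Proof.
have /sigma_finiteP[F [TF ndF Foo]] := sigma_finiteT (@lebesgue_measure R).
have /sigma_finiteP[G [TG ndG Goo]] := sigma_finiteT nu.
pose h (v : euclidean R n.+1) : measurableTypeR R * euclidean R n :=
  (tnth v ord0, [tuple of behead v]).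
have mh : measurable_fun setT h.
  by apply/measurable_fun_pairP; split => /=;
    [exact: measurable_tnth|exact: measurable_behead].
have hK : cancel space_cons h.
  by move=> [a v]; rewrite /h /space_cons/=; congr pair; exact: val_inj.
exists (fun k => h @^-1` (F k `*` G k)).
  rewrite -preimage_bigcup (_ : \bigcup_k _ = setT) ?preimage_setT//.
  apply/seteqP; split => // -[a v] _.
  have [i _ Fa] : (\bigcup_k F k) a by rewrite -TF.
  have [j _ Gv] : (\bigcup_k G k) v by rewrite -TG.
  exists (maxn i j) => //; split => /=.
  - by move: a Fa; exact/subsetPset/ndF/leq_maxl.
  - by move: v Gv; exact/subsetPset/ndG/leq_maxr.
move=> k; have [mF Fk] := Foo k; have [mG Gk] := Goo k; split.
  by rewrite -[_ @^-1` _]setTI; apply: mh => //; exact: measurableX.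
rewrite /cons_measure /pushforward -comp_preimage.
rewrite (_ : h \o space_cons = id) ?preimage_id; last first.
  by apply/funext => p /=; rewrite hK.
rewrite product_measure1E//.
by rewrite lte_mul_pinfty// ge0_fin_numE.
Qed.

HB.instance Definition _ := Measure_isSigmaFinite.Build _ _ _ cons_measure
  sigma_finite_cons_measure.

End cons_measure.

Fixpoint lebesgue_space (R : realType) (d : nat) :
    {sigma_finite_measure set (euclidean R d) -> \bar R} :=
  if d is d'.+1 then cons_measure (lebesgue_space R d')
  else dirac [tuple].

Section deterministic.
Context {R : realType} {d : nat}.
Implicit Types (t : R) (x y : euclidean R d).

Definition sqnorm x : R := \sum_(i < d) tnth x i ^+ 2.

Definition vsub x y : euclidean R d := [tuple tnth x i - tnth y i | i < d].

Definition heat_kernel t x : R :=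
  (2 * pi * t) `^ (- (d%:R / 2)) * expR (- sqnorm x / (2 * t)).

(* The formula for heat_kernel is meaningless at t = 0, where the semigroup is
   the identity. *)
Definition heat_semigroup t (v : euclidean R d -> R) x : R :=
  if t == 0 then v x
  else \int[lebesgue_space R d]_y (heat_kernel t (vsub x y) * v y).

(* x |-> |x|^-2; the conventional value 0 at the origin is immaterial. *)
Definition riesz x : R := (sqnorm x)^-1.

Definition riesz_reg (rho : R) x : R :=
  \int[lebesgue_space R d]_y (heat_kernel (2 * rho) (vsub x y) * riesz y).

Definition test_function (phi : euclidean R d -> R) :=
  measurable_fun setT phi /\
  exists M : R, forall x, `|phi x| <= M /\ (M < sqnorm x -> phi x = 0).

End deterministic.

Section noise.
Context {R : realType} {d : nat} {disp : measure_display}.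
Context {Omega : measurableType disp} (P : probability Omega R).

Definition measurable_wrt (G : set (set Omega)) (X : Omega -> R) :=
  forall B : set R, measurable B -> G (X @^-1` B).

Record filtration (F : R -> set (set Omega)) : Prop := {
  filtration_sigma_algebra : forall t : R, 0 <= t -> sigma_algebra setT (F t) ;
  filtration_measurable : forall t : R, 0 <= t -> F t `<=` measurable ;
  filtration_monotone : forall s t : R, 0 <= s -> s <= t -> F s `<=` F t }.

Definition independent_families (G H : set (set Omega)) :=
  forall A B, G A -> H B -> P (A `&` B) = (P A * P B)%E.

(* normal_prob 0 0 is the uniform law on [0, 1], not the Dirac mass, hence the
   separate degenerate case. *)
Definition centered_gaussian (X : Omega -> R) :=
  measurable_fun setT X /\
  ({ae P, forall w, X w = 0} \/
   exists2 sigma : R, 0 < sigma &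
     forall B : set R, measurable B -> P (X @^-1` B) = normal_prob 0 sigma B).

(* W t phi stands for "\int_0^t \int phi(y) dW_s(y) dy": the noise is
   distribution-valued in time, so it is given through its time integrals
   against spatial test functions (a cylindrical Wiener process).  The formal
   identity E[dW_t(x) dW_t'(x')] = delta(t - t') K(x - x'), tested against
   1_[0,s] phi and 1_[0,t] psi, is noise_covariance.  "White in time and adapted
   to F" also means that increments after time s are independent of F s. *)
Record spatial_noise (K : euclidean R d -> R) (F : R -> set (set Omega))
    (W : R -> (euclidean R d -> R) -> Omega -> R) : Prop := {
  noise_adapted : forall (t : R) phi, 0 <= t -> test_function phi ->
    measurable_wrt (F t) (W t phi) ;
  noise_gaussian : forall (n : nat) (c t : 'I_n -> R)
      (phi : 'I_n -> euclidean R d -> R),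
    (forall i, 0 <= t i) -> (forall i, test_function (phi i)) ->
    centered_gaussian (fun w => \sum_(i < n) c i * W (t i) (phi i) w) ;
  noise_covariance : forall (s t : R) phi psi, 0 <= s -> 0 <= t ->
    test_function phi -> test_function psi ->
    ('E_P[(fun w => W s phi w * W t psi w)%R] =
    (Num.min s t * \int[lebesgue_space R d]_y \int[lebesgue_space R d]_y'
                     (phi y * psi y' * K (vsub y y')))%:E)%E ;
  noise_independent : forall s : R, 0 <= s ->
    independent_families (F s)
      <<s [set A | exists (t : R) phi (B : set R),
             [/\ s <= t, test_function phi, measurable B &
                 A = (fun w => W t phi w - W s phi w) @^-1` B]] >> }.

(* The elementary integrand X(w) 1_]a, b](s) phi(y). *)
Record step := Step {
  step_start : R ;
  step_end : R ;
  step_weight : Omega -> R ;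
  step_profile : euclidean R d -> R }.

Definition predictable_step (F : R -> set (set Omega)) (p : step) :=
  [/\ 0 <= step_start p, step_start p <= step_end p,
      measurable_wrt (F (step_start p)) (step_weight p),
      exists M : R, forall w, `|step_weight p w| <= M &
      test_function (step_profile p)].

Definition simple_integrand (l : seq step) (s : R) (y : euclidean R d) (w : Omega)
    : R :=
  \sum_(p <- l) step_weight p w *
    \1_(`]step_start p, step_end p]) s * step_profile p y.

Definition simple_integral (W : R -> (euclidean R d -> R) -> Omega -> R)
    (l : seq step) (t : R) (w : Omega) : R :=
  \sum_(p <- l) step_weight p w *
    (W (Num.min t (step_end p)) (step_profile p) w -
     W (Num.min t (step_start p)) (step_profile p) w).

(* The squared norm in which Walsh and Dalang complete the simple integrands:
   E \int_0^t \int \int |f_s(y) f_s(y') K(y - y')| dy dy' ds. *)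
Definition integrand_norm2 (K : euclidean R d -> R) (t : R)
    (f : R -> euclidean R d -> Omega -> R) : \bar R :=
  (\int[P]_w \int[lebesgue_measure]_(s in `]0%R, t[)
     \int[lebesgue_space R d]_y \int[lebesgue_space R d]_y'
       `|(f s y w * f s y' w * K (vsub y y'))%R|%:E)%E.

(* Z is (a version of) the Walsh-Dalang integral
   \int_0^t \int f_s(y) dW_s(y) dy: the L^2(P) limit of integrals of simple
   integrands which converge to f. *)
Definition stochastic_integral (K : euclidean R d -> R)
    (F : R -> set (set Omega)) (W : R -> (euclidean R d -> R) -> Omega -> R)
    (t : R) (f : R -> euclidean R d -> Omega -> R) (Z : Omega -> R) :=
  measurable_fun setT Z /\
  exists l : nat -> seq step,
    [/\ forall n p, List.In p (l n) -> predictable_step F p,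
        (fun n => integrand_norm2 K t
           (fun s y w => f s y w - simple_integrand (l n) s y w))
          @ \oo --> 0%E &
        (fun n => 'E_P[(fun w => `|Z w - simple_integral W (l n) t w| ^+ 2)%R])%E
          @ \oo --> 0%E].

(* mild_moment is the usual requirement on the random-field solutions for which
   Dalang's theory gives existence and uniqueness; the bound M may depend on
   everything, in particular on rho. *)
Record mild_solution (rho beta : R) (F : R -> set (set Omega))
    (W : R -> (euclidean R d -> R) -> Omega -> R) (u0 : euclidean R d -> R)
    (u : R -> euclidean R d -> Omega -> R) : Prop := {
  mild_measurable :
    measurable_fun
      [set p : measurableTypeR R * euclidean R d * Omega | 0 <= p.1.1]
      (fun p => u p.1.1 p.1.2 p.2) ;
  mild_adapted : forall (t : R) x, 0 <= t -> measurable_wrt (F t) (u t x) ;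
  mild_moment : forall T : R, exists M : R, forall (t : R) x, 0 <= t <= T ->
    ('E_P[(fun w => `|u t x w| ^+ 2)%R] <= M%:E)%E ;
  mild_equation : forall (t : R) x, 0 <= t ->
    exists2 Z : Omega -> R,
      stochastic_integral (riesz_reg rho) F W t
        (fun s y w => heat_kernel (t - s) (vsub x y) * (beta * u s y w)) Z &
      {ae P, forall w, u t x w =
         heat_semigroup t u0 x + (Num.sqrt (ln rho^-1))^-1 * Z w} }.

End noise.

(* Main.v *)
Require Import Defs.
From HB Require Import structures.
From mathcomp Require Import all_boot all_order all_algebra.
From mathcomp Require Import all_classical all_reals all_analysis.
From mathcomp Require Import measurable_realfun ring lra.

Set Implicit Arguments.
Unset Strict Implicit.
Unset Printing Implicit Defensive.

Import Order.TTheory GRing.Theory Num.Theory.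
Import numFieldNormedType.Exports.

Local Open Scope classical_set_scope.
Local Open Scope ring_scope.

(** The idea.  By the Ito isometry w_t(x,x') = |E u_t(x) u_t(x')| satisfies
      w_t(x,x') <= 1 + lambda int_0^t (G_(t-s) (x) G_(t-s)) [K w_s] (x,x') ds,
    with K(y,y') = R^rho(y - y') and lambda = beta^2 / log(1/rho).  Bounding w_s by
    its supremum is too lossy for large beta; instead w is compared with the
    supersolution 2 (1 + t/q)^a, where q = |x - x'|^2 + rho.  In dimension d >= 3,
    R^rho <= C/q and G_tau * (|.|^2 + p)^-b <= C (|.|^2 + p + tau)^-b for b <= 5/4,
    so that the Duhamel integral of (1 + s/q)^a is at most (C/a) (1 + t/q)^a.  Hence
    a = C lambda is admissible once rho is small, and on the diagonal
    (1 + t/rho)^a <= (1 + T) exp(C beta^2) does not depend on rho.  The remaining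
    rho <= rho0 are bounded away from 0, and there R^rho is bounded.

    The isometry passes to the limit defining the Walsh-Dalang integral through the
    inequality 2 <phi,psi> <= e <phi,phi> + <psi,psi>/e for the form with kernel
    R^rho.  No Fourier analysis is needed for it: on test functions the form is a
    covariance of the noise, and nonnegative functions follow by truncation. *)

(** The kernel [|x|^-2] is critical: on the diagonal the Duhamel integral of a constant is of order
    log(1/rho), exactly what lambda cancels, so a supremum estimate closes only for small beta. The
    barrier escapes this because its Duhamel integral costs 1/a instead of log(1/rho), and lambda /
    a can be made as small as desired by the choice of a, whatever beta is. Taking absolute values
    of the two-point function makes it nonnegative, so that the positive Duhamel operator preserves
    inequalities. The comparison starts from the qualitative moment bound contained in the notion of
    mild solution; that bound may depend on rho, but it is multiplied by [2^-n] along the iteration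
    and disappears in the limit. On the stochastic side nothing is assumed about the norms of the
    approximating simple integrands. The error estimates therefore put the small weight e on the
    norms of the limits and the large weight 1 + 1/e on the differences, which tend to 0. *)

(* The library declares m1 \x m2 sigma-finite, but that instance is shadowed by
   the one for subprobabilities and is never inferred; hence this copy. *)
Section sigma_prod.
Context {d1 d2 : measure_display} {T1 : measurableType d1} {T2 : measurableType d2}.
Context {R : realType}.
Variables (m1 : {sigma_finite_measure set T1 -> \bar R})
  (m2 : {sigma_finite_measure set T2 -> \bar R}).

Definition sigma_prod : set (T1 * T2) -> \bar R := (m1 \x m2)%E.

HB.instance Definition _ := Measure.on sigma_prod.

Let sigma_prod_sigma_finite : sigma_finite setT sigma_prod.
Proof.
have /sigma_finiteP[F [TF ndF Foo]] := sigma_finiteT m1.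
have /sigma_finiteP[G [TG ndG Goo]] := sigma_finiteT m2.
exists (fun k => F k `*` G k) => [|k].
  apply/seteqP; split => // -[x y] _.
  have [i _ Fx] : (\bigcup_k F k) x by rewrite -TF.
  have [j _ Gy] : (\bigcup_k G k) y by rewrite -TG.
  exists (maxn i j) => //; split => /=.
    by move: x Fx; exact/subsetPset/ndF/leq_maxl.
  by move: y Gy; exact/subsetPset/ndG/leq_maxr.
have [mF Fk] := Foo k; have [mG Gk] := Goo k; split; first exact: measurableX.
by rewrite /sigma_prod product_measure1E// lte_mul_pinfty// ge0_fin_numE.
Qed.

HB.instance Definition _ := Measure_isSigmaFinite.Build _ _ _ sigma_prod
  sigma_prod_sigma_finite.

Lemma tonelli1 (f : T1 * T2 -> \bar R) : measurable_fun setT f ->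
  (forall z, 0 <= f z)%E ->
  (\int[sigma_prod]_z f z = \int[m1]_x \int[m2]_y f (x, y))%E.
Proof. exact: fubini_tonelli1. Qed.

Lemma tonelli2 (f : T1 * T2 -> \bar R) : measurable_fun setT f ->
  (forall z, 0 <= f z)%E ->
  (\int[sigma_prod]_z f z = \int[m2]_y \int[m1]_x f (x, y))%E.
Proof. exact: fubini_tonelli2. Qed.

Lemma measurable_tonelli1 (f : T1 * T2 -> \bar R) : measurable_fun setT f ->
  (forall z, 0 <= f z)%E -> measurable_fun setT (fun x => \int[m2]_y f (x, y))%E.
Proof. exact: measurable_fun_fubini_tonelli_F. Qed.

Lemma fubini_sigma1 (f : T1 * T2 -> \bar R) : sigma_prod.-integrable setT f ->
  (\int[sigma_prod]_z f z = \int[m1]_x \int[m2]_y f (x, y))%E.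
Proof. by move=> fi; rewrite [LHS]/= -(integral12_prod_meas1 fi). Qed.

Lemma fubini_sigma2 (f : T1 * T2 -> \bar R) : sigma_prod.-integrable setT f ->
  (\int[sigma_prod]_z f z = \int[m2]_y \int[m1]_x f (x, y))%E.
Proof. by move=> fi; rewrite [LHS]/= -(integral21_prod_meas1 fi). Qed.

End sigma_prod.


(** * One-dimensional heat kernel against a singular power *)

Definition heat1 {R : realType} (t z : R) : R :=
  (2 * pi * t) `^ (- 2^-1) * expR (- z ^+ 2 / (2 * t)).

Lemma heat1_ge0 (R : realType) (t z : R) : 0 <= heat1 t z.
Proof. by rewrite mulr_ge0 ?powR_ge0 ?expR_ge0. Qed.

Lemma heat1E (R : realType) (t x y : R) : 0 < t ->
  heat1 t (x - y) = normal_pdf x (Num.sqrt t) y.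
Proof.
move=> t0; rewrite normal_pdfE ?gt_eqF ?sqrtr_gt0//.
rewrite /normal_peak /normal_fun /heat1 sqr_sqrtr ?ltW//.
have pi0 := @pi_gt0 R.
congr (_ * expR _).
  by rewrite powRN powR12_sqrt ?mulr_ge0 ?ltW//; congr (Num.sqrt _)^-1; ring.
by rewrite -sqrrN opprB mulr2n; congr (_ / _); ring.
Qed.

Lemma measurable_heat1 (R : realType) (t x : R) :
  0 < t -> measurable_fun [set: measurableTypeR R] (fun y => heat1 t (x - y)).
Proof.
move=> t0; rewrite (_ : (fun y => _) = normal_pdf x (Num.sqrt t)).
  exact: measurable_normal_pdf.
by apply/funext => y; rewrite heat1E.
Qed.

Lemma integral_heat1 (R : realType) (t x : R) : 0 < t ->
  (\int[lebesgue_measure]_y (heat1 t (x - y))%:E = 1)%E.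
Proof.
by move=> t0; under eq_integral do rewrite heat1E//; exact: integral_normal_pdf.
Qed.

(** An affine base of either slope serves the two sides of a spatial singularity as well as the time
    integrals, whose base is [q + t - s] or [1 + s]; g may be negative. *)
Lemma integral_powR_affine (R : realType) (k m a b g : R) :
  a <= b -> 0 < k * a + m -> 0 < k * b + m -> k != 0 -> g != 0 ->
  (\int[lebesgue_measure]_(y in `[a, b]) ((k * y + m) `^ (g - 1))%:E =
   ((k * g)^-1 * ((k * b + m) `^ g - (k * a + m) `^ g))%:E)%E.
Proof.
rewrite le_eqVlt => /predU1P[-> _ _ _ _|ab a0 b0 k0 g0].
  by rewrite set_itv1 integral_set1 subrr mulr0.
have pos (y : R) : y \in `[a, b] -> 0 < k * y + m.
  rewrite in_itv/= => /andP[ay yb].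
  have [k_ge0|k_lt0] := leP 0 k.
    by rewrite (lt_le_trans a0)// lerD2r ler_wpM2l.
  by rewrite (lt_le_trans b0)// lerD2r ler_wnM2l// ltW.
have daff (y : R) : is_derive y 1 (fun y : R => k * y + m) k.
  by apply: is_derive_eq; rewrite addr0 scaler1.
have D (y : R) : y \in `[a, b] ->
    is_derive y 1 (fun y => (k * g)^-1 * (k * y + m) `^ g) ((k * y + m) `^ (g - 1)).
  move=> /pos y0.
  have := @is_derive1_comp R (fun z => z `^ g) (fun y => k * y + m) y _ _
    (is_derive1_powR g y0) (daff y).
  move=> /(@is_deriveZ _ _ _ _ (k * g)^-1 y 1) /is_derive_eq; apply.
  by rewrite /GRing.scale/=; field; rewrite k0 g0.
have ab_in : (a \in `[a, b]) * (b \in `[a, b]).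
  by rewrite !in_itv/= !lexx ltW.
rewrite (@continuous_FTC2 _ _ (fun y => (k * g)^-1 * (k * y + m) `^ g))//.
- by rewrite -EFinB -mulrBr.
- apply: derivable_within_continuous => y /pos y0.
  by have [] := @is_derive1_comp R (fun z => z `^ (g - 1)) (fun y => k * y + m)
    y _ _ (is_derive1_powR (g - 1) y0) (daff y).
- have C (y : R) : y \in `[a, b] ->
      {for y, continuous (fun y => (k * g)^-1 * (k * y + m) `^ g)}.
    by move=> yab; apply/differentiable_continuous/derivable1_diffP; case: (D y yab).
  split.
  + move=> y yab; have /D[]// : y \in `[a, b].
    by move: yab; rewrite !in_itv/= => /andP[/ltW -> /ltW ->].
  + by apply: cvg_at_right_filter; apply: C; rewrite ab_in.
  + by apply: cvg_at_left_filter; apply: C; rewrite ab_in.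
- move=> y yab; rewrite derive1E; apply: derive_val.
  by apply: D; move: yab; rewrite !in_itv/= => /andP[/ltW -> /ltW ->].
Qed.

Lemma heat1_le (R : realType) (t z : R) : 0 < t -> heat1 t z * Num.sqrt t <= 1.
Proof.
move=> t0; have pi2 := pi_ge2 R.
rewrite /heat1 powRN powR12_sqrt; last by rewrite !mulr_ge0 ?pi_ge0 ?ltW.
rewrite mulrAC; apply: mulr_ile1.
- by rewrite mulr_ge0 ?invr_ge0 ?sqrtr_ge0.
- exact: expR_ge0.
- rewrite mulrC ler_pdivrMr ?mul1r; last by rewrite sqrtr_gt0 !mulr_gt0 ?pi_gt0.
  have h : 1 <= 2 * pi :> R by lra.
  by rewrite ler_wsqrtr// ler_peMl// ltW.
- by rewrite -expR0 ler_expR mulNr oppr_le0 divr_ge0 ?sqr_ge0 ?mulr_ge0 ?ltW.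
Qed.

(** At distances up to r the exponent g is traded for the worst one, 5/6, at the price of powers of
    r, so that a single integral serves all g. The form [1 / 6 - 1] is the one of
    [integral_powR_affine]. *)
Lemma powR_shift_le (R : realType) (r s z g : R) :
  0 < r -> 0 < s -> 0 <= z -> 0 <= g <= 5 / 6 ->
  (z + s) `^ (- g) <=
  r `^ (- g) * (1 + (r `^ (5 / 6) * (z + s) `^ (1 / 6 - 1)) *+ (z <= r)%R).
Proof.
move=> r0 s0 z0 /andP[g0 g1].
have zs0 : 0 < z + s by lra.
have [rzs|zsr] := leP r (z + s).
  rewrite (@le_trans _ _ (r `^ (- g)))//.
    rewrite !powRN lef_pV2 ?posrE ?powR_gt0//.
    by rewrite ge0_ler_powR// nnegrE ltW.
  by rewrite ler_peMr ?powR_ge0// lerDl mulrn_wge0// mulr_ge0// powR_ge0.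
have -> : z <= r by lra.
rewrite mulr1n mulrDr mulr1 (@le_trans _ _ (r `^ (- g) * (r `^ (5 / 6) * (z + s) `^ (1 / 6 - 1))))//; last first.
  by rewrite lerDr powR_ge0.
have -> : (1/6 - 1 : R) = - (5/6) by lra.
rewrite mulrA -powRD; last by rewrite (gt_eqF r0) implybT.
have -> : (z + s) `^ (- g) = (z + s) `^ (5 / 6 - g) * (z + s) `^ (- (5 / 6)).
  by rewrite -powRD ?(gt_eqF zs0) ?implybT//; congr (_ `^ _); lra.
rewrite (_ : - g + 5 / 6 = 5 / 6 - g); last by lra.
rewrite ler_wpM2r ?powR_ge0// ge0_ler_powR ?nnegrE; lra.
Qed.

Section one_dimensional_singularity.
Local Open Scope ereal_scope.

(** The singularity is cut at the diffusive scale [r = sqrt t]. Outside, the power is at most [r^-g]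
    and the kernel has mass 1; inside, the kernel is at most 1/r and the exponent 5/6 is integrable,
    with at most [12 r^(1/6)] on each side. Hence 25 = 1 + 12 + 12. *)
Lemma integral_heat1_sing (R : realType) (t x c s g : R) :
  (0 < t)%R -> (0 < s)%R -> (0 <= g <= 5 / 6)%R ->
  \int[lebesgue_measure]_y (heat1 t (x - y) * (`|y - c| + s) `^ (- g))%:E
    <= (25 * Num.sqrt t `^ (- g))%:E.
Proof.
move=> t0 s0 g01.
pose r := Num.sqrt t; have r0 : (0 < r)%R by rewrite sqrtr_gt0.
have mabs : measurable_fun [set: measurableTypeR R] (fun y : R => (`|y - c| + s) `^ (- g))%R.
  apply: (measurableT_comp (measurable_powR (- g))) => /=.
  by apply: measurable_funD => //; apply: measurableT_comp => //; exact: measurable_funB.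
pose f1 := (fun y : R => ((1 * y + (s - c)) `^ (1 / 6 - 1))%:E) \_ `[c, (c + r)%R].
pose f2 := (fun y : R => ((-1 * y + (c + s)) `^ (1 / 6 - 1))%:E) \_ `[(c - r)%R, c].
have f1ge0 y : 0 <= f1 y by rewrite /f1 patchE; case: ifP => //; rewrite lee_fin powR_ge0.
have f2ge0 y : 0 <= f2 y by rewrite /f2 patchE; case: ifP => //; rewrite lee_fin powR_ge0.
have maff k m : measurable_fun [set: measurableTypeR R] (fun y : R => ((k * y + m) `^ (1 / 6 - 1))%:E).
  apply/measurable_EFinP; apply: (measurableT_comp (measurable_powR _)) => /=.
  by apply: measurable_funD => //; exact: measurable_funM.
have mf1 : measurable_fun [set: measurableTypeR R] f1.
  by apply/(measurable_restrictT _ _).1 => //; exact: measurable_funTS.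
have mf2 : measurable_fun [set: measurableTypeR R] f2.
  by apply/(measurable_restrictT _ _).1 => //; exact: measurable_funTS.
have If1 : (s <= r)%R -> \int[lebesgue_measure]_y f1 y <= (12 * r `^ (1 / 6))%:E.
  move=> sr.
  rewrite -integral_mkcond integral_powR_affine; [|lra..].
  rewrite lee_fin (_ : 1 * (c + r) + (s - c) = r + s)%R; last by lra.
  rewrite (_ : 1 * c + (s - c) = s)%R; last by lra.
  rewrite (_ : (1 * (1 / 6))^-1 = 6 :> R)%R; last by field.
  have : ((r + s) `^ (1 / 6) <= (2 * r) `^ (1 / 6))%R.
    by rewrite ge0_ler_powR ?nnegrE; lra.
  rewrite powRM//; last exact: ltW.
  have : (2 `^ (1 / 6) <= 2 :> R)%R by rewrite ler1_powR; lra.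
  have := powR_ge0 s (1 / 6); have := powR_ge0 r (1 / 6).
  by nra.
have If2 : (s <= r)%R -> \int[lebesgue_measure]_y f2 y <= (12 * r `^ (1 / 6))%:E.
  move=> sr.
  rewrite -integral_mkcond integral_powR_affine; [|lra..].
  rewrite lee_fin (_ : -1 * (c - r) + (c + s) = r + s)%R; last by lra.
  rewrite (_ : -1 * c + (c + s) = s)%R; last by lra.
  rewrite (_ : (-1 * (1 / 6))^-1 = - 6 :> R)%R; last by field.
  have : ((r + s) `^ (1 / 6) <= (2 * r) `^ (1 / 6))%R.
    by rewrite ge0_ler_powR ?nnegrE; lra.
  rewrite powRM//; last exact: ltW.
  have : (2 `^ (1 / 6) <= 2 :> R)%R by rewrite ler1_powR; lra.
  have := powR_ge0 s (1 / 6); have := powR_ge0 r (1 / 6).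
  by nra.
have mheat := measurable_heat1 x t0.
(* If s exceeds r the power is at most [r^-g] everywhere. Otherwise [s <= r] gives [r + s <= 2 r],
   as used in [If1] and [If2]. *)
have [sr|rs] := leP s r; last first.
  apply: (@le_trans _ _ (\int[lebesgue_measure]_y ((r `^ (- g))%:E * (heat1 t (x - y))%:E))).
    apply: ge0_le_integral => //.
    - by move=> y _; rewrite lee_fin mulr_ge0 ?heat1_ge0 ?powR_ge0.
    - by apply/measurable_EFinP; exact: measurable_funM.
    - by apply: measurable_funeM; exact/measurable_EFinP.
    - move=> y _; rewrite -EFinM lee_fin mulrC ler_wpM2r ?heat1_ge0//.
      have rzs : (r <= `|y - c| + s)%R by rewrite (le_trans (ltW rs))// lerDr.
      rewrite !powRN lef_pV2 ?posrE ?powR_gt0//; last by lra.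
      by rewrite ge0_ler_powR ?nnegrE//; lra.
  rewrite ge0_integralZl_EFin ?powR_ge0//; last 2 first.
    by move=> y _; rewrite lee_fin heat1_ge0.
    exact/measurable_EFinP.
  by rewrite integral_heat1// mule1 lee_fin ler_peMl ?powR_ge0//; lra.
(* The peak bound 1/r of the kernel times the factor [r^(5/6)] of [powR_shift_le]. *)
pose k := (r `^ (- (1 / 6)))%R.
have k0 : (0 <= k)%R by exact: powR_ge0.
apply: (@le_trans _ _ (\int[lebesgue_measure]_y ((r `^ (- g))%:E *
   ((heat1 t (x - y))%:E + k%:E * (f1 y + f2 y))))).
  apply: ge0_le_integral => //.
  - by move=> y _; rewrite lee_fin mulr_ge0 ?heat1_ge0 ?powR_ge0.
  - by apply/measurable_EFinP; exact: measurable_funM.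
  - apply: measurable_funeM; apply: emeasurable_funD; first exact/measurable_EFinP.
    by apply: measurable_funeM; apply: emeasurable_funD.
  - move=> y _.
    have z0 := normr_ge0 (y - c)%R.
    have hz := powR_shift_le r0 s0 z0 g01.
    apply: (@le_trans _ _ ((r `^ (- g))%:E * (heat1 t (x - y) * (1 + r `^ (5 / 6) * (`|y - c| + s) `^ (1 / 6 - 1) *+ (`|y - c| <= r)%R))%:E)).
      rewrite -EFinM lee_fin mulrCA ler_wpM2l ?heat1_ge0//.
    rewrite lee_pmul2l ?lte_fin ?powR_gt0// mulrDr mulr1 EFinD leeD2l//.
    have [yr|_] := leP `|y - c|%R r; last by rewrite mulr0n mulr0 mule_ge0 ?adde_ge0.
    rewrite mulr1n mulrA.
    apply: (@le_trans _ _ (k%:E * ((`|y - c| + s) `^ (1 / 6 - 1))%:E)).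
      rewrite -EFinM lee_fin ler_wpM2r ?powR_ge0//.
      have := heat1_le (x - y)%R t0; rewrite -/r => h.
      rewrite -(@ler_pM2r _ (r `^ (1/6))%R) ?powR_gt0// -mulrA -!powRD ?(gt_eqF r0) ?implybT//.
      by rewrite addNr powRr0 (_ : 5 / 6 + 1 / 6 = 1)%R ?powRr1 ?(ltW r0)//; lra.
    rewrite lee_wpmul2l// ?lee_fin//.
    have [cy|yc] := leP c y.
      rewrite ger0_norm ?subr_ge0// in yr *.
      rewrite /f1 patchE mem_set/=; last by rewrite in_itv/= cy/=; lra.
      by rewrite (_ : y - c + s = 1 * y + (s - c))%R ?leeDl//; lra.
    rewrite ltr0_norm ?subr_lt0// in yr *.
    rewrite /f2 patchE mem_set/=; last by rewrite in_itv/= (ltW yc) andbT; lra.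
    by rewrite (_ : - (y - c) + s = -1 * y + (c + s))%R ?leeDr//; lra.
rewrite ge0_integralZl_EFin ?powR_ge0//; last 2 first.
  by move=> y _; rewrite adde_ge0 ?mule_ge0 ?adde_ge0// lee_fin heat1_ge0.
  apply: emeasurable_funD; first exact/measurable_EFinP.
  by apply: measurable_funeM; apply: emeasurable_funD.
rewrite ge0_integralD//; last 4 first.
  by move=> y _; rewrite lee_fin heat1_ge0.
  exact/measurable_EFinP.
  by move=> y _; rewrite mule_ge0 ?adde_ge0.
  by apply: measurable_funeM; apply: emeasurable_funD.
rewrite integral_heat1// ge0_integralZl_EFin//; last 2 first.
  by move=> y _; rewrite adde_ge0.
  exact: emeasurable_funD.
rewrite ge0_integralD//.
rewrite mulrC EFinM lee_pmul2l// ?lte_fin ?powR_gt0//.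
apply: (@le_trans _ _ (1 + k%:E * ((12 * r `^ (1 / 6))%:E + (12 * r `^ (1 / 6))%:E))).
  by rewrite leeD2l// lee_wpmul2l// ?lee_fin// leeD// (If1, If2).
rewrite -[X in 1 + k%:E * X]EFinD -EFinM -EFinD lee_fin.
have kr : (k * r `^ (1 / 6) = 1)%R.
  by rewrite -powRD ?(gt_eqF r0) ?implybT// addNr powRr0.
by rewrite mulrDr mulrCA kr; lra.
Qed.

End one_dimensional_singularity.

(** * Integration and measurability on Euclidean space *)

(** The inverse of f is f times the real power -1 of [f^2]; at the zeros of f both vanish by
    convention. *)
Lemma measurable_invr (R : realType) d (T : measurableType d) (f : T -> R) :
  measurable_fun setT f -> measurable_fun setT (fun x => (f x)^-1).
Proof.
move=> mf; rewrite (_ : (fun x => _) = fun x => f x * (f x ^+ 2) `^ (-1)).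
  apply: measurable_funM => //.
  by apply: (measurableT_comp (measurable_powR _)); exact: measurable_funX.
apply/funext => x; rewrite powR_inv1 ?sqr_ge0//.
have [->|fx0] := eqVneq (f x) 0; first by rewrite invr0 mul0r.
by field.
Qed.

Section space.
Context {R : realType}.
Implicit Types d n : nat.

Lemma integral_space_cons n (f : euclidean R n.+1 -> \bar R) :
  measurable_fun setT f -> (forall y, 0 <= f y)%E ->
  (\int[lebesgue_space R n.+1]_y f y =
   \int[@lebesgue_measure R]_a \int[lebesgue_space R n]_v f [tuple of a :: v])%E.
Proof.
move=> mf f0.
rewrite [LHS](ge0_integral_pushforward (@measurable_space_cons R n))//.
rewrite preimage_setT fubini_tonelli1//.
  by apply: measurableT_comp => //; exact: measurable_space_cons.
by move=> z; exact: f0.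
Qed.

Lemma le_integral_space_prod d (f : 'I_d -> R -> R) (c : 'I_d -> R) :
  (forall i, measurable_fun setT (f i : measurableTypeR R -> R)) ->
  (forall i z, 0 <= f i z) ->
  (forall i, \int[@lebesgue_measure R]_z (f i z)%:E <= (c i)%:E)%E ->
  (\int[lebesgue_space R d]_y (\prod_(i < d) f i (tnth y i))%:E <=
   (\prod_(i < d) c i)%:E)%E.
Proof.
have mp n (g : 'I_n -> R -> R) :
    (forall i, measurable_fun setT (g i : measurableTypeR R -> R)) ->
    measurable_fun setT (fun y : euclidean R n => \prod_(i < n) g i (tnth y i)).
  move=> mg; apply: measurable_prod => i _.
  by apply: (measurableT_comp (mg i)); exact: measurable_tnth.
elim: d f c => [|d IH] f c mf f0 fc.
  rewrite /= integral_dirac//; last first.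
    by apply/measurable_EFinP; exact: mp.
  by rewrite !big_ord0 diracT mule1.
have c0 i : 0 <= c i.
  by rewrite -lee_fin (le_trans _ (fc i))// integral_ge0// => z _; rewrite lee_fin.
rewrite integral_space_cons; last 2 first.
  by apply/measurable_EFinP; exact: mp.
  by move=> y; rewrite lee_fin prodr_ge0.
rewrite big_ord_recl.
have E a : (\int[lebesgue_space R d]_v
      (\prod_(i < d.+1) f i (tnth [tuple of a :: v] i))%:E =
    (f ord0 a)%:E * \int[lebesgue_space R d]_v
      (\prod_(i < d) f (lift ord0 i) (tnth v i))%:E)%E.
  rewrite -ge0_integralZl_EFin//; last 2 first.
    by move=> y _; rewrite lee_fin prodr_ge0.
    by apply/measurable_EFinP; apply: (mp _ (fun i => f (lift ord0 i))) => i; exact: mf.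
  apply: eq_integral => v _; rewrite big_ord_recl -EFinM tnth0.
  by congr (_ * _)%:E; apply: eq_bigr => i _; rewrite tnthS.
under eq_integral do rewrite E.
rewrite ge0_integralZr//; last 3 first.
  by apply/measurable_EFinP; exact: mf.
  by move=> z _; rewrite lee_fin.
  by apply: integral_ge0 => y _; rewrite lee_fin prodr_ge0.
rewrite EFinM lee_pmul//.
- by apply: integral_ge0 => y _; rewrite lee_fin.
- by apply: integral_ge0 => y _; rewrite lee_fin prodr_ge0.
- by apply: (IH (fun i => f (lift ord0 i)) (fun i => c (lift ord0 i))).
Qed.

Lemma prod_first3 d (A : R) : (3 <= d)%N ->
  \prod_(i < d) (if (i < 3)%N then A else 1) = A ^+ 3.
Proof.
case: d => [|[|[|d]]]// _.
rewrite !big_ord_recl/= big1 ?mulr1//.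
Qed.

Context {d : nat}.
Implicit Types x y c : euclidean R d.

Lemma sqnorm_ge0 x : 0 <= sqnorm x.
Proof. by apply: sumr_ge0 => i _; exact: sqr_ge0. Qed.

Lemma tnth_vsub x y i : tnth (vsub x y) i = tnth x i - tnth y i.
Proof. by rewrite tnth_mktuple. Qed.

Lemma sqnorm_vsubC x y : sqnorm (vsub x y) = sqnorm (vsub y x).
Proof. by apply: eq_bigr => i _; rewrite !tnth_vsub -sqrrN opprB. Qed.

Lemma sqr_tnth_le x i : tnth x i ^+ 2 <= sqnorm x.
Proof. by rewrite /sqnorm (bigD1 i)//= lerDl sumr_ge0// => j _; exact: sqr_ge0. Qed.

Lemma sqnorm_triangle x y c :
  sqnorm (vsub x c) <= 2 * sqnorm (vsub x y) + 2 * sqnorm (vsub y c).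
Proof.
rewrite /sqnorm !mulr_sumr -big_split/=; apply: ler_sum => i _.
rewrite !tnth_vsub; set a := tnth x i; set b := tnth y i; set e := tnth c i.
have := sqr_ge0 ((a - b) - (b - e)); nra.
Qed.

Lemma heat_kernel_prod (t : R) x y : 0 < t ->
  heat_kernel t (vsub x y) = \prod_(i < d) heat1 t (tnth x i - tnth y i).
Proof.
move=> t0; rewrite /heat1 big_split/= -expR_sum prodr_const card_ord.
congr (_ * expR _).
  by rewrite -powR_mulrn ?powR_ge0// -powRrM; congr (_ `^ _); field.
rewrite /sqnorm -sumrN mulr_suml.
by apply: eq_bigr => i _; rewrite tnth_vsub.
Qed.

Lemma heat_kernel_ge0 (t : R) x : 0 <= heat_kernel t x.
Proof. by rewrite mulr_ge0 ?powR_ge0 ?expR_ge0. Qed.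

Lemma heat_kernel_vsubC (t : R) x y :
  heat_kernel t (vsub x y) = heat_kernel t (vsub y x).
Proof. by rewrite /heat_kernel sqnorm_vsubC. Qed.

Section measurability.
Context (d' : measure_display) (T : measurableType d').
Implicit Types (f g : T -> euclidean R d) (h : T -> R).

Lemma measurable_sqnorm f :
  measurable_fun setT f -> measurable_fun setT (fun z => sqnorm (f z)).
Proof.
move=> mf; apply: measurable_sum => i; apply: measurable_funX.
exact: (measurable_fun_tnthP f).1.
Qed.

Lemma measurable_vsub f g : measurable_fun setT f -> measurable_fun setT g ->
  measurable_fun setT (fun z => vsub (f z) (g z)).
Proof.
move=> mf mg; apply/measurable_fun_tnthP => i.
rewrite (_ : _ \o _ = fun z => tnth (f z) i - tnth (g z) i).
  by apply: measurable_funB; exact: (measurable_fun_tnthP _).1.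
by apply/funext => z /=; rewrite tnth_vsub.
Qed.

Lemma measurable_heat_kernel h f : measurable_fun setT h -> measurable_fun setT f ->
  measurable_fun setT (fun z => heat_kernel (h z) (f z)).
Proof.
move=> mh mf; apply: measurable_funM.
  by apply: (measurableT_comp (measurable_powR _)); exact: measurable_funM.
apply: (measurableT_comp (@measurable_expR R)); apply: measurable_funM.
  by apply: measurableT_comp => //; exact: measurable_sqnorm.
by apply: measurable_invr; exact: measurable_funM.
Qed.

End measurability.

Lemma integral_heat_kernel_le1 (t : R) x : 0 < t ->
  (\int[lebesgue_space R d]_y (heat_kernel t (vsub x y))%:E <= 1)%E.
Proof.
move=> t0; under eq_integral do rewrite heat_kernel_prod//.
apply: le_trans (@le_integral_space_prod d (fun i z => heat1 t (tnth x i - z)) (fun=> 1) _ _ _) _.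
- by move=> i; exact: measurable_heat1.
- by move=> i z; exact: heat1_ge0.
- by move=> i; rewrite integral_heat1.
- by rewrite big1.
Qed.

End space.

(** * Heat flow of shifted inverse powers *)

Lemma ler_powRN (R : realType) (u v e : R) :
  0 < u -> u <= v -> 0 <= e -> v `^ (- e) <= u `^ (- e).
Proof.
move=> u0 uv e0; rewrite !powRN lef_pV2 ?posrE ?powR_gt0//; last exact: lt_le_trans uv.
by rewrite ge0_ler_powR// nnegrE ?ltW//; exact: lt_le_trans uv.
Qed.

(** Numerical factors raised to the power -b are bounded uniformly in b, which keeps
    [heat_rpow_const] free of b. *)
Lemma inv_powR_le (R : realType) (u b : R) : 1 <= u -> b <= 2 ->
  u^-1 `^ (- b) <= u `^ 2.
Proof.
move=> u1 b2; have u0 : 0 <= u by lra.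
by rewrite -powR_inv1// -powRrM mulN1r opprK ler_powR.
Qed.

Section riesz_potential.
Context {R : realType} {d : nat}.
Implicit Types x y c : euclidean R d.

(** The shift p keeps the base away from 0 and records elapsed time: up to constants, the heat flow
    for time t replaces p by [p + t]. *)
Definition rpow (p b : R) (z : euclidean R d) : R := (sqnorm z + p) `^ (- b).

Lemma rpow_ge0 p b z : 0 <= rpow p b z.
Proof. exact: powR_ge0. Qed.

Lemma rpow_vsubC p b x y : rpow p b (vsub x y) = rpow p b (vsub y x).
Proof. by rewrite /rpow sqnorm_vsubC. Qed.

Lemma measurable_rpow (d' : measure_display) (T : measurableType d') p b
    (f : T -> euclidean R d) : measurable_fun setT f ->
  measurable_fun setT (fun z => rpow p b (f z)).
Proof.
move=> mf; apply: (measurableT_comp (measurable_powR _)).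
by apply: measurable_funD => //; exact: measurable_sqnorm.
Qed.

Lemma measurable_vsubr x : measurable_fun setT (fun y : euclidean R d => vsub x y).
Proof. exact: measurable_vsub. Qed.

Lemma measurable_vsubl c : measurable_fun setT (fun y : euclidean R d => vsub y c).
Proof. exact: measurable_vsub. Qed.

Lemma measurable_heat_rpow t p b x c : measurable_fun setT
  (fun y : euclidean R d => heat_kernel t (vsub x y) * rpow p b (vsub y c)).
Proof.
apply: measurable_funM.
  by apply: measurable_heat_kernel => //; exact: measurable_vsubr.
by apply: measurable_rpow; exact: measurable_vsubl.
Qed.

(* Three of the d coordinates suffice: (|z|^2+p)^-b is dominated by the product
   of the one-dimensional singularities |z_i|^(-2b/3), i < 3, whose exponent is
   below 1. *)
Lemma heat_rpow_time (hd : (3 <= d)%N) (t p b : R) x c :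
  0 < t -> 0 < p -> 0 <= b <= 5 / 4 ->
  (\int[lebesgue_space R d]_y (heat_kernel t (vsub x y) * rpow p b (vsub y c))%:E
    <= (4 * 25 ^+ 3 * t `^ (- b))%:E)%E.
Proof.
move=> t0 p0 /andP[b0 b1].
pose s := Num.sqrt p; have s0 : 0 < s by rewrite sqrtr_gt0.
(* The assumption [b <= 5 / 4] is the translation of the one-dimensional range [g <= 5 / 6]. *)
pose g := 2 * b / 3; have g01 : 0 <= g <= 5 / 6 by rewrite /g; lra.
pose f (i : 'I_d) (z : R) := heat1 t (tnth x i - z) *
  (if (i < 3)%N then (`|z - tnth c i| + s) `^ (- g) else 1).
have f0 i z : 0 <= f i z.
  by rewrite mulr_ge0 ?heat1_ge0//; case: ifP => // _; exact: powR_ge0.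
have mf i : measurable_fun setT (f i : measurableTypeR R -> R).
  apply: measurable_funM; first exact: measurable_heat1.
  case: (i < 3)%N => //; apply: (measurableT_comp (measurable_powR _)).
  by apply: measurable_funD => //; apply: measurableT_comp => //; exact: measurable_funB.
have fc i : (\int[@lebesgue_measure R]_z (f i z)%:E <=
    (if (i < 3)%N then 25 * Num.sqrt t `^ (- g) else 1)%:E)%E.
  rewrite /f; case: (i < 3)%N; first exact: integral_heat1_sing.
  by under eq_integral do rewrite mulr1; rewrite integral_heat1.
have := le_integral_space_prod mf f0 fc.
rewrite prod_first3// exprMn.
have -> : (Num.sqrt t `^ (- g)) ^+ 3 = t `^ (- b).
  rewrite -powR_mulrn ?powR_ge0// -powR12_sqrt ?ltW// -!powRrM; congr (_ `^ _).
  by rewrite /g; field.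
move=> H; rewrite -mulrA EFinM.
apply: (@le_trans _ _ (4%:E * \int[lebesgue_space R d]_y (\prod_(i < d) f i (tnth y i))%:E)%E).
  have mpf : measurable_fun [set: euclidean R d] (EFin \o (fun y => \prod_(i < d) f i (tnth y i))).
    apply/measurable_EFinP; apply: measurable_prod => i _.
    by apply: (measurableT_comp (mf i)); exact: measurable_tnth.
  rewrite -ge0_integralZl_EFin//; last by move=> y _; rewrite lee_fin prodr_ge0.
  apply: ge0_le_integral => //.
  - by move=> y _; rewrite lee_fin mulr_ge0 ?heat_kernel_ge0 ?rpow_ge0.
  - by apply/measurable_EFinP; exact: measurable_heat_rpow.
  - exact: measurable_funeM.
  - move=> y _; rewrite -EFinM lee_fin big_split/= -heat_kernel_prod// mulrCA.
    rewrite ler_wpM2l ?heat_kernel_ge0//.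
    set q := sqnorm (vsub y c) + p.
    have q0 : 0 < q by rewrite ltr_wpDl ?sqnorm_ge0.
    (* Since [(|z_i| + s)^2 <= 2 q], the three factors give [(2 q)^-b]; the 4 absorbs the loss, as
       [2^b <= 4]. *)
    apply: (@le_trans _ _ (4 * \prod_(i < d) (if (i < 3)%N then (2 * q) `^ (- (b / 3)) else 1))).
      rewrite prod_first3// -powR_mulrn ?powR_ge0// -powRrM.
      rewrite (_ : - (b / 3) * 3%:R = - b); last by field.
      rewrite /rpow -/q powRM ?(ltW q0)// mulrA ler_peMl ?powR_ge0//.
      rewrite (@le_trans _ _ (4 * 2 `^ (- 2)))//; last first.
        by rewrite ler_wpM2l// ler_powR; lra.
      by rewrite powRN (@powR_mulrn _ _ 2)//; lra.
    rewrite ler_wpM2l// ler_prod// => i _; case: ifP => _; rewrite ?ler01 ?lexx// powR_ge0/=.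
    set m := `|tnth y i - tnth c i| + s.
    have m0 : 0 < m by rewrite ltr_wpDl.
    have -> : m `^ (- g) = (m ^+ 2) `^ (- (b / 3)).
      by rewrite -(@powR_mulrn _ m)// ?(ltW m0)// -powRrM; congr (_ `^ _); rewrite /g; field.
    apply: ler_powRN; [by rewrite exprn_gt0| |lra].
    have h1 : `|tnth y i - tnth c i| ^+ 2 <= sqnorm (vsub y c).
      by rewrite real_normK ?num_real// -tnth_vsub sqr_tnth_le.
    have h2 : s ^+ 2 = p by rewrite sqr_sqrtr// ltW.
    rewrite /m /q; have := sqr_ge0 (`|tnth y i - tnth c i| - s); nra.
by rewrite lee_pmul2l.
Qed.

(** The summands serve the estimates of [heat_rpow_le]: 16 and the term with [2^(n/2)] for the far
    and near parts of the bound by [X^-b], [4 * 25^3] for the one by [t^-b], 1 for the one by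
    [p^-b]. In [2 * 256] the 2 is that of [expR_powR_le] and 256 generously covers [8^b]. The 9 pays
    for comparing a sum of three scales with the largest. *)
Definition heat_rpow_const (n : nat) : R :=
  9 * (16 + 2 `^ (n%:R / 2) * (4 * 25 ^+ 3 * (2 * 256)) + 4 * 25 ^+ 3 + 1).

Lemma heat_rpow_const_ge1 n : 1 <= heat_rpow_const n.
Proof.
rewrite /heat_rpow_const; have := powR_ge0 (2:R) (n%:R / 2).
have : 0 <= 25 ^+ 3 :> R by rewrite exprn_ge0.
set u := 25 ^+ 3; set v := _ `^ _ => u0 v0.
have : 0 <= v * u by exact: mulr_ge0.
by lra.
Qed.

(** From [1 + v^2 / 2 <= exp v]: the power [v^b] is at most [v^2] if v is at least 1, and at most 1
    otherwise. *)
Lemma expR_powR_le (v b : R) : 0 < v -> 0 <= b <= 2 -> expR (- v) <= 2 * v `^ (- b).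
Proof.
move=> v0 /andP[b0 b2].
rewrite expRN powRN -[leLHS]mul1r ler_pdivrMr ?expR_gt0// mulrAC.
rewrite ler_pdivlMr ?powR_gt0// mul1r.
have e1 : 1 + v ^+ 2 / 2 <= expR v by exact: (expR_ge1Dxn 1 (ltW v0)).
have [v1|v1] := leP 1 v.
  apply: (@le_trans _ _ (v ^+ 2)); first by rewrite -powR_mulrn ?(ltW v0)// ler_powR.
  by move: e1; lra.
apply: (@le_trans _ _ 1); last by have := sqr_ge0 v; lra.
by rewrite -[leRHS](powRr0 v) ger_powR// v0 ltW.
Qed.

(** With [X = |x - c|^2], the integral is bounded, up to constants, by each of [p^-b], [t^-b] and
    (if X > 0) [X^-b], hence by the power of the largest of the three scales, which is at least a
    third of their sum. *)
Lemma heat_rpow_le (hd : (3 <= d)%N) (t p b : R) x c :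
  0 < t -> 0 < p -> 0 <= b <= 5 / 4 ->
  (\int[lebesgue_space R d]_y (heat_kernel t (vsub x y) * rpow p b (vsub y c))%:E
    <= (heat_rpow_const d * rpow (p + t) b (vsub x c))%:E)%E.
Proof.
move=> t0 p0 b01; have /andP[b0 b1] := b01.
set I := (\int[_]_y _)%E; pose X := sqnorm (vsub x c); pose C := heat_rpow_const d / 9.
have X0 : 0 <= X := sqnorm_ge0 _.
have V0 : 0 <= 2 `^ (d%:R / 2) * (4 * 25 ^+ 3 * (2 * 256)) :> R.
  by rewrite mulr_ge0 ?powR_ge0// !mulr_ge0// exprn_ge0.
have U0 : 0 <= 25 ^+ 3 :> R by rewrite exprn_ge0.
have mh t' : measurable_fun setT (fun y : euclidean R d => heat_kernel t' (vsub x y)).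
  by apply: measurable_heat_kernel => //; exact: measurable_vsubr.
have Ip : (I <= (p `^ (- b))%:E)%E.
  apply: (@le_trans _ _ ((p `^ (- b))%:E * \int[lebesgue_space R d]_y (heat_kernel t (vsub x y))%:E)%E).
    rewrite -ge0_integralZl_EFin ?powR_ge0//; last 2 first.
      by move=> y _; rewrite lee_fin heat_kernel_ge0.
      exact/measurable_EFinP.
    apply: ge0_le_integral => //.
    - by move=> y _; rewrite lee_fin mulr_ge0 ?heat_kernel_ge0 ?rpow_ge0.
    - by apply/measurable_EFinP; exact: measurable_heat_rpow.
    - by apply: measurable_funeM; exact/measurable_EFinP.
    - move=> y _; rewrite -EFinM lee_fin mulrC ler_wpM2r ?heat_kernel_ge0//.
      by apply: ler_powRN => //; rewrite lerDr sqnorm_ge0.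
  by rewrite -[leRHS]mule1 lee_wpmul2l ?lee_fin ?powR_ge0//; exact: integral_heat_kernel_le1.
have It := heat_rpow_time hd x c t0 p0 b01; rewrite -/I in It.
have IX : 0 < X -> (I <= ((16 + 2 `^ (d%:R / 2) * (4 * 25 ^+ 3 * (2 * 256))) * X `^ (- b))%:E)%E.
  move=> Xp.
  pose A := (X / 4) `^ (- b); pose B := 2 `^ (d%:R / 2) * expR (- X / (16 * t)).
  have A0 : 0 <= A := powR_ge0 _ _.
  have B0 : 0 <= B by rewrite mulr_ge0 ?powR_ge0 ?expR_ge0.
  apply: (@le_trans _ _ (\int[lebesgue_space R d]_y (A%:E * (heat_kernel t (vsub x y))%:E +
      B%:E * (heat_kernel (2 * t) (vsub x y) * rpow p b (vsub y c))%:E))%E).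
    apply: ge0_le_integral => //.
    - by move=> y _; rewrite lee_fin mulr_ge0 ?heat_kernel_ge0 ?rpow_ge0.
    - by apply/measurable_EFinP; exact: measurable_heat_rpow.
    - apply: emeasurable_funD; apply: measurable_funeM; apply/measurable_EFinP => //.
      exact: measurable_heat_rpow.
    - move=> y _; rewrite -!EFinM -EFinD lee_fin.
      have tri := sqnorm_triangle x y c; rewrite -/X in tri.
      have H0 t' := heat_kernel_ge0 t' (vsub x y).
      have r0 := rpow_ge0 p b (vsub y c).
      (* Either y is far from c and the power is small, or the triangle inequality puts y far from
         x. In the latter case one half of the Gaussian exponent yields [exp (- X / (16 t))], and
         the other half is a heat kernel at time 2 t up to [2^(d/2)]. *)
      have [far|near] := leP (X / 4) (sqnorm (vsub y c)).
        rewrite -[leLHS]addr0; apply: lerD; last exact: mulr_ge0 B0 (mulr_ge0 (H0 _) r0).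
        rewrite mulrC; apply: ler_wpM2r => //.
        apply: ler_powRN => //; first by lra.
        by rewrite (le_trans far)// lerDl ltW.
      rewrite -[leLHS]add0r; apply: lerD; first exact: mulr_ge0 A0 (H0 _).
      rewrite mulrA; apply: ler_wpM2r => //.
      have xy : X / 4 <= sqnorm (vsub x y) by lra.
      rewrite /B /heat_kernel.
      have -> : - sqnorm (vsub x y) / (2 * t) =
          - sqnorm (vsub x y) / (4 * t) + - sqnorm (vsub x y) / (2 * (2 * t)).
        by field; rewrite gt_eqF.
      rewrite expRD (_ : 2 * pi * (2 * t) = 2 * (2 * pi * t)); last by ring.
      rewrite [in leRHS]powRM ?mulr_ge0 ?pi_ge0 ?(ltW t0)//.
      rewrite (_ : 2 `^ (d%:R / 2) * expR (- X / (16 * t)) * _ =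
        (2 `^ (d%:R / 2) * 2 `^ (- (d%:R / 2))) * ((2 * pi * t) `^ (- (d%:R / 2)) *
         (expR (- X / (16 * t)) * expR (- sqnorm (vsub x y) / (2 * (2 * t)))))); last by ring.
      rewrite -powRD ?pnatr_eq0 ?implybT// subrr powRr0 mul1r.
      rewrite ler_wpM2l ?powR_ge0// ler_wpM2r ?expR_ge0// ler_expR.
      rewrite !mulNr lerN2 ler_pdivlMr ?mulr_gt0// mulrAC ler_pdivrMr ?mulr_gt0//.
      by nra.
  rewrite ge0_integralD//; last 4 first.
    by move=> y _; apply: mule_ge0; rewrite lee_fin// heat_kernel_ge0.
    by apply: measurable_funeM; apply/measurable_EFinP.
    by move=> y _; apply: mule_ge0; rewrite lee_fin// mulr_ge0 ?heat_kernel_ge0 ?rpow_ge0.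
    by apply: measurable_funeM; apply/measurable_EFinP; exact: measurable_heat_rpow.
  rewrite !ge0_integralZl_EFin//; last 4 first.
    by move=> y _; rewrite lee_fin mulr_ge0 ?heat_kernel_ge0 ?rpow_ge0.
    by apply/measurable_EFinP; exact: measurable_heat_rpow.
    by move=> y _; rewrite lee_fin heat_kernel_ge0.
    exact/measurable_EFinP.
  rewrite [X in (_ <= X%:E)%E]mulrDl EFinD. apply: leeD.
    rewrite -[leRHS]mule1 lee_pmul ?lee_fin//.
    - by apply: integral_ge0 => y _; rewrite lee_fin heat_kernel_ge0.
    - rewrite /A mulrC powRM// mulrC [leRHS]mulrC ler_wpM2l ?powR_ge0//.
      by apply: (@le_trans _ _ (4 `^ 2)); [apply: inv_powR_le|rewrite powR_mulrn//]; lra.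
    - exact: integral_heat_kernel_le1.
  have t20 : 0 < 2 * t by lra.
  apply: (@le_trans _ _ (B%:E * (4 * 25 ^+ 3 * (2 * t) `^ (- b))%:E)%E).
    by rewrite lee_wpmul2l ?lee_fin//; exact: heat_rpow_time.
  rewrite -EFinM lee_fin /B; move: U0; set K := 25 ^+ 3; clearbody K => U0.
  rewrite -!mulrA ler_wpM2l ?powR_ge0//.
  rewrite mulrCA ler_wpM2l// mulrCA ler_wpM2l//.
  have v0 : 0 < X / (16 * t) by rewrite divr_gt0 ?mulr_gt0.
  have b02 : 0 <= b <= 2 by lra.
  have := expR_powR_le v0 b02; rewrite mulNr.
  move=> /(ler_wpM2r (powR_ge0 (2 * t) (- b))) /le_trans; apply.
  rewrite -mulrA -powRM//; [|exact: ltW|exact: ltW].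
  rewrite ler_wpM2l// (_ : _ * (2 * t) = 8^-1 * X); last by field; rewrite gt_eqF.
  rewrite powRM; [|by rewrite invr_ge0|exact: ltW].
  rewrite ler_wpM2r ?powR_ge0//.
  by apply: (@le_trans _ _ (8 `^ 2)); [apply: inv_powR_le|rewrite powR_mulrn//]; lra.
(* At X = 0 the real power has a finite default value, so the bound cannot be claimed there; but
   then X is not the largest scale. *)
have CX : (I <= (C * X `^ (- b))%:E)%E \/ X = 0.
  have := X0; rewrite le_eqVlt => /predU1P[<-|Xp]; [by right|left].
  apply: le_trans (IX Xp) _; rewrite lee_fin ler_wpM2r ?powR_ge0//.
  by rewrite /C /heat_rpow_const; set v := 2 `^ _ * _ in V0 *; lra.
have Ct : (I <= (C * t `^ (- b))%:E)%E.
  apply: le_trans It _; rewrite lee_fin ler_wpM2r ?powR_ge0//.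
  by rewrite /C /heat_rpow_const; set v := 2 `^ _ * _ in V0 *; lra.
have Cp : (I <= (C * p `^ (- b))%:E)%E.
  apply: le_trans Ip _; rewrite lee_fin ler_peMl ?powR_ge0//.
  by rewrite /C /heat_rpow_const; set v := 2 `^ _ * _ in V0 *; lra.
have C0 : 0 <= C by rewrite divr_ge0// (le_trans ler01)// heat_rpow_const_ge1.
have key m : 0 < m -> X + (p + t) <= 3 * m -> (I <= (C * m `^ (- b))%:E)%E ->
    (I <= (heat_rpow_const d * rpow (p + t) b (vsub x c))%:E)%E.
  move=> m0 le3 /le_trans; apply; rewrite lee_fin.
  rewrite (_ : heat_rpow_const d = C * 9); last by rewrite /C; field.
  rewrite -mulrA ler_wpM2l// /rpow -/X.
  have -> : m = 3^-1 * (3 * m) by field.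
  rewrite powRM ?mulr_ge0 ?(ltW m0)//; apply: ler_pM; rewrite ?powR_ge0//.
    by apply: (@le_trans _ _ (3 `^ 2)); [apply: inv_powR_le|rewrite powR_mulrn//]; lra.
  by apply: ler_powRN => //; lra.
have [pt|tp] := leP p t.
  have [Xt|tX] := leP X t; first by apply: (key t) => //; lra.
  by case: CX => [h|h]; [apply: (key X) => //|exfalso]; lra.
have [Xp|pX] := leP X p; first by apply: (key p) => //; lra.
by case: CX => [h|h]; [apply: (key X) => //|exfalso]; lra.
Qed.
End riesz_potential.

Global Opaque heat_rpow_const.

(** * Bounds on the regularized Riesz kernel and on double smoothing *)

Section riesz_reg_bounds.
Context {R : realType} {d : nat}.
Implicit Types x y : euclidean R d.

Lemma riesz_ge0 x : 0 <= riesz x.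
Proof. by rewrite invr_ge0 sqnorm_ge0. Qed.

Lemma measurable_riesz : measurable_fun setT (@riesz R d).
Proof. by apply: measurable_invr; exact: measurable_sqnorm. Qed.

Lemma sqnorm_vsub0 x : sqnorm (vsub x [tuple 0 | i < d]) = sqnorm x.
Proof. by apply: eq_bigr => i _; rewrite tnth_vsub tnth_mktuple subr0. Qed.

(** An inequality only: at the origin the limit is infinite while [riesz] is 0 by convention. *)
Lemma riesz_le_lim x :
  ((riesz x)%:E <= limn (fun n => (rpow n.+1%:R^-1 1 x)%:E))%E.
Proof.
have := sqnorm_ge0 x; rewrite /riesz /rpow le_eqVlt => /predU1P[<-|x0].
  rewrite invr0; apply: lime_ge => //.
    apply: ereal_nondecreasing_is_cvgn => m n mn; rewrite lee_fin.
    by apply: ler_powRN => //; rewrite !add0r ?invr_gt0// lef_pV2 ?posrE ?ler_nat.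
  by near=> n; rewrite lee_fin powR_ge0.
rewrite -powR_inv1 ?(ltW x0)// (@cvg_lim _ _ _ _ _ _ (EFin (sqnorm x `^ (-1))))//.
apply: cvg_EFin; first by near=> n.
rewrite (_ : _ \o _ = fun n : nat => (sqnorm x + n.+1%:R^-1) `^ (-1))//.
have C : {for sqnorm x, continuous (fun z : R => z `^ (-1))}.
  apply/differentiable_continuous/derivable1_diffP.
  by have [] := is_derive1_powR (-1) x0.
have L : sqnorm x + n.+1%:R^-1 @[n --> \oo] --> sqnorm x.
  by rewrite -[X in _ --> X]addr0; apply: cvgD; [exact: cvg_cst|exact: cvg_harmonic].
exact: (continuous_cvg _ C L).
Unshelve. all: by end_near. Qed.

(** [heat_rpow_le] requires a positive shift. The shifts 1/(n+1) increase to a limit dominating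
    [riesz], and their bounds are uniform in n, so monotone convergence applies. *)
Lemma riesz_reg_int_le (hd : (3 <= d)%N) (rho : R) x : 0 < rho ->
  (\int[lebesgue_space R d]_y (heat_kernel (2 * rho) (vsub x y) * riesz y)%:E <=
   (heat_rpow_const d * rpow (2 * rho) 1 x)%:E)%E.
Proof.
move=> rho0.
pose F n y := (heat_kernel (2 * rho) (vsub x y) * rpow n.+1%:R^-1 1 y)%:E.
have mF n : measurable_fun setT (F n).
  apply/measurable_EFinP; apply: measurable_funM; last exact: measurable_rpow.
  by apply: measurable_heat_kernel => //; exact: measurable_vsubr.
have F0 n y : (0 <= F n y)%E by rewrite lee_fin mulr_ge0 ?heat_kernel_ge0 ?rpow_ge0.
have ndF y : {homo F ^~ y : n m / (n <= m)%N >-> (n <= m)%E}.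
  move=> n m nm; rewrite lee_fin ler_wpM2l ?heat_kernel_ge0//.
  apply: ler_powRN => //; first by rewrite ltr_wpDl ?sqnorm_ge0.
  by rewrite lerD2l lef_pV2 ?posrE ?ler_nat.
apply: (@le_trans _ _ (\int[lebesgue_space R d]_y limn (F ^~ y))%E).
  apply: ge0_le_integral => //.
  - by move=> y _; rewrite lee_fin mulr_ge0 ?heat_kernel_ge0 ?riesz_ge0.
  - apply/measurable_EFinP; apply: measurable_funM; last exact: measurable_riesz.
    by apply: measurable_heat_kernel => //; exact: measurable_vsubr.
  - apply: (@emeasurable_fun_cvg _ _ _ _ F) => //.
    by move=> y _; apply: ereal_nondecreasing_is_cvgn => n m; exact: ndF.
  - move=> y _; rewrite /F.
    under [X in limn X]eq_fun do rewrite EFinM.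
    rewrite limeMl//; last first.
      apply: ereal_nondecreasing_is_cvgn => n m nm; rewrite lee_fin.
      apply: ler_powRN => //; first by rewrite ltr_wpDl ?sqnorm_ge0.
      by rewrite lerD2l lef_pV2 ?posrE ?ler_nat.
    by rewrite EFinM lee_wpmul2l ?lee_fin ?heat_kernel_ge0//; exact: riesz_le_lim.
rewrite monotone_convergence//.
apply: lime_le.
  apply: ereal_nondecreasing_is_cvgn => n m nm.
  by apply: ge0_le_integral => // y _; exact: ndF.
near=> n.
have := @heat_rpow_le R d hd (2 * rho) n.+1%:R^-1 1 x [tuple 0 | i < d].
rewrite mulr_gt0// invr_gt0 ltr0Sn => /(_ isT isT); rewrite ler01 /=.
have -> : (1 <= 5 / 4 :> R) by lra.
move=> /(_ isT) h.
apply: (@le_trans _ _ (\int[lebesgue_space R d]_y (heat_kernel (2 * rho) (vsub x y) *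
   rpow n.+1%:R^-1 1 (vsub y [tuple 0 | i < d]))%:E)%E).
  by under [leRHS]eq_integral do rewrite /rpow sqnorm_vsub0.
apply: le_trans h _; rewrite lee_fin ler_wpM2l//.
  by rewrite (le_trans ler01)// heat_rpow_const_ge1.
rewrite /rpow sqnorm_vsub0; apply: ler_powRN => //.
  by rewrite ltr_wpDl ?sqnorm_ge0// mulr_gt0.
by rewrite lerD2l lerDr.
Unshelve. all: by end_near. Qed.

Lemma riesz_reg_ge0 rho x : 0 <= riesz_reg rho x.
Proof.
by apply: Rintegral_ge0 => y _; rewrite mulr_ge0 ?heat_kernel_ge0 ?riesz_ge0.
Qed.

Lemma riesz_reg_le (hd : (3 <= d)%N) (rho : R) x : 0 < rho ->
  riesz_reg rho x <= heat_rpow_const d * rpow (2 * rho) 1 x.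
Proof.
move=> rho0; have h := riesz_reg_int_le hd x rho0.
rewrite -lee_fin fineK// ge0_fin_numE; first exact: le_lt_trans h (ltry _).
by apply: integral_ge0 => y _; rewrite lee_fin mulr_ge0 ?heat_kernel_ge0 ?riesz_ge0.
Qed.

Lemma measurable_riesz_reg (rho : R) : measurable_fun setT (@riesz_reg R d rho).
Proof.
apply: (@measurableT_comp _ _ _ _ _ _ fine) => //.
apply: (@measurable_fun_fubini_tonelli_F _ _ _ _ _ (lebesgue_space R d) 
  (fun z : euclidean R d * euclidean R d =>
     (heat_kernel (2 * rho) (vsub z.1 z.2) * riesz z.2)%:E)).
  apply/measurable_EFinP; apply: measurable_funM.
    by apply: measurable_heat_kernel => //; exact: measurable_vsub.
  by apply: (measurableT_comp measurable_riesz).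
by move=> z; rewrite lee_fin mulr_ge0 ?heat_kernel_ge0 ?riesz_ge0.
Qed.

(** Smoothing in y' turns the shift p into [p + t], and smoothing in y adds another t, which is
    given away; each costs one constant. *)
Lemma heat2_rpow_le (hd : (3 <= d)%N) (t p b : R) x x' :
  0 < t -> 0 < p -> 0 <= b <= 5 / 4 ->
  (\int[lebesgue_space R d]_y \int[lebesgue_space R d]_y'
     (heat_kernel t (vsub x y) * heat_kernel t (vsub x' y') * rpow p b (vsub y y'))%:E <=
   (heat_rpow_const d ^+ 2 * rpow (p + t) b (vsub x x'))%:E)%E.
Proof.
move=> t0 p0 b01; set C := heat_rpow_const d.
have C0 : 0 <= C by rewrite (le_trans ler01)// heat_rpow_const_ge1.
have pt0 : 0 < p + t by rewrite addr_gt0.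
pose f (z : euclidean R d * euclidean R d) := 
  (heat_kernel t (vsub x z.1) * heat_kernel t (vsub x' z.2) * rpow p b (vsub z.1 z.2))%:E.
have mf : measurable_fun setT f.
  apply/measurable_EFinP; apply: measurable_funM; last first.
    by apply: measurable_rpow; exact: measurable_vsub.
  apply: measurable_funM; apply: measurable_heat_kernel => //.
    by apply: (measurableT_comp (measurable_vsubr x)).
  by apply: (measurableT_comp (measurable_vsubr x')).
have f0 z : (0 <= f z)%E.
  by rewrite lee_fin mulr_ge0 ?rpow_ge0// mulr_ge0 ?heat_kernel_ge0.
apply: (@le_trans _ _ (\int[lebesgue_space R d]_y
    (C%:E * (heat_kernel t (vsub x y) * rpow (p + t) b (vsub y x'))%:E))%E).
  apply: ge0_le_integral => //.
  - by move=> y _; apply: integral_ge0 => y' _; exact: (f0 (y, y')).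
  - exact: (@measurable_fun_fubini_tonelli_F _ _ _ _ _ _ f).
  - by apply: measurable_funeM; apply/measurable_EFinP; exact: measurable_heat_rpow.
  - move=> y _.
    under eq_integral do rewrite -mulrA EFinM rpow_vsubC.
    rewrite ge0_integralZl_EFin ?heat_kernel_ge0//; last 2 first.
      by move=> y' _; rewrite lee_fin mulr_ge0 ?heat_kernel_ge0 ?rpow_ge0.
      by apply/measurable_EFinP; exact: measurable_heat_rpow.
    rewrite [leRHS](_ : _ = (heat_kernel t (vsub x y))%:E *
      (C * rpow (p + t) b (vsub y x'))%:E)%E; last by rewrite -!EFinM mulrCA.
    apply: lee_wpmul2l; first by rewrite lee_fin heat_kernel_ge0.
    by rewrite (rpow_vsubC _ _ y); exact: heat_rpow_le.
rewrite ge0_integralZl_EFin//; last 2 first.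
  by move=> y _; rewrite lee_fin mulr_ge0 ?heat_kernel_ge0 ?rpow_ge0.
  by apply/measurable_EFinP; exact: measurable_heat_rpow.
rewrite expr2 -mulrA [leRHS]EFinM lee_wpmul2l ?lee_fin//.
apply: le_trans (heat_rpow_le hd x x' t0 pt0 b01) _.
rewrite lee_fin ler_wpM2l//; apply: ler_powRN => //; last by lra.
by rewrite ltr_wpDl ?sqnorm_ge0.
by lra.
Qed.

End riesz_reg_bounds.

(** * The Duhamel operator on two-point functions *)

Notation spacetime R d :=
  (measurableTypeR R * (euclidean R d * euclidean R d))%type.

Section duhamel.
Context {R : realType} {d : nat} (rho : R).
Implicit Types (x y : euclidean R d) (t : R).


Definition space2_measure := sigma_prod (lebesgue_space R d) (lebesgue_space R d).
HB.instance Definition _ := SigmaFiniteMeasure.on space2_measure.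

Definition spacetime_measure := sigma_prod (@lebesgue_measure R) space2_measure.
HB.instance Definition _ := SigmaFiniteMeasure.on spacetime_measure.

(** The time cut-off belongs to the kernel, so that [duhamel] integrates over all of space-time and
    the heat kernel at times [t - s <= 0] never enters. *)
Definition pair_kernel t x x' (z : spacetime R d) : R :=
  if 0 < z.1 < t then
    heat_kernel (t - z.1) (vsub x z.2.1) * heat_kernel (t - z.1) (vsub x' z.2.2)
      * riesz_reg rho (vsub z.2.1 z.2.2)
  else 0.

Definition duhamel t x x' (w : spacetime R d -> R) : \bar R :=
  (\int[spacetime_measure]_z (pair_kernel t x x' z * w z)%:E)%E.

Lemma pair_kernel_ge0 t x x' z : 0 <= pair_kernel t x x' z.
Proof.
rewrite /pair_kernel; case: ifP => // _.
by rewrite mulr_ge0 ?riesz_reg_ge0// mulr_ge0 ?heat_kernel_ge0.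
Qed.

Lemma measurable_fst_gt (a : R) : measurable_fun setT (fun z : spacetime R d => a < z.1).
Proof. by apply: (@measurable_fun_ltr _ _ _ setT (cst a) (@fst _ _)). Qed.

Lemma measurable_fst_lt (a : R) : measurable_fun setT (fun z : spacetime R d => z.1 < a).
Proof. by apply: (@measurable_fun_ltr _ _ _ setT (@fst _ _) (cst a)). Qed.

Lemma measurable_fst_itv t : measurable_fun setT (fun z : spacetime R d => 0 < z.1 < t).
Proof.
by apply: measurable_and; [exact: measurable_fst_gt|exact: measurable_fst_lt].
Qed.

Lemma measurable_spacetime1 : measurable_fun setT (fun z : spacetime R d => z.2.1).
Proof. exact: (measurableT_comp measurable_fst measurable_snd). Qed.

Lemma measurable_spacetime2 : measurable_fun setT (fun z : spacetime R d => z.2.2).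
Proof. exact: (measurableT_comp measurable_snd measurable_snd). Qed.

Lemma measurable_pair_kernel t x x' : measurable_fun setT (pair_kernel t x x').
Proof.
have m1 := measurable_spacetime1; have m2 := measurable_spacetime2.
have mt : measurable_fun setT (fun z : spacetime R d => t - z.1).
  by apply: measurable_funB => //; exact: measurable_fst.
apply: measurable_fun_ifT => //; first exact: measurable_fst_itv.
apply: measurable_funM; last first.
  by apply: (measurableT_comp (measurable_riesz_reg rho)); exact: measurable_vsub.
by apply: measurable_funM; apply: measurable_heat_kernel => //; exact: measurable_vsub.
Qed.

(** Reduces a Duhamel estimate to a bound at each fixed time. The slice bound is asked for in the
    open interval only; the result is over the closed one, where [integral_powR_affine] evaluates
    it. *)
Lemma spacetime_integral_le t (f : spacetime R d -> R) (g : R -> R) :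
  measurable_fun setT f -> (forall z, 0 <= f z) ->
  (forall s yy, ~~ (0 < s < t) -> f (s, yy) = 0) ->
  measurable_fun setT (g : measurableTypeR R -> R) ->
  (forall s, 0 < s < t -> (\int[lebesgue_space R d]_y \int[lebesgue_space R d]_y'
     (f (s, (y, y')))%:E <= (g s)%:E)%E) ->
  (forall s, 0 <= s <= t -> 0 <= g s) ->
  (\int[spacetime_measure]_z (f z)%:E <=
   \int[@lebesgue_measure R]_(s in `[0%R, t]) (g s)%:E)%E.
Proof.
move=> mf f0 fout mg fg g0.
have mfE : measurable_fun setT (EFin \o f) by exact/measurable_EFinP.
have f0E z : (0 <= (EFin \o f) z)%E by rewrite lee_fin.
rewrite tonelli1// [leRHS]integral_mkcond.
apply: ge0_le_integral => //.
- by move=> s _; apply: integral_ge0 => yy _; exact: (f0E (s, yy)).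
- exact: (measurable_tonelli1 _ mfE f0E).
- apply/(measurable_restrictT _ _).1 => //; apply: measurable_funTS.
  exact/measurable_EFinP.
- move=> s _; rewrite patchE.
  have [st|st] := boolP (0 < s < t).
    have /andP[s0 s1] := st.
    rewrite mem_set/=; last by rewrite in_itv/= !ltW.
    apply: le_trans (fg _ st).
    rewrite (@tonelli1 _ _ _ _ _ _ _ (fun yy => ((f (s, yy))%:E)))//.
      by apply: (measurableT_comp mfE); exact: pair1_measurable.
    by move=> yy; rewrite lee_fin.
  rewrite integral0_eq; last by move=> yy _ /=; rewrite fout.
  case: ifP => // /set_mem/=; rewrite in_itv/= => sin.
  by rewrite lee_fin g0.
Qed.

Lemma le_duhamel t x x' (w1 w2 : spacetime R d -> R) :
  measurable_fun setT w1 -> measurable_fun setT w2 ->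
  (forall z, 0 < z.1 < t -> 0 <= w1 z <= w2 z) ->
  (duhamel t x x' w1 <= duhamel t x x' w2)%E.
Proof.
move=> m1 m2 w12; apply: ge0_le_integral => //.
- move=> z _; rewrite lee_fin /pair_kernel; case: ifPn => [zt|]; last by rewrite mul0r.
  have /andP[w0 _] := w12 z zt; rewrite mulr_ge0//.
  by rewrite mulr_ge0 ?riesz_reg_ge0// mulr_ge0 ?heat_kernel_ge0.
- by apply/measurable_EFinP; apply: measurable_funM => //; exact: measurable_pair_kernel.
- by apply/measurable_EFinP; apply: measurable_funM => //; exact: measurable_pair_kernel.
- move=> z _; rewrite lee_fin /pair_kernel; case: ifPn => [zt|]; last by rewrite !mul0r.
  have /andP[_ w0] := w12 z zt; rewrite ler_wpM2l//.
  by rewrite mulr_ge0 ?riesz_reg_ge0// mulr_ge0 ?heat_kernel_ge0.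
Qed.

Lemma duhamelDZ t x x' (w1 w2 : spacetime R d -> R) (k : R) : 0 <= k ->
  measurable_fun setT w1 -> measurable_fun setT w2 ->
  (forall z, 0 <= w1 z) -> (forall z, 0 <= w2 z) ->
  (duhamel t x x' (fun z => w1 z + k * w2 z)%R =
   duhamel t x x' w1 + k%:E * duhamel t x x' w2)%E.
Proof.
move=> k0 m1 m2 w10 w20; have mk := measurable_pair_kernel t x x'.
have kw w : (forall z, 0 <= w z) -> forall z, 0 <= pair_kernel t x x' z * w z.
  by move=> w0 z; rewrite mulr_ge0 ?pair_kernel_ge0.
rewrite /duhamel -ge0_integralZl_EFin//; last 2 first.
  by move=> z _; rewrite lee_fin kw.
  by apply/measurable_EFinP; exact: measurable_funM.
rewrite -ge0_integralD//; last 4 first.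
  by move=> z _; rewrite lee_fin kw.
  by apply/measurable_EFinP; exact: measurable_funM.
  by move=> z _; rewrite mule_ge0 ?lee_fin ?kw.
  by apply: measurable_funeM; apply/measurable_EFinP; exact: measurable_funM.
by apply: eq_integral => z _; rewrite -EFinM -EFinD mulrDr (mulrCA k).
Qed.

Hypothesis (hd : (3 <= d)%N) (hrho : 0 < rho).
Notation C := (heat_rpow_const d : R).

Let C0 : 0 <= C.
Proof. by rewrite (le_trans ler01)// heat_rpow_const_ge1. Qed.

(** The shift [2 * rho] is weakened to [rho] so that the kernel and the barrier involve the same
    [rad2]. *)
Lemma riesz_reg_le_rpow x : riesz_reg rho x <= C * rpow rho 1 x.
Proof.
apply: le_trans (riesz_reg_le hd x hrho) _; rewrite ler_wpM2l//.
apply: ler_powRN => //; first by rewrite ltr_wpDl ?sqnorm_ge0.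
by have h := hrho; rewrite lerD2l; lra.
Qed.

Lemma riesz_reg_le_cst x : riesz_reg rho x <= C / rho.
Proof.
apply: le_trans (riesz_reg_le_rpow x) _; rewrite ler_wpM2l//.
rewrite -powR_inv1 ?(ltW hrho)// /rpow; apply: ler_powRN => //.
by rewrite lerDr sqnorm_ge0.
Qed.

Definition rad2 (z : spacetime R d) : R := sqnorm (vsub z.2.1 z.2.2) + rho.

Lemma rad2_gt0 z : 0 < rad2 z.
Proof. by rewrite ltr_wpDl ?sqnorm_ge0. Qed.

Lemma measurable_rad2 : measurable_fun setT rad2.
Proof.
apply: measurable_funD => //; apply: measurable_sqnorm.
by apply: measurable_vsub; [exact: measurable_spacetime1|exact: measurable_spacetime2].
Qed.

(** Separates the barrier into a constant and a pure power, the only shapes that [heat2_rpow_le] can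
    smooth. *)
Lemma powR1D_le (v a : R) : 0 <= v -> 0 <= a <= 1 ->
  (1 + v) `^ a <= 2 * (1 + v `^ a).
Proof.
move=> v0 /andP[a0 a1]; have h2 : 2 `^ a <= 2 :> R by rewrite ler1_powR//; lra.
have [v1|v1] := leP v 1.
  apply: (@le_trans _ _ (2 `^ a)); first by rewrite ge0_ler_powR ?nnegrE; lra.
  by have := powR_ge0 v a; lra.
apply: (@le_trans _ _ ((2 * v) `^ a)); first by rewrite ge0_ler_powR ?nnegrE; lra.
by rewrite powRM//; have := powR_ge0 v a; nra.
Qed.

Definition barrier (a : R) (z : spacetime R d) : R := (1 + z.1 / rad2 z) `^ a.

Lemma measurable_barrier a : measurable_fun setT (barrier a).
Proof.
apply: (measurableT_comp (measurable_powR _)); apply: measurable_funD => //.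
apply: measurable_funM; first exact: measurable_fst.
by apply: measurable_invr; exact: measurable_rad2.
Qed.

(** By [powR1D_le], kernel times barrier splits into [rpow] of exponents 1 and 1 + a; [a <= 1 / 4]
    keeps both within the range of [heat2_rpow_le]. The time integral of [(q + t - s)^(-a-1)] is at
    most [q^-a / a], which together with [(q + t)^a] rebuilds the barrier at the endpoint. *)
Lemma duhamel_barrier_le (a t : R) x x' : 0 < a <= 1 / 4 -> 0 <= t ->
  (duhamel t x x' (barrier a) <= (4 * C ^+ 3 / a * barrier a (t, (x, x')))%:E)%E.
Proof.
move=> /andP[a0 a1] t0; set q := rad2 (t, (x, x')).
have q0 : 0 < q := rad2_gt0 _.
set K := 4 * C ^+ 3; have K0 : 0 <= K := mulr_ge0 (ler0n _ 4) (exprn_ge0 3 C0).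
(* A common bound for the two smoothed terms. In K, one C comes from the Riesz kernel and [C^2] from
   the double smoothing; 4 is 2 from [powR1D_le] times 2 for adding the terms. *)
pose g s := K * (q + t) `^ a * (-1 * s + (q + t)) `^ (- a - 1).
have qt0 : 0 < q + t by lra.
apply: (@le_trans _ _ (\int[@lebesgue_measure R]_(s in `[0%R, t]) (g s)%:E)%E).
  apply: spacetime_integral_le.
  - by apply: measurable_funM; [exact: measurable_pair_kernel|exact: measurable_barrier].
  - by move=> z; rewrite mulr_ge0 ?pair_kernel_ge0 ?powR_ge0.
  - by move=> s yy st; rewrite /pair_kernel (negbTE st) mul0r.
  - apply: measurable_funM => //; apply: (measurableT_comp (measurable_powR _)).
    by apply: measurable_funD => //; exact: measurable_funM.
  - move=> s st; have /andP[s0 s1] := st.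
    have ts0 : 0 < t - s by lra.
    pose h b (y y' : euclidean R d) := heat_kernel (t - s) (vsub x y) *
      heat_kernel (t - s) (vsub x' y') * rpow rho b (vsub y y').
    have h0 b y y' : 0 <= h b y y'.
      by rewrite mulr_ge0 ?rpow_ge0// mulr_ge0 ?heat_kernel_ge0.
    have mh b : measurable_fun setT (fun z : euclidean R d * euclidean R d => h b z.1 z.2).
      apply: measurable_funM; last by apply: measurable_rpow; exact: measurable_vsub.
      by apply: measurable_funM; apply: measurable_heat_kernel => //; exact: measurable_vsub.
    pose hE b (z : euclidean R d * euclidean R d) := (h b z.1 z.2)%:E.
    have mhE b : measurable_fun setT (hE b) by exact/measurable_EFinP.
    have h0E b z : (0 <= hE b z)%E by rewrite lee_fin.
    pose f yy := (pair_kernel t x x' (s, yy) * barrier a (s, yy))%:E.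
    have mf : measurable_fun setT f.
      apply: (measurableT_comp (f := EFin \o (fun z => pair_kernel t x x' z * barrier a z))).
        apply/measurable_EFinP; apply: measurable_funM.
          exact: measurable_pair_kernel.
        exact: measurable_barrier.
      exact: pair1_measurable.
    have f0 z : (0 <= f z)%E by rewrite lee_fin mulr_ge0 ?pair_kernel_ge0 ?powR_ge0.
    rewrite -(tonelli1 _ _ mf f0).
    pose E z := ((2 * C)%:E * (hE 1%R z + (s `^ a)%:E * hE (1 + a)%R z))%E.
    apply: (@le_trans _ _ (\int[space2_measure]_z E z)%E).
      apply: ge0_le_integral => //.
      + apply: measurable_funeM; apply: emeasurable_funD => //.
        exact: measurable_funeM.
      + move=> [y y'] _; rewrite /E /f /hE /= /pair_kernel/= st /barrier/=.
        rewrite -[X in (_ <= _ * (_ + X))%E]EFinM -[X in (_ <= _ * X)%E]EFinD.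
        rewrite -EFinM lee_fin.
        set p := rad2 (s, (y, y')); have p0 : 0 < p := rad2_gt0 _.
        have -> : h (1 + a) y y' = h 1 y y' * p `^ (- a).
          rewrite /h -[RHS]mulrA; congr (_ * _).
          rewrite /rpow -/p -powRD ?(gt_eqF p0) ?implybT//.
          by congr (_ `^ _); ring.
        have bar : (1 + s / p) `^ a <= 2 * (1 + s `^ a * p `^ (- a)).
          apply: le_trans (powR1D_le _ _) _; [exact: divr_ge0 (ltW s0) (ltW p0)|lra|].
          rewrite powRM ?invr_ge0 ?(ltW p0) ?(ltW s0)//.
          by rewrite -(@powR_inv1 _ p) ?(ltW p0)// -powRrM mulN1r.
        have -> : 2 * C * (h 1 y y' + s `^ a * (h 1 y y' * p `^ (- a))) =
           (C * h 1 y y') * (2 * (1 + s `^ a * p `^ (- a))) by ring.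
        apply: ler_pM => //.
        * by rewrite mulr_ge0 ?riesz_reg_ge0// mulr_ge0 ?heat_kernel_ge0.
        * exact: powR_ge0.
        * rewrite /h [leRHS]mulrCA; apply: ler_wpM2l; last exact: riesz_reg_le_rpow.
          by rewrite mulr_ge0 ?heat_kernel_ge0.
    have sa0 : 0 <= s `^ a := powR_ge0 _ _.
    rewrite ge0_integralZl_EFin//; last 3 first.
      by move=> z _; apply: adde_ge0 => //; apply: mule_ge0; rewrite // lee_fin.
      by apply: emeasurable_funD => //; exact: measurable_funeM.
      exact: mulr_ge0 (ler0n _ 2) C0.
    rewrite ge0_integralD//; last 2 first.
      by move=> z _; rewrite mule_ge0 ?lee_fin.
      exact: measurable_funeM.
    rewrite ge0_integralZl_EFin// !tonelli1//.
    have b1 : 0 <= (1 : R) <= 5 / 4 by lra.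
    have b2 : 0 <= 1 + a <= 5 / 4 by lra.
    have I1 := heat2_rpow_le hd x x' ts0 hrho b1.
    have I2 := heat2_rpow_le hd x x' ts0 hrho b2.
    apply: (@le_trans _ _ ((2 * C)%:E * ((C ^+ 2 * rpow (rho + (t - s)) 1 (vsub x x'))%:E
        + (s `^ a)%:E * (C ^+ 2 * rpow (rho + (t - s)) (1 + a) (vsub x x'))%:E))%E).
      apply: lee_wpmul2l; first by rewrite lee_fin mulr_ge0.
      by apply: leeD => //; apply: lee_wpmul2l => //; rewrite lee_fin.
    rewrite -[X in (_ * (_ + X))%E]EFinM -[X in (_ * X)%E]EFinD -EFinM lee_fin.
    rewrite /rpow !addrA -/(rad2 (t, (x, x'))) -/q.
    set v := q + t - s; have v0 : 0 < v by rewrite /v; lra.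
    rewrite /g (_ : -1 * s + (q + t) = v); last by rewrite /v; ring.
    have -> : - (1 + a) = - a - 1 by ring.
    set V := v `^ (- a - 1).
    have V0 : 0 <= V := powR_ge0 _ _.
    have -> : v `^ (- 1) = v `^ a * V.
      by rewrite -powRD ?(gt_eqF v0) ?implybT//; congr (_ `^ _); ring.
    have va : v `^ a <= (q + t) `^ a.
      by apply: ge0_ler_powR; rewrite ?nnegrE /v ?ltW//; clear -s0; lra.
    have sa : s `^ a <= (q + t) `^ a.
      by apply: ge0_ler_powR; rewrite ?nnegrE ?ltW//; clear -s1 q0; lra.
    have CV0 : 0 <= 2 * C ^+ 3 * V := mulr_ge0 (mulr_ge0 (ler0n _ 2) (exprn_ge0 3 C0)) V0.
    rewrite [leLHS](_ : _ = 2 * C ^+ 3 * V * (v `^ a + s `^ a)); last by ring.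
    rewrite [leRHS](_ : _ = 2 * C ^+ 3 * V * (2 * (q + t) `^ a)); last by rewrite /K; ring.
    by apply: (ler_wpM2l CV0); clear -va sa; lra.
  - by move=> s _; exact: mulr_ge0 (mulr_ge0 K0 (powR_ge0 _ _)) (powR_ge0 _ _).
rewrite /g; under eq_integral do rewrite EFinM.
rewrite ge0_integralZl_EFin//; last 3 first.
  by move=> s _; rewrite lee_fin powR_ge0.
  apply/measurable_EFinP; apply: (measurableT_comp (measurable_powR _)) => /=.
  by apply: measurable_funD => //; exact: measurable_funM.
  exact: mulr_ge0 K0 (powR_ge0 _ _).
rewrite integral_powR_affine; [|by []|lra|lra|by rewrite oppr_eq0 oner_eq0
  |by rewrite oppr_eq0 gt_eqF].
rewrite -EFinM lee_fin /barrier /= -/q.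
have -> : -1 * t + (q + t) = q by ring.
have -> : -1 * 0 + (q + t) = q + t by ring.
have -> : 1 + t / q = (q + t) * q^-1 by field; rewrite gt_eqF.
rewrite powRM ?invr_ge0 ?(ltW qt0) ?(ltW q0)//.
rewrite -(@powR_inv1 _ q) ?(ltW q0)// -powRrM !mulN1r opprK.
set P := (q + t) `^ a; set N := (q + t) `^ (- a).
have P0 : 0 <= P := powR_ge0 _ _.
have N0 : 0 <= N := powR_ge0 _ _.
rewrite [leRHS](_ : _ = K * P * (a^-1 * q `^ (- a))); last by ring.
apply: (ler_wpM2l (mulr_ge0 K0 P0)); apply: ler_wpM2l; last by rewrite gerBl.
by rewrite invr_ge0 ltW.
Qed.

End duhamel.

(** * Comparison of subsolutions with supersolutions *)

Section comparison.
Context {R : realType} {d : nat} (rho : R).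
Implicit Types (x y : euclidean R d) (t : R).
Hypothesis (hd : (3 <= d)%N) (hrho : 0 < rho).
Notation C := (heat_rpow_const d : R).

Let C0 : 0 <= C.
Proof. by rewrite (le_trans ler01)// heat_rpow_const_ge1. Qed.

(** A polynomial in place of the usual exponential weight of a Gronwall argument: integrating it in
    time gains 1/(m+1), which a large m makes as small as needed. *)
Definition growth (m : R) (z : spacetime R d) : R := (1 + z.1) `^ m.

Lemma measurable_growth m : measurable_fun setT (growth m).
Proof.
by apply: (measurableT_comp (measurable_powR _)); exact: measurable_funD.
Qed.

(** Here the crude bound C / rho of the Riesz kernel is enough, leaving two heat kernels of mass at
    most 1. *)
Lemma duhamel_power_le (m t : R) x x' : 0 < m -> 0 <= t ->
  (duhamel rho t x x' (growth m) <=
   (C / rho * ((1 + t) / (m + 1)) * (1 + t) `^ m)%:E)%E.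
Proof.
move=> m0 t0.
pose g s := C / rho * (1 * s + 1) `^ (m + 1 - 1).
have Cr0 : 0 <= C / rho by rewrite divr_ge0// ltW.
have mpow := measurable_growth m.
apply: (@le_trans _ _ (\int[@lebesgue_measure R]_(s in `[0%R, t]) (g s)%:E)%E).
  apply: (@spacetime_integral_le R d t (fun z => pair_kernel rho t x x' z * growth m z) g).
  - by apply: measurable_funM => //; exact: measurable_pair_kernel.
  - by move=> z; rewrite mulr_ge0 ?pair_kernel_ge0 ?powR_ge0.
  - by move=> s yy st; rewrite /pair_kernel (negbTE st) mul0r.
  - apply: measurable_funM => //; apply: (measurableT_comp (measurable_powR _)).
    by apply: measurable_funD => //; exact: measurable_funM.
  - move=> s st; have /andP[s0 s1] := st.
    have ts0 : 0 < t - s by lra.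
    have gs0 : 0 <= g s by rewrite mulr_ge0 ?powR_ge0.
    pose G z y := heat_kernel (t - s) (vsub z y).
    have G0 z y : (0 <= (G z y)%:E)%E by rewrite lee_fin heat_kernel_ge0.
    have mG z : measurable_fun [set: euclidean R d] (EFin \o G z).
      by apply/measurable_EFinP; apply: measurable_heat_kernel => //; exact: measurable_vsubr.
    pose f yy := (pair_kernel rho t x x' (s, yy) * growth m (s, yy))%:E.
    have mf : measurable_fun setT f.
      apply/measurable_EFinP; apply: measurable_funM.
        by apply: (measurableT_comp (measurable_pair_kernel rho t x x')); exact: pair1_measurable.
      by apply: (measurableT_comp (measurable_growth m)); exact: pair1_measurable.
    have f0 z : (0 <= f z)%E by rewrite lee_fin mulr_ge0 ?pair_kernel_ge0 ?powR_ge0.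
    apply: (@le_trans _ _ (\int[lebesgue_space R d]_y ((g s)%:E * (G x y)%:E))%E).
      apply: ge0_le_integral; first exact: measurableT.
      + by move=> y _; apply: integral_ge0 => y' _; exact: (f0 (y, y')).
      + exact: (measurable_tonelli1 _ mf f0).
      + by apply: measurable_funeM; exact: mG.
      + move=> y _.
        apply: (@le_trans _ _ (\int[lebesgue_space R d]_y' ((g s * G x y)%:E * (G x' y')%:E))%E).
          apply: ge0_le_integral; first exact: measurableT.
          * by move=> y' _; exact: (f0 (y, y')).
          * by apply: (measurableT_comp mf); exact: pair1_measurable.
          * by apply: measurable_funeM; exact: mG.
          * move=> y' _; rewrite -EFinM lee_fin /growth /pair_kernel/= st.
            rewrite -/(G x y) -/(G x' y').
            rewrite [leRHS](_ : _ = G x y * G x' y' * (C / rho) * (1 + s) `^ m); last first.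
              by rewrite /g mul1r addrK (addrC s); ring.
            rewrite ler_wpM2r ?powR_ge0//; apply: ler_wpM2l; last exact: riesz_reg_le_cst.
            by rewrite mulr_ge0 ?heat_kernel_ge0.
        have gG0 : 0 <= g s * G x y by rewrite mulr_ge0 ?heat_kernel_ge0.
        rewrite ge0_integralZl_EFin//; last exact: mG.
        apply: (@le_trans _ _ ((g s * G x y)%:E * 1)%E); last by rewrite mule1 EFinM.
        apply: lee_wpmul2l; first by rewrite lee_fin.
        exact: integral_heat_kernel_le1.
    rewrite ge0_integralZl_EFin//; last exact: mG.
    apply: (@le_trans _ _ ((g s)%:E * 1)%E); last by rewrite mule1.
    apply: lee_wpmul2l; first by rewrite lee_fin.
    exact: integral_heat_kernel_le1.
  - by move=> s _; rewrite mulr_ge0 ?powR_ge0.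
rewrite /g; under eq_integral do rewrite EFinM.
rewrite ge0_integralZl_EFin//; last 2 first.
  by move=> s _; rewrite lee_fin powR_ge0.
  apply/measurable_EFinP; apply: (measurableT_comp (measurable_powR _)) => /=.
  by apply: measurable_funD => //; exact: measurable_funM.
rewrite integral_powR_affine; [|by []|lra|lra|exact: oner_neq0|by rewrite gt_eqF; lra].
rewrite -EFinM lee_fin -[leRHS]mulrA; apply: ler_wpM2l => //.
rewrite !mul1r add0r powR1 (addrC t) powRD; last first.
  by rewrite (@gt_eqF _ _ (1 + t) 0) ?implybT// ltr_wpDr.
rewrite powRr1; last by rewrite addr_ge0.
set P := (1 + t) `^ m; have P0 : 0 <= P := powR_ge0 _ _.
rewrite [leRHS](_ : _ = (m + 1)^-1 * (P * (1 + t))); last by ring.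
rewrite ler_wpM2l ?invr_ge0//; last by rewrite gerBl.
by rewrite addr_ge0// ltW.
Qed.

(** Relative to the weight [growth m], the operator k times Duhamel halves the excess of w over H.
    Starting from the bound M and iterating leaves an excess [|M| 2^-n growth m]; so M and m, which
    may depend badly on rho, vanish from the conclusion. *)
Lemma comparison (k T M : R) (w H : spacetime R d -> R) : 0 <= k -> 0 <= T ->
  measurable_fun setT w -> measurable_fun setT H ->
  (forall z, 0 <= w z) -> (forall z, 0 <= H z) ->
  (forall t x x', 0 <= t <= T -> w (t, (x, x')) <= M) ->
  (forall t x x', 0 <= t <= T ->
     ((w (t, (x, x')))%:E <= 1 + k%:E * duhamel rho t x x' w)%E) ->
  (forall t x x', 0 <= t <= T ->
     (1 + k%:E * duhamel rho t x x' H <= (H (t, (x, x')))%:E)%E) ->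
  forall t x x', 0 <= t <= T -> w (t, (x, x')) <= H (t, (x, x')).
Proof.
move=> k0 T0 mw mH w0 H0 wM wD HD.
have Cr0 : 0 <= C / rho by rewrite divr_ge0// ltW.
(* Ensures that [k * (C / rho) * (1 + t) / (m + 1)] is at most 1/2 up to time T. *)
pose m := 2 * (k * (C / rho) * (1 + T)) + 1.
have kC0 : 0 <= k * (C / rho) * (1 + T).
  exact: mulr_ge0 (mulr_ge0 k0 Cr0) (addr_ge0 ler01 T0).
have m0 : 0 < m by rewrite /m; lra.
pose N := `|M|.
have g0 z : 0 <= growth m z by exact: powR_ge0.
have mg := measurable_growth m.
have E0 n : 0 <= N * 2^-1 ^+ n.
  by apply: mulr_ge0; [exact: normr_ge0|apply: exprn_ge0; rewrite invr_ge0].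
have step n : forall t x x', 0 <= t <= T ->
    w (t, (x, x')) <= H (t, (x, x')) + N * 2^-1 ^+ n * growth m (t, (x, x')).
  elim: n => [|n IH] t x x' tT; have /andP[t0 t1] := tT.
    rewrite expr0 mulr1 (le_trans (wM t x x' tT))// (le_trans (ler_norm _))//.
    rewrite ler_wpDl// ler_peMr// /growth/= -[leLHS](@powRr0 _ (1 + t)).
    by rewrite ler_powR ?(ltW m0)//; lra.
  rewrite -lee_fin; apply: le_trans (wD t x x' tT) _.
  pose v z := H z + N * 2^-1 ^+ n * growth m z.
  have Dle : (duhamel rho t x x' w <= duhamel rho t x x' v)%E.
    apply: le_duhamel => //.
      by apply: measurable_funD => //; exact: measurable_funM.
    move=> [s [y y']] /= /andP[s0 s1]; rewrite w0/=; apply: IH.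
    by rewrite ltW//= (le_trans (ltW s1)).
  rewrite /v duhamelDZ// in Dle.
  apply: (@le_trans _ _ (1 + k%:E * (duhamel rho t x x' H +
      (N * 2^-1 ^+ n)%:E * duhamel rho t x x' (growth m)))%E).
    by rewrite leeD2l// lee_wpmul2l.
  have DH0 : (0 <= duhamel rho t x x' H)%E.
    by apply: integral_ge0 => z _; rewrite lee_fin mulr_ge0 ?pair_kernel_ge0.
  have Dg0 : (0 <= duhamel rho t x x' (growth m))%E.
    by apply: integral_ge0 => z _; rewrite lee_fin mulr_ge0 ?pair_kernel_ge0.
  rewrite ge0_muleDr// ?mule_ge0 ?lee_fin// addeA EFinD leeD//; first exact: HD.
  apply: (@le_trans _ _ (k%:E * ((N * 2^-1 ^+ n)%:E *
    (C / rho * ((1 + t) / (m + 1)) * (1 + t) `^ m)%:E))%E).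
    by rewrite lee_wpmul2l// lee_wpmul2l ?lee_fin//; exact: duhamel_power_le.
  rewrite -!EFinM lee_fin exprSr /growth/=.
  rewrite [leLHS](_ : _ = N * 2^-1 ^+ n * (1 + t) `^ m * (k * (C / rho) * (1 + t) / (m + 1))); last by ring.
  rewrite [leRHS](_ : _ = N * 2^-1 ^+ n * (1 + t) `^ m * 2^-1); last by ring.
  apply: ler_wpM2l; first by rewrite mulr_ge0 ?powR_ge0.
  rewrite ler_pdivrMr; last by lra.
  have : k * (C / rho) * (1 + t) <= k * (C / rho) * (1 + T).
    by apply: (ler_wpM2l (mulr_ge0 k0 Cr0)); rewrite lerD2l.
  by rewrite /m; lra.
move=> t x x' tT; have /andP[t0 t1] := tT.
rewrite leNgt; apply/negP => Hw.
pose D := N * growth m (t, (x, x')).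
have D0 : 0 <= D := mulr_ge0 (normr_ge0 _) (g0 _).
pose e := w (t, (x, x')) - H (t, (x, x')).
have e0 : 0 < e by rewrite subr_gt0.
(* With [n <= 2^n], the Archimedean property makes [D 2^-n] smaller than the supposed gap e. *)
have [n Dn] : exists n : nat, D / e < n%:R.
  by exists (Num.bound (D / e)); rewrite archi_boundP// divr_ge0// ltW.
have n2 : n%:R <= 2 ^+ n :> R by rewrite -natrX ler_nat ltnW// ltn_expl.
have := step n t x x' tT.
rewrite -lerBlDl -/e mulrAC -/D exprVn ler_pdivlMr ?exprn_gt0//.
apply/negP; rewrite -ltNge -ltr_pdivrMl// mulrC.
exact: lt_le_trans n2.
Qed.
End comparison.

(** * Supersolutions and the bound uniform in rho *)

Section moment_bound.
Context {R : realType} {d : nat}.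

(** The factor 2 makes room for the source term 1: the condition on k brings the Duhamel term below
    one barrier, and the barrier is at least 1. *)
Lemma barrier_supersolution (rho a k T t : R) (x x' : euclidean R d) :
  (3 <= d)%N -> 0 < rho -> 0 < a <= 1 / 4 -> 0 <= k ->
  8 * heat_rpow_const d ^+ 3 * k <= a -> 0 <= t ->
  (1 + k%:E * duhamel rho t x x' (fun z => (2 * barrier rho a z)%R) <=
   (2 * barrier rho a (t, (x, x')))%:E)%E.
Proof.
move=> hd rho0 a01 k0 ka t0; have /andP[a0 a1] := a01.
set b := barrier rho a (t, (x, x')).
have b1 : 1 <= b.
  rewrite /b /barrier -[leLHS](powRr0 (1 + t / rad2 rho (t, (x, x')))).
  by rewrite ler_powR ?(ltW a0)// lerDl divr_ge0// ltW// rad2_gt0.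
have -> : duhamel rho t x x' (fun z => (2 * barrier rho a z)%R) =
    (2%:E * duhamel rho t x x' (barrier rho a))%E.
  rewrite /duhamel -ge0_integralZl_EFin//; last 2 first.
    by move=> z _; rewrite lee_fin mulr_ge0 ?pair_kernel_ge0 ?powR_ge0.
    apply/measurable_EFinP; apply: measurable_funM.
      exact: measurable_pair_kernel.
    exact: measurable_barrier.
  by apply: eq_integral => z _; rewrite -EFinM mulrCA.
have h := duhamel_barrier_le hd rho0 x x' a01 t0; rewrite -/b in h.
apply: (@le_trans _ _ (1 + k%:E * (2%:E * (4 * heat_rpow_const d ^+ 3 / a * b)%:E))%E).
  by rewrite leeD2l// lee_wpmul2l// lee_wpmul2l.
rewrite -[X in (_ * X)%E]EFinM -EFinM -EFinD lee_fin.
have -> : k * (2 * (4 * heat_rpow_const d ^+ 3 / a * b)) =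
   (8 * heat_rpow_const d ^+ 3 * k) / a * b by ring.
have : (8 * heat_rpow_const d ^+ 3 * k) / a <= 1 by rewrite ler_pdivrMr ?mul1r.
move: (_ / a) => y y1; nra.
Qed.

(** The counterpart for rho bounded away from 0, where a factor C / rho is affordable. *)
Lemma growth_supersolution (rho m k T t : R) (x x' : euclidean R d) :
  (3 <= d)%N -> 0 < rho -> 0 < m -> 0 <= k -> 0 <= t <= T ->
  2 * (k * (heat_rpow_const d / rho) * (1 + T)) <= m ->
  (1 + k%:E * duhamel rho t x x' (fun z => (2 * growth m z)%R) <=
   (2 * growth m (t, (x, x')))%:E)%E.
Proof.
move=> hd rho0 m0 k0 /andP[t0 tT] km.
set b := growth m (t, (x, x')); set c := heat_rpow_const d / rho in km *.
have c0 : 0 <= c.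
  by rewrite /c divr_ge0 ?(ltW rho0)// (le_trans ler01)// heat_rpow_const_ge1.
have b1 : 1 <= b.
  by rewrite /b /growth -[leLHS](powRr0 (1 + t)) ler_powR ?(ltW m0)//= lerDl.
have -> : duhamel rho t x x' (fun z => (2 * growth m z)%R) =
    (2%:E * duhamel rho t x x' (growth m))%E.
  rewrite /duhamel -ge0_integralZl_EFin//; last 2 first.
    by move=> z _; rewrite lee_fin mulr_ge0 ?pair_kernel_ge0 ?powR_ge0.
    apply/measurable_EFinP; apply: measurable_funM.
      exact: measurable_pair_kernel.
    exact: measurable_growth.
  by apply: eq_integral => z _; rewrite -EFinM mulrCA.
have h := duhamel_power_le hd rho0 x x' m0 t0; rewrite -/c -/b in h.
apply: (@le_trans _ _ (1 + k%:E * (2%:E * (c * ((1 + t) / (m + 1)) * b)%:E))%E).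
  by rewrite leeD2l// lee_wpmul2l// lee_wpmul2l.
rewrite -[X in (_ * X)%E]EFinM -EFinM -EFinD lee_fin.
have -> : k * (2 * (c * ((1 + t) / (m + 1)) * b)) =
   (2 * (k * c * (1 + t))) / (m + 1) * b by ring.
have kct : k * c * (1 + t) <= k * c * (1 + T).
  by apply: (ler_wpM2l (mulr_ge0 k0 c0)); rewrite lerD2l.
have : (2 * (k * c * (1 + t))) / (m + 1) <= 1.
  rewrite ler_pdivrMr ?mul1r; first by clear -kct km; lra.
  by clear -m0; lra.
move: (_ / (m + 1)) => y y1; clear -y1 b1; nra.
Qed.

Lemma moment_bound (hd : (3 <= d)%N) (beta T rho0 : R) :
  0 < beta -> 0 < T -> 0 < rho0 < 1 ->
  exists B : R, forall rho : R, 0 < rho <= rho0 ->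
  forall (w : spacetime R d -> R) (M : R),
    measurable_fun setT w -> (forall z, 0 <= w z) ->
    (forall t x x', 0 <= t <= T -> w (t, (x, x')) <= M) ->
    (forall t x x', 0 <= t <= T -> ((w (t, (x, x')))%:E <=
       1 + (beta ^+ 2 / ln rho^-1)%:E * duhamel rho t x x' w)%E) ->
  forall t x, 0 <= t <= T -> w (t, (x, x)) <= B.
Proof.
move=> beta0 T0 /andP[r00 r01].
set C := heat_rpow_const d : R.
have C1 : 1 <= C := heat_rpow_const_ge1 _.
have C3 : 1 <= C ^+ 3 by rewrite exprn_ege1.
(* For [a = 8 C^3 k], the requirement [a <= 1 / 4] of the barrier reads [L <= ln rho^-1]; the two
   regimes are separated at [rho = exp (- L)]. *)
pose L := 32 * C ^+ 3 * beta ^+ 2.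
have b20 : 0 < beta ^+ 2 by rewrite exprn_gt0.
have lnr0 : 0 < ln rho0^-1 by rewrite ln_gt0// invf_gt1.
have C0 : 0 <= C := le_trans ler01 C1.
have T1 : 0 <= 1 + T by clear -T0; lra.
(* Uniform over the second regime: there [rho^-1 <= exp L], while [rho <= rho0] bounds k. *)
pose m := 2 * ((beta ^+ 2 / ln rho0^-1) * (C * expR L) * (1 + T)) + 1.
have m0 : 0 < m.
  apply: ltr_wpDl => //; apply: mulr_ge0 => //; apply: mulr_ge0 => //.
  apply: mulr_ge0; first by rewrite divr_ge0// ltW.
  by rewrite mulr_ge0// expR_ge0.
exists (2 * (1 + T) * expR (8 * C ^+ 3 * beta ^+ 2) + 2 * (1 + T) `^ m).
move=> rho /andP[rho_gt0 rhole] w M mw w0 wM wD t x tT.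
have /andP[t0 t1] := tT.
have lnle : ln rho0^-1 <= ln rho^-1.
  by rewrite ler_ln ?posrE ?invr_gt0// lef_pV2 ?posrE.
have ln0 : 0 < ln rho^-1 by exact: lt_le_trans lnle.
set k := beta ^+ 2 / ln rho^-1 in wD.
have k0 : 0 < k by rewrite divr_gt0.
have [Lle|Lgt] := leP L (ln rho^-1).
  pose a := 8 * C ^+ 3 * k.
  have a0 : 0 < a by rewrite mulr_gt0// mulr_gt0//; exact: lt_le_trans C3.
  have a1 : a <= 1 / 4.
    rewrite /a /k mulrA ler_pdivrMr//; move: Lle; rewrite /L; clear; lra.
  have a01 : 0 < a <= 1 / 4 by rewrite a0.
  pose H (z : spacetime R d) := 2 * barrier rho a z.
  have mH : measurable_fun setT H by apply: measurable_funM => //; exact: measurable_barrier.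
  have H0 z : 0 <= H z by rewrite mulr_ge0 ?powR_ge0.
  have HD s y y' : 0 <= s <= T ->
      (1 + k%:E * duhamel rho s y y' H <= (H (s, (y, y')))%:E)%E.
    by move=> /andP[s0 _]; apply: barrier_supersolution => //; exact: ltW.
  apply: le_trans (comparison hd rho_gt0 (ltW k0) (ltW T0) mw mH w0 H0 wM wD HD x x tT) _.
  apply: (@le_trans _ _ (2 * (1 + T) * expR (8 * C ^+ 3 * beta ^+ 2))); last first.
    by rewrite lerDl mulr_ge0 ?powR_ge0.
  rewrite /H -mulrA; apply: ler_wpM2l => //.
  rewrite /barrier /rad2 /=.
  have -> : sqnorm (vsub x x) = 0.
    by apply: big1 => i _; rewrite tnth_vsub subrr expr0n.
  rewrite add0r.
  apply: (@le_trans _ _ (((1 + T) / rho) `^ a)).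
    apply: ge0_ler_powR; rewrite ?nnegrE ?(ltW a0)//.
    - by rewrite addr_ge0// divr_ge0// ltW.
    - by rewrite divr_ge0// ltW.
    - rewrite mulrDl mul1r; apply: lerD.
        by rewrite invf_ge1//; apply: ltW; exact: le_lt_trans r01.
      by rewrite ler_wpM2r// invr_ge0 ltW.
  rewrite powRM ?invr_ge0 ?(ltW rho_gt0)//; apply: ler_pM; rewrite ?powR_ge0//.
    by rewrite ler1_powR//; clear -T0 a1; lra.
  (* [(rho^-1)^a] is [exp (a ln rho^-1)], and the logarithm cancels against the one in k. *)
  rewrite /powR invr_eq0 gt_eqF// ler_expR /a /k.
  by rewrite mulrA mulfVK// gt_eqF.
pose H (z : spacetime R d) := 2 * growth m z.
have mH : measurable_fun setT H by apply: measurable_funM => //; exact: measurable_growth.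
have H0 z : 0 <= H z by rewrite mulr_ge0 ?powR_ge0.
have HD s y y' : 0 <= s <= T ->
    (1 + k%:E * duhamel rho s y y' H <= (H (s, (y, y')))%:E)%E.
  move=> sT; apply: (@growth_supersolution _ _ _ T) => //; first exact: ltW.
  rewrite /m; apply: ler_wpDr => //; apply: ler_wpM2l => //; apply: ler_wpM2r => //.
  apply: ler_pM; [exact: ltW|by rewrite divr_ge0// ltW| |].
    by apply: ler_wpM2l; [exact: ltW|rewrite lef_pV2 ?posrE].
  apply: ler_wpM2l => //.
  by rewrite -[leLHS](@lnK _ rho^-1) ?posrE ?invr_gt0// ler_expR ltW.
apply: le_trans (comparison hd rho_gt0 (ltW k0) (ltW T0) mw mH w0 H0 wM wD HD x x tT) _.
apply: ler_wpDl; first by rewrite mulr_ge0 ?expR_ge0// mulr_ge0.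
rewrite /H; apply: ler_wpM2l => //; apply: ge0_ler_powR; rewrite ?nnegrE ?(ltW m0)//=.
  by rewrite addr_ge0.
by rewrite lerD2l.
Qed.

End moment_bound.

(** * The bilinear form with a bounded nonnegative kernel *)

Section kernel_form.
Context {R : realType} {d : nat} (K : euclidean R d -> R) (B : R).
Hypotheses (mK : measurable_fun setT K) (K0 : forall x, 0 <= K x)
  (KB : forall x, K x <= B).
Notation V := (euclidean R d).
Notation V2 := (space2_measure (R := R) (d := d)).
Implicit Types phi psi : V -> R.

Definition tensor phi psi (z : V * V) : R := phi z.1 * psi z.2 * K (vsub z.1 z.2).

Lemma measurable_tensor phi psi : measurable_fun setT phi ->
  measurable_fun setT psi -> measurable_fun setT (tensor phi psi).
Proof.
move=> mphi mpsi; apply: measurable_funM; last first.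
  by apply: (measurableT_comp mK); exact: measurable_vsub.
by apply: measurable_funM; [exact: (measurableT_comp mphi)|exact: (measurableT_comp mpsi)].
Qed.

(** A positive weight of mass at most 1: domination by it gives integrability of test functions
    without volumes of balls. *)
Definition gauss (y : V) : R := heat_kernel 1 (vsub [tuple 0 | i < d] y).

Lemma gauss_ge0 y : 0 <= gauss y.
Proof. exact: heat_kernel_ge0. Qed.

Lemma measurable_gauss : measurable_fun setT gauss.
Proof. by apply: measurable_heat_kernel => //; exact: measurable_vsub. Qed.

Lemma integral_gauss_le1 : (\int[lebesgue_space R d]_y (gauss y)%:E <= 1)%E.
Proof. exact: integral_heat_kernel_le1. Qed.

Lemma test_function_le_gauss phi : test_function phi ->
  exists2 c, 0 <= c & forall y, `|phi y| <= c * gauss y.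
Proof.
move=> [_ [M HM]].
have M0 : 0 <= M by have [+ _] := HM [tuple 0 | i < d]; exact: le_trans.
(* The Gaussian at squared radius M, its least value where [phi] may be nonzero. *)
pose g0 : R := (2 * pi * 1) `^ (- (d%:R / 2)) * expR (- M / (2 * 1)).
have pi2 := pi_ge2 R.
have g00 : 0 < g0 by rewrite mulr_gt0 ?expR_gt0// powR_gt0//; lra.
exists (M / g0); first by rewrite divr_ge0// ltW.
move=> y; have [h1 h2] := HM y; have [My|yM] := ltP M (sqnorm y).
  by rewrite h2// normr0 mulr_ge0 ?gauss_ge0// divr_ge0// ltW.
apply: le_trans h1 _; rewrite -mulrA ler_peMr// mulrC ler_pdivlMr// mul1r.
rewrite /gauss heat_kernel_vsubC /heat_kernel sqnorm_vsub0 ler_wpM2l ?powR_ge0//.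
by rewrite ler_expR ler_pM2r ?invr_gt0// lerN2.
Qed.

Lemma test_function_measurable phi : test_function phi -> measurable_fun setT phi.
Proof. by case. Qed.

Lemma integrable_tensor phi psi : test_function phi -> test_function psi ->
  V2.-integrable setT (EFin \o tensor phi psi).
Proof.
move=> tphi tpsi.
have mphi := test_function_measurable tphi; have mpsi := test_function_measurable tpsi.
have [c c0 hc] := test_function_le_gauss tphi.
have [c' c'0 hc'] := test_function_le_gauss tpsi.
have B0 : 0 <= B := le_trans (K0 [tuple 0 | i < d]) (KB _).
have mt := measurable_tensor mphi mpsi.
have mg := measurable_gauss.
pose g (z : V * V) : \bar R := ((c * c' * B)%:E * ((gauss z.1)%:E * (gauss z.2)%:E))%E.
have mgg : measurable_fun setT (fun z : V * V => (gauss z.1)%:E * (gauss z.2)%:E)%E.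
  by apply: emeasurable_funM; apply/measurable_EFinP; apply: (measurableT_comp mg).
have gg0 z : (0 <= (gauss z.1)%:E * (gauss z.2)%:E :> \bar R)%E.
  by rewrite mule_ge0 ?lee_fin ?gauss_ge0.
have mgE : measurable_fun setT (EFin \o gauss) by exact/measurable_EFinP.
apply/integrableP; split; first exact/measurable_EFinP.
apply: (@le_lt_trans _ _ (\int[V2]_z g z)%E).
  apply: ge0_le_integral; first exact: measurableT.
  - by move=> z _; exact: abse_ge0.
  - by apply: measurableT_comp => //; exact/measurable_EFinP.
  - exact: measurable_funeM.
  - move=> [y y'] _; rewrite /g -!EFinM lee_fin /tensor/= !normrM (ger0_norm (K0 _)).
    rewrite (_ : c * c' * B * _ = (c * gauss y) * (c' * gauss y') * B); last by ring.
    by apply: ler_pM; [exact: mulr_ge0|exact: K0|exact: ler_pM|exact: KB].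
rewrite /g ge0_integralZl_EFin//; last by rewrite !mulr_ge0.
apply: (@le_lt_trans _ _ ((c * c' * B)%:E * 1)%E); last by rewrite mule1 ltry.
apply: lee_wpmul2l; first by rewrite lee_fin; apply: mulr_ge0 => //; exact: mulr_ge0.
rewrite tonelli1//=.
apply: (@le_trans _ _ (\int[lebesgue_space R d]_y (gauss y)%:E)%E); last exact: integral_gauss_le1.
apply: ge0_le_integral; first exact: measurableT.
- move=> y _; apply: integral_ge0 => y' _; exact: (gg0 (y, y')).
- exact: (measurable_tonelli1 _ mgg gg0).
- exact: mgE.
- move=> y _; rewrite ge0_integralZl_EFin//; last 2 first.
    by move=> y' _; rewrite lee_fin gauss_ge0.
    exact: gauss_ge0.
  rewrite -[leRHS]mule1; apply: lee_wpmul2l; first by rewrite lee_fin gauss_ge0.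
  exact: integral_gauss_le1.
Qed.

Definition form phi psi : R := \int[V2]_z tensor phi psi z.

Lemma form_EFin phi psi : test_function phi -> test_function psi ->
  (form phi psi)%:E = (\int[V2]_z (tensor phi psi z)%:E)%E.
Proof.
move=> tphi tpsi; rewrite fineK//.
exact: integrable_fin_num (integrable_tensor tphi tpsi).
Qed.

(** The covariance of the noise is stated with iterated real integrals, where an infinite inner
    integral would silently become 0. Gaussian domination makes the inner integral finite for every
    y, so that Fubini identifies the two. *)
Lemma form_iterated phi psi : test_function phi -> test_function psi ->
  \int[lebesgue_space R d]_y \int[lebesgue_space R d]_y'
    (phi y * psi y' * K (vsub y y')) = form phi psi.
Proof.
move=> tphi tpsi; have it := integrable_tensor tphi tpsi.
rewrite /form /Rintegral [in RHS](fubini_sigma1 it); congr fine.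
apply: eq_integral => y _.
rewrite fineK// integrable_fin_num//.
have mphi := test_function_measurable tphi; have mpsi := test_function_measurable tpsi.
have [c' c'0 hc'] := test_function_le_gauss tpsi.
have B0 : 0 <= B := le_trans (K0 [tuple 0 | i < d]) (KB _).
apply: (@le_integrable _ _ _ _ _ _ _ (fun y' => (`|phi y| * c' * B)%:E * (gauss y')%:E)%E) => //.
- apply/measurable_EFinP; apply: measurable_funM; first exact: measurable_funM.
  by apply: (measurableT_comp mK); exact: measurable_vsub.
- move=> y' _; rewrite -EFinM !abse_EFin lee_fin.
  rewrite (ger0_norm (mulr_ge0 (mulr_ge0 (mulr_ge0 _ c'0) B0) (gauss_ge0 y')))//.
  rewrite !normrM (ger0_norm (K0 _)).
  rewrite (_ : _ * c' * B * _ = `|phi y| * (c' * gauss y') * B); last by ring.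
  by apply: ler_pM; [exact: mulr_ge0|exact: K0|exact: ler_pM|exact: KB].
- apply: integrableZl => //; apply/integrableP; split.
    by apply/measurable_EFinP; exact: measurable_gauss.
  under eq_integral do rewrite gee0_abs ?lee_fin ?gauss_ge0//.
  by apply: le_lt_trans integral_gauss_le1 _; rewrite ltry.
Qed.

End kernel_form.

(** * Young's inequality for the form *)

Section positive_kernel_form.
Context {R : realType} {d : nat} (K : euclidean R d -> R) (B : R).
Hypotheses (mK : measurable_fun setT K) (K0 : forall x, 0 <= K x)
  (KB : forall x, K x <= B).
Notation V := (euclidean R d).
Notation V2 := (space2_measure (R := R) (d := d)).
Implicit Types phi psi : V -> R.

Hypothesis formC : forall phi psi, test_function phi -> test_function psi ->
  form K phi psi = form K psi phi.
Hypothesis form_ge0 : forall phi, test_function phi -> 0 <= form K phi phi.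

Lemma test_function_comb (e : R) phi psi : test_function phi -> test_function psi ->
  test_function (fun y => e * phi y - psi y).
Proof.
move=> [mphi [M HM]] [mpsi [N HN]]; split.
  by apply: measurable_funB => //; exact: measurable_funM.
have M0 : 0 <= M by have [+ _] := HM [tuple 0 | i < d]; exact: le_trans.
have N0 : 0 <= N by have [+ _] := HN [tuple 0 | i < d]; exact: le_trans.
exists ((`|e| + 1) * (M + N)) => y; have [p1 p2] := HM y; have [q1 q2] := HN y.
have e0 := normr_ge0 e; split.
  apply: le_trans (ler_normB _ _) _; rewrite normrM.
  rewrite (@le_trans _ _ (`|e| * (M + N) + 1 * (M + N)))//; last by rewrite -mulrDl.
  rewrite mul1r; apply: lerD; last by rewrite (le_trans q1)// lerDr.
  by apply: ler_wpM2l => //; rewrite (le_trans p1)// lerDl.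
have MN : M + N <= (`|e| + 1) * (M + N) by rewrite ler_peMl ?addr_ge0// lerDr.
move=> /(le_lt_trans MN) My.
by rewrite p2 ?q2 ?mulr0 ?subr0//; apply: le_lt_trans My; rewrite ?lerDl ?lerDr.
Qed.

(** Expand the nonnegative value of the form at [e phi - psi], then divide by e. *)
Lemma form_young (e : R) phi psi : 0 < e -> test_function phi -> test_function psi ->
  2 * form K phi psi <= e * form K phi phi + e^-1 * form K psi psi.
Proof.
move=> e0 tphi tpsi.
have it p q := @integrable_tensor R d K B mK K0 KB p q.
have iC p q (c : R) : test_function p -> test_function q ->
    V2.-integrable setT (EFin \o (fun z => c * tensor K p q z)).
  move=> tp tq; rewrite (_ : _ \o _ = fun z => (c%:E * (tensor K p q z)%:E)%E)//.
  exact: integrableZl (it _ _ tp tq).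
have iD (f g : V * V -> R) : V2.-integrable setT (EFin \o f) ->
    V2.-integrable setT (EFin \o g) -> V2.-integrable setT (EFin \o (fun z => f z + g z)).
  move=> fi gi; rewrite (_ : _ \o _ = ((EFin \o f) \+ (EFin \o g))%E)//.
  exact: integrableD.
have := form_ge0 (test_function_comb e tphi tpsi).
have tE z : tensor K (fun y => e * phi y - psi y) (fun y => e * phi y - psi y) z =
    (e ^+ 2 * tensor K phi phi z + - e * tensor K phi psi z) +
    (- e * tensor K psi phi z + 1 * tensor K psi psi z) by rewrite /tensor; ring.
rewrite /form; under eq_Rintegral do rewrite tE.
rewrite RintegralD//; [|by apply: iD; exact: iC|by apply: iD; exact: iC].
rewrite RintegralD//; [|exact: iC|exact: iC].
rewrite RintegralD//; [|exact: iC|exact: iC].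
rewrite !RintegralZl//; [|exact: it|exact: it|exact: it|exact: it].
rewrite -!/(form _ _ _) (formC tpsi tphi) => h.
have -> : e * form K phi phi + e^-1 * form K psi psi =
    e^-1 * (e ^+ 2 * form K phi phi + form K psi psi) by field; rewrite gt_eqF.
by rewrite -ler_pdivrMl ?invr_gt0// invrK; move: h; lra.
Qed.

(** One index cuts both the height and the squared radius, as [test_function] uses one M for
    both. *)
Definition trunc (n : nat) phi (y : V) : R :=
  if sqnorm y <= n%:R then Num.min (phi y) n%:R else 0.

Lemma trunc_test n phi : measurable_fun setT phi -> (forall y, 0 <= phi y) ->
  test_function (trunc n phi).
Proof.
move=> mphi phi0; split.
  apply: measurable_fun_ifT => //; last exact: measurable_minr.
  by apply: measurable_fun_ler => //; exact: measurable_sqnorm.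
exists n%:R => y; rewrite /trunc; case: ifPn => [yn|]; last by rewrite normr0.
rewrite ger0_norm ?ge_min ?lexx ?orbT ?le_min ?phi0 ?ler0n//; split => //.
by rewrite ltNge yn.
Qed.

Lemma trunc_ge0 n phi y : (forall y, 0 <= phi y) -> 0 <= trunc n phi y.
Proof. by move=> phi0; rewrite /trunc; case: ifP => // _; rewrite le_min phi0 ler0n. Qed.

Lemma trunc_le n phi y : (forall y, 0 <= phi y) -> trunc n phi y <= phi y.
Proof. by move=> phi0; rewrite /trunc; case: ifP => // _; rewrite ge_min lexx. Qed.

Lemma trunc_nd m n phi y : (forall y, 0 <= phi y) -> (m <= n)%N ->
  trunc m phi y <= trunc n phi y.
Proof.
move=> phi0 mn; have mnR : m%:R <= n%:R :> R by rewrite ler_nat.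
rewrite {1}/trunc; case: ifPn => [ym|_]; last exact: trunc_ge0.
by rewrite /trunc (le_trans ym mnR) le_min !ge_min lexx mnR/= orbT.
Qed.

Lemma trunc_eventually phi y : \forall n \near \oo, trunc n phi y = phi y.
Proof.
near=> n; rewrite /trunc.
have -> : sqnorm y <= n%:R.
  by near: n; exact: nbhs_infty_ger.
apply/min_idPl; near: n; exact: nbhs_infty_ger.
Unshelve. all: by end_near. Qed.

Lemma tensor_ge0 phi psi z : (forall y, 0 <= phi y) -> (forall y, 0 <= psi y) ->
  0 <= tensor K phi psi z.
Proof. by move=> h1 h2; rewrite /tensor mulr_ge0// mulr_ge0. Qed.

(** The truncations are test functions, to which [form_young] applies. Only the left side needs
    monotone convergence; on the right the full integrals, possibly infinite, dominate the truncated
    ones. *)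
Lemma tensor_young (e : R) phi psi : 0 < e ->
  measurable_fun setT phi -> measurable_fun setT psi ->
  (forall y, 0 <= phi y) -> (forall y, 0 <= psi y) ->
  (2%:E * \int[V2]_z (tensor K phi psi z)%:E <=
   e%:E * \int[V2]_z (tensor K phi phi z)%:E +
   e^-1%:E * \int[V2]_z (tensor K psi psi z)%:E)%E.
Proof.
move=> e0 mphi mpsi phi0 psi0.
have mt n (p q : V -> R) : measurable_fun setT p -> measurable_fun setT q ->
    (forall y, 0 <= p y) -> (forall y, 0 <= q y) ->
    measurable_fun setT (EFin \o tensor K (trunc n p) (trunc n q)).
  move=> mp mq p0 q0; apply/measurable_EFinP; apply: measurable_tensor => //.
    by have [] := trunc_test n mp p0.
  by have [] := trunc_test n mq q0.
have le (p q : V -> R) : measurable_fun setT p -> measurable_fun setT q ->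
    (forall y, 0 <= p y) -> (forall y, 0 <= q y) -> forall n,
    (\int[V2]_z (tensor K (trunc n p) (trunc n q) z)%:E <=
     \int[V2]_z (tensor K p q z)%:E)%E.
  move=> mp mq p0 q0 n; apply: ge0_le_integral; first exact: measurableT.
  - by move=> z _; rewrite lee_fin; apply: tensor_ge0 => y; exact: trunc_ge0.
  - exact: mt.
  - by apply/measurable_EFinP; exact: measurable_tensor.
  - move=> z _; rewrite lee_fin /tensor; apply: ler_wpM2r => //.
    by apply: ler_pM; rewrite ?trunc_ge0 ?trunc_le.
have -> : (\int[V2]_z (tensor K phi psi z)%:E =
    limn (fun n => \int[V2]_z (tensor K (trunc n phi) (trunc n psi) z)%:E))%E.
  rewrite -monotone_convergence//; first last.
  - move=> z _ m n mn; rewrite lee_fin /tensor; apply: ler_wpM2r => //.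
    by apply: ler_pM; rewrite ?trunc_ge0 ?trunc_nd.
  - by move=> n z _; rewrite lee_fin; apply: tensor_ge0 => y; exact: trunc_ge0.
  - by move=> n; exact: mt.
  apply: eq_integral => z _; apply/esym/cvg_lim => //.
  apply: cvg_near_cst; near=> n; rewrite /tensor; congr (_ * _ * _)%:E.
    by near: n; exact: trunc_eventually.
  by near: n; exact: trunc_eventually.
rewrite -limeMl//; last first.
  apply: ereal_nondecreasing_is_cvgn => m n mn.
  apply: ge0_le_integral; first exact: measurableT.
  - by move=> z _; rewrite lee_fin; apply: tensor_ge0 => y; exact: trunc_ge0.
  - exact: mt.
  - exact: mt.
  - move=> z _; rewrite lee_fin /tensor; apply: ler_wpM2r => //.
    by apply: ler_pM; rewrite ?trunc_ge0 ?trunc_nd.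
apply: lime_le.
  apply: is_cvgeMl => //.
  apply: ereal_nondecreasing_is_cvgn => m n mn.
  apply: ge0_le_integral; first exact: measurableT.
  - by move=> z _; rewrite lee_fin; apply: tensor_ge0 => y; exact: trunc_ge0.
  - exact: mt.
  - exact: mt.
  - move=> z _; rewrite lee_fin /tensor; apply: ler_wpM2r => //.
    by apply: ler_pM; rewrite ?trunc_ge0 ?trunc_nd.
near=> n.
have tp := trunc_test n mphi phi0; have tq := trunc_test n mpsi psi0.
apply: (@le_trans _ _ (e%:E * \int[V2]_z (tensor K (trunc n phi) (trunc n phi) z)%:E +
   e^-1%:E * \int[V2]_z (tensor K (trunc n psi) (trunc n psi) z)%:E)%E).
  have fE p q := @form_EFin R d K B mK K0 KB p q.
  by rewrite -!fE// -!EFinM -EFinD lee_fin; exact: form_young.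
by apply: leeD; (apply: lee_wpmul2l; [by rewrite lee_fin ?invr_ge0 ltW|exact: le]).
Unshelve. all: by end_near. Qed.

End positive_kernel_form.

(** * Independence, adaptedness and square integrability *)

Section independence.
Context {R : realType} {disp : measure_display} {Omega : measurableType disp}.
Variable P : probability Omega R.
Implicit Types (X Y : Omega -> R) (G H : set (set Omega)).

(** By independence the law of (X, Y) agrees with the product of the laws on rectangles, hence
    everywhere; Fubini then factors the integral. *)
Lemma integral_indep G H X Y : independent_families P G H ->
  measurable_wrt G X -> measurable_wrt H Y ->
  measurable_fun setT X -> measurable_fun setT Y ->
  P.-integrable setT (EFin \o X) -> P.-integrable setT (EFin \o Y) ->
  P.-integrable setT (EFin \o (fun w => X w * Y w)) ->
  (\int[P]_w (X w * Y w)%:E = \int[P]_w (X w)%:E * \int[P]_w (Y w)%:E)%E.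
Proof.
move=> ind GX HY mX mY iX iY iXY.
pose X' : {mfun Omega >-> R} := HB.pack X (isMeasurableFun.Build _ _ _ _ X mX).
pose Y' : {mfun Omega >-> R} := HB.pack Y (isMeasurableFun.Build _ _ _ _ Y mY).
pose m1 := distribution P X'; pose m2 := distribution P Y'.
have mXY : measurable_fun setT (fun w => (X w, Y w)) by exact: measurable_fun_pair.
pose XY' : {mfun Omega >-> (R * R)%type} :=
  HB.pack (fun w => (X w, Y w)) (isMeasurableFun.Build _ _ _ _ (fun w => (X w, Y w)) mXY).
pose m12 := pushforward P XY'.
have E12 A : measurable A -> (m1 \x m2)%E A = m12 A.
  apply: product_measure_unique => C D mC mD.
  rewrite /m1 /m2 /m12 /distribution/= /pushforward/=.
  rewrite -(ind (X @^-1` C) (Y @^-1` D)); [|exact: GX|exact: HY].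
  by congr (P _); apply/seteqP; split => w /=.
pose f (z : R * R) : R := z.1 * z.2.
have mf : measurable_fun setT f.
  by apply: measurable_funM; [exact: measurable_fst|exact: measurable_snd].
have I12 : (\int[P]_w (X w * Y w)%:E = \int[sigma_prod m1 m2]_z (f z)%:E)%E.
  rewrite (@eq_measure_integral _ _ _ _ m12); last by move=> A mA _; exact: E12.
  rewrite integral_pushforward//.
  by apply/measurable_EFinP.
rewrite I12 fubini_sigma1; last first.
  apply/integrableP; split; first exact/measurable_EFinP.
  rewrite (@eq_measure_integral _ _ _ _ m12); last by move=> A mA _; exact: E12.
  rewrite ge0_integral_pushforward//.
    by have /integrableP[_] := iXY.
  by apply: measurableT_comp => //; exact/measurable_EFinP.
have E1 : (\int[m1]_x x%:E = \int[P]_w (X w)%:E)%E.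
  by rewrite /m1 /distribution integral_pushforward.
have E2 : (\int[m2]_y y%:E = \int[P]_w (Y w)%:E)%E.
  by rewrite /m2 /distribution integral_pushforward.
have i1 : m1.-integrable setT (EFin \o id).
  apply/integrableP; split; first exact/measurable_EFinP.
  rewrite /m1 /distribution ge0_integral_pushforward//.
    by have /integrableP[_] := iX.
  by apply: measurableT_comp => //; exact/measurable_EFinP.
have i2 : m2.-integrable setT (EFin \o id).
  apply/integrableP; split; first exact/measurable_EFinP.
  rewrite /m2 /distribution ge0_integral_pushforward//.
    by have /integrableP[_] := iY.
  by apply: measurableT_comp => //; exact/measurable_EFinP.
rewrite -E1 -E2.
have fY : (\int[m2]_y y%:E)%E \is a fin_num by exact: integrable_fin_num i2.
rewrite -(fineK fY) -integralZr//.
apply: eq_integral => x _ /=; rewrite /f/= (fineK fY).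
by under eq_integral do rewrite EFinM; rewrite integralZl.
Qed.

End independence.

Section measurable_wrt.
Context {R : realType} {disp : measure_display} {Omega : measurableType disp}.
Implicit Types (X Y : Omega -> R) (G : set (set Omega)).

(** Views adaptedness as measurability on [Omega] equipped with G, which brings closure under
    products and differences. *)
Lemma measurable_wrtE G X : sigma_algebra setT G ->
  measurable_wrt G X <->
  measurable_fun setT (X : g_sigma_algebraType G -> R).
Proof.
move=> sG; have mG := measurable_g_measurableTypeE sG; split => [h _ B mB|h B mB].
  by rewrite setTI mG; exact: h.
by have := h measurableT B mB; rewrite setTI mG.
Qed.

Lemma measurable_wrtM G X Y : sigma_algebra setT G ->
  measurable_wrt G X -> measurable_wrt G Y ->
  measurable_wrt G (fun w => X w * Y w).
Proof.
move=> sG /(measurable_wrtE _ sG) mX /(measurable_wrtE _ sG) mY.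
by apply/(measurable_wrtE _ sG); exact: measurable_funM.
Qed.

Lemma measurable_wrtB G X Y : sigma_algebra setT G ->
  measurable_wrt G X -> measurable_wrt G Y ->
  measurable_wrt G (fun w => X w - Y w).
Proof.
move=> sG /(measurable_wrtE _ sG) mX /(measurable_wrtE _ sG) mY.
by apply/(measurable_wrtE _ sG); exact: measurable_funB.
Qed.

Lemma measurable_wrt_sub G H X : G `<=` H -> measurable_wrt G X -> measurable_wrt H X.
Proof. by move=> GH h B mB; exact/GH/h. Qed.

Lemma measurable_wrt_fun G X : G `<=` measurable -> measurable_wrt G X ->
  measurable_fun setT X.
Proof. by move=> Gm h _ B mB; rewrite setTI; exact/Gm/h. Qed.

End measurable_wrt.

Section square_integrable.
Context {R : realType} {disp : measure_display} {Omega : measurableType disp}.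
Variable P : probability Omega R.
Implicit Types (X Y : Omega -> R).

Definition sqint X := measurable_fun setT X /\
  P.-integrable setT (EFin \o (fun w => (X w ^+ 2)%R)).

Lemma sqintM X Y : sqint X -> sqint Y ->
  P.-integrable setT (EFin \o (fun w => (X w * Y w)%R)).
Proof.
move=> [mX iX] [mY iY].
apply: (@le_integrable _ _ _ _ _ _ _
  ((EFin \o (fun w => (X w ^+ 2)%R)) \+ (EFin \o (fun w => (Y w ^+ 2)%R)))%E) => //.
- by apply/measurable_EFinP; exact: measurable_funM.
- move=> w _ /=; rewrite lee_fin.
  rewrite (@ger0_norm _ (_ + _)) ?addr_ge0 ?sqr_ge0// ler_norml.
  by apply/andP; split; have := sqr_ge0 (X w + Y w); have := sqr_ge0 (X w - Y w); nra.
- exact: integrableD.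
Qed.

Lemma sqint_cst (c : R) : sqint (cst c).
Proof. by split => //; exact: (finite_measure_integrable_cst _ (c ^+ 2)). Qed.

Lemma sqint_integrable X : sqint X -> P.-integrable setT (EFin \o X).
Proof.
move=> sX; have := sqintM sX (sqint_cst 1).
by rewrite (_ : (fun w => X w * _) = X)//; apply/funext => w; rewrite /= mulr1.
Qed.

Lemma sqintD X Y : sqint X -> sqint Y -> sqint (fun w => X w + Y w).
Proof.
move=> sX sY; have [mX iX] := sX; have [mY iY] := sY.
split; first exact: measurable_funD.
have iXY := sqintM sX sY.
rewrite (_ : _ \o _ = (((EFin \o (fun w => (X w ^+ 2)%R)) \+ (EFin \o (fun w => (Y w ^+ 2)%R)))
  \+ ((EFin \o (fun w => (X w * Y w)%R)) \+ (EFin \o (fun w => (X w * Y w)%R))))%E).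
  by apply: integrableD => //; apply: integrableD.
by apply/funext => w /=; rewrite -!EFinD; congr EFin; ring.
Qed.

Lemma sqintMb X Y : sqint X -> measurable_fun setT Y ->
  (exists M : R, forall w, `|Y w| <= M) -> sqint (fun w => Y w * X w).
Proof.
move=> [mX iX] mY [M HM]; split; first exact: measurable_funM.
apply: (@le_integrable _ _ _ _ _ _ _
  (fun w => ((M ^+ 2)%R%:E * (EFin \o (fun w => (X w ^+ 2)%R)) w)%E)) => //.
- by apply/measurable_EFinP; apply: measurable_funX; exact: measurable_funM.
- move=> w _ /=; rewrite lee_fin.
  rewrite (ger0_norm (sqr_ge0 _)) (ger0_norm (mulr_ge0 (sqr_ge0 M) (sqr_ge0 (X w)))).
  rewrite exprMn ler_wpM2r ?sqr_ge0// -(@real_normK _ (Y w)) ?num_real//.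
  by rewrite ler_pXn2r ?nnegrE// (le_trans _ (HM w)).
- exact: (integrableZl measurableT (M ^+ 2) iX).
Qed.

Lemma sqintZ (c : R) X : sqint X -> sqint (fun w => c * X w).
Proof.
by move=> sX; apply: (@sqintMb _ (cst c)) => //; exists `|c| => w; rewrite /cst lexx.
Qed.

Lemma sqintB X Y : sqint X -> sqint Y -> sqint (fun w => X w - Y w).
Proof.
move=> sX sY; have := sqintD sX (sqintZ (-1) sY).
rewrite (_ : (fun w => X w + _) = (fun w => X w - Y w))//.
by apply/funext => w; rewrite mulN1r.
Qed.

Lemma sqint_sum (I : Type) (l : seq I) (X : I -> Omega -> R) :
  (forall i, List.In i l -> sqint (X i)) -> sqint (fun w => \sum_(i <- l) X i w).
Proof.
elim: l => [_|i l IH h].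
  rewrite (_ : (fun _ => _) = cst 0); first exact: sqint_cst.
  by apply/funext => w; rewrite big_nil.
rewrite (_ : (fun _ => _) = (fun w => X i w + \sum_(j <- l) X j w)); last first.
  by apply/funext => w; rewrite big_cons.
by apply: sqintD; [apply: h; left|apply: IH => j jl; apply: h; right].
Qed.

Definition Ex X : R := \int[P]_w X w.

Lemma Ex_EFin X : P.-integrable setT (EFin \o X) -> (Ex X)%:E = (\int[P]_w (X w)%:E)%E.
Proof. by move=> iX; rewrite fineK//; exact: integrable_fin_num iX. Qed.

End square_integrable.

Lemma normal_prob_opp (R : realType) (s : R) (A : set R) : measurable A -> s != 0 ->
  normal_prob 0 s ((-%R : R -> R) @^-1` A) = normal_prob 0 s A.
Proof.
move=> mA s0; rewrite /normal_prob.
have mN : measurable_fun setT (-%R : measurableTypeR R -> measurableTypeR R).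
  exact: oppr_measurable.
have mp : measurable_fun (A : set (measurableTypeR R)) (fun x => (normal_pdf 0 s x)%:E).
  by apply: measurable_funTS; apply/measurable_EFinP; exact: measurable_normal_pdf.
rewrite [RHS](_ : _ = (\int[pushforward (@lebesgue_measure R)
    (-%R : measurableTypeR R -> measurableTypeR R)]_(x in A) (normal_pdf 0 s x)%:E)%E); last first.
  by apply: eq_measure_integral => B mB _; exact/esym/lebesgue_measureN.
rewrite ge0_integral_pushforward; [|exact: mN|exact: mA|exact: mp|
  by move=> x _; rewrite lee_fin normal_pdf_ge0].
apply: eq_integral => x _ /=; rewrite !normal_pdfE//.
by rewrite /normal_fun !subr0 sqrrN.
Qed.

(** The law is invariant under negation, so its mean is its own opposite; integrability makes that
    mean finite, hence 0. *)
Lemma Ex_centered_gaussian (R : realType) (disp : measure_display)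
    (Omega : measurableType disp) (P : probability Omega R) (X : Omega -> R) :
  centered_gaussian P X -> P.-integrable setT (EFin \o X) -> Ex P X = 0.
Proof.
move=> [mX [X0|[s s0 Xs]]] iX.
  rewrite /Ex /Rintegral (@ae_eq_integral _ _ _ _ _ (cst 0%E))// ?integral0//.
    exact/measurable_EFinP.
  by apply: filterS X0 => w /= + _ => ->.
pose X' : {mfun Omega >-> R} := HB.pack X (isMeasurableFun.Build _ _ _ _ X mX).
pose m := distribution P X'; pose mN := pushforward m (-%R : R -> R).
have E A : measurable A -> mN A = m A.
  move=> mA; rewrite /mN /m /distribution /pushforward/= Xs.
    by rewrite Xs// normal_prob_opp// gt_eqF.
  rewrite -[_ @^-1` _]setTI; exact: (@oppr_measurable R).
have im : m.-integrable setT (EFin \o id).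
  apply/integrableP; split; first exact/measurable_EFinP.
  rewrite /m /distribution ge0_integral_pushforward//.
    by have /integrableP[_] := iX.
  by apply: measurableT_comp => //; exact/measurable_EFinP.
have EX : (\int[P]_w (X w)%:E = \int[m]_x x%:E)%E.
  by rewrite /m /distribution integral_pushforward.
have : (\int[m]_x x%:E = - \int[m]_x x%:E)%E.
  transitivity (\int[mN]_x x%:E)%E.
    by apply: eq_measure_integral => A mA _; exact/esym/E.
  rewrite /mN integral_pushforward//=.
    by rewrite -integralN//; apply: integrable_add_def.
  rewrite preimage_setT (_ : _ \o _ = -%E \o (EFin \o id))//.
  exact: integrableN im.
have fin : (\int[m]_x x%:E)%E \is a fin_num by exact: integrable_fin_num im.
rewrite /Ex /Rintegral EX -(fineK fin) -EFinN => -[] /eqP.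
by rewrite -addr_eq0 -mulr2n mulrn_eq0/= => /eqP ->.
Qed.

(** * Covariances of elementary stochastic integrals *)

Section isometry.
Context {R : realType} {d : nat} {disp : measure_display}.
Context {Omega : measurableType disp} (P : probability Omega R).
Context (K : euclidean R d -> R) (B : R).
Context (F : R -> set (set Omega)) (W : R -> (euclidean R d -> R) -> Omega -> R).
Hypotheses (mK : measurable_fun setT K) (K0 : forall x, 0 <= K x)
  (KB : forall x, K x <= B) (Ffilt : filtration F) (HW : spatial_noise P K F W).
Implicit Types (phi psi : euclidean R d -> R) (X Y : Omega -> R).

Let Fm t : 0 <= t -> F t `<=` measurable := @filtration_measurable _ _ _ _ Ffilt t.
Let Fs t : 0 <= t -> sigma_algebra setT (F t) := @filtration_sigma_algebra _ _ _ _ Ffilt t.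

Lemma measurable_noise t phi : 0 <= t -> test_function phi ->
  measurable_fun setT (W t phi).
Proof.
by move=> t0 tphi; apply: (measurable_wrt_fun (Fm t0)); exact: (noise_adapted HW).
Qed.

(** The second moment is finite because [noise_covariance] equates it with a real number. *)
Lemma sqint_noise t phi : 0 <= t -> test_function phi -> sqint P (W t phi).
Proof.
move=> t0 tphi; have mW := measurable_noise t0 tphi.
split => //; apply/integrableP; split.
  by apply/measurable_EFinP; exact: measurable_funX.
have := noise_covariance HW t0 t0 tphi tphi; rewrite unlock => E.
under eq_integral do rewrite gee0_abs ?lee_fin ?sqr_ge0//=.
by under eq_integral do rewrite expr2; rewrite E ltry.
Qed.

Lemma Ex_noise2 s t phi psi : 0 <= s -> 0 <= t ->
  test_function phi -> test_function psi ->
  Ex P (fun w => W s phi w * W t psi w) = Num.min s t * form K phi psi.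
Proof.
move=> s0 t0 tphi tpsi; have := noise_covariance HW s0 t0 tphi tpsi.
by rewrite unlock => E; rewrite /Ex {1}/Rintegral E /= (form_iterated mK K0 KB).
Qed.

Lemma noise_formC phi psi : test_function phi -> test_function psi ->
  form K phi psi = form K psi phi.
Proof.
move=> tphi tpsi; have := Ex_noise2 ler01 ler01 tphi tpsi.
have := Ex_noise2 ler01 ler01 tpsi tphi; rewrite minxx !mul1r => <- <-.
by congr Ex; apply/funext => w; rewrite mulrC.
Qed.

Lemma noise_form_ge0 phi : test_function phi -> 0 <= form K phi phi.
Proof.
move=> tphi; have := Ex_noise2 ler01 ler01 tphi tphi; rewrite minxx mul1r => <-.
by apply: Rintegral_ge0 => w _; rewrite -expr2 sqr_ge0.
Qed.

Lemma Ex_noise t phi : 0 <= t -> test_function phi -> Ex P (W t phi) = 0.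
Proof.
move=> t0 tphi; apply: Ex_centered_gaussian; last first.
  exact: sqint_integrable (sqint_noise t0 tphi).
have := @noise_gaussian _ _ _ _ _ _ _ _ HW 1 (fun=> 1) (fun=> t) (fun=> phi)
  (fun=> t0) (fun=> tphi).
rewrite (_ : (fun w => _) = W t phi)//.
by apply/funext => w; rewrite big_ord1 mul1r.
Qed.

Lemma ExD X Y : P.-integrable setT (EFin \o X) -> P.-integrable setT (EFin \o Y) ->
  Ex P (fun w => X w + Y w) = Ex P X + Ex P Y.
Proof. by move=> iX iY; rewrite /Ex RintegralD. Qed.

Lemma ExB X Y : P.-integrable setT (EFin \o X) -> P.-integrable setT (EFin \o Y) ->
  Ex P (fun w => X w - Y w) = Ex P X - Ex P Y.
Proof. by move=> iX iY; rewrite /Ex RintegralB. Qed.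

Definition incr s t phi w := W t phi w - W s phi w.

Lemma sqint_incr s t phi : 0 <= s -> 0 <= t -> test_function phi ->
  sqint P (incr s t phi).
Proof. by move=> s0 t0 tphi; apply: sqintB; exact: sqint_noise. Qed.

Lemma Ex_incr s t phi : 0 <= s -> 0 <= t -> test_function phi ->
  Ex P (incr s t phi) = 0.
Proof.
move=> s0 t0 tphi; rewrite /incr ExB ?Ex_noise ?subrr//;
  exact: sqint_integrable (sqint_noise _ tphi).
Qed.

Lemma Ex_incr2 c s t phi psi : 0 <= c -> c <= s -> c <= t ->
  test_function phi -> test_function psi ->
  Ex P (fun w => incr c s phi w * incr c t psi w) =
  (Num.min s t - c) * form K phi psi.
Proof.
move=> c0 cs ct tphi tpsi.
have s0 := le_trans c0 cs; have t0 := le_trans c0 ct.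
have sW u p (u0 : 0 <= u) (tp : test_function p) := sqint_noise u0 tp.
rewrite (_ : (fun w => _) = (fun w => (W s phi w * W t psi w - W s phi w * W c psi w) -
    (W c phi w * W t psi w - W c phi w * W c psi w))); last first.
  by apply/funext => w; rewrite /incr; ring.
have i u v p q (u0 : 0 <= u) (v0 : 0 <= v) (tp : test_function p) (tq : test_function q) :=
  sqintM (sW u p u0 tp) (sW v q v0 tq).
have iB X Y : P.-integrable setT (EFin \o X) -> P.-integrable setT (EFin \o Y) ->
    P.-integrable setT (EFin \o (fun w => X w - Y w)).
  move=> iX iY; rewrite (_ : _ \o _ = ((EFin \o X) \- (EFin \o Y))%E)//.
  exact: integrableB.
rewrite ExB; [|by apply: iB; exact: i|by apply: iB; exact: i].
rewrite ExB; [|exact: i|exact: i].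
rewrite ExB; [|exact: i|exact: i].
rewrite !Ex_noise2// (min_r cs) (min_l ct) minxx; ring.
Qed.

Definition future s := <<s [set A | exists (t : R) phi (B : set R),
  [/\ s <= t, test_function phi, measurable B &
      A = (fun w => W t phi w - W s phi w) @^-1` B]] >>.

Lemma future_incr s t phi : s <= t -> test_function phi ->
  measurable_wrt (future s) (incr s t phi).
Proof. by move=> st tphi A mA; apply: sub_sigma_algebra; exists t, phi, A. Qed.

Lemma Ex_indep s X Y : 0 <= s -> measurable_wrt (F s) X ->
  measurable_wrt (future s) Y -> measurable_fun setT Y ->
  P.-integrable setT (EFin \o X) -> P.-integrable setT (EFin \o Y) ->
  P.-integrable setT (EFin \o (fun w => X w * Y w)) ->
  Ex P (fun w => X w * Y w) = Ex P X * Ex P Y.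
Proof.
move=> s0 FX fY mY iX iY iXY; apply: EFin_inj; rewrite EFinM !Ex_EFin//.
apply: (integral_indep (noise_independent HW s0)) => //.
exact: measurable_wrt_fun (Fm s0) FX.
Qed.

(** Orthogonality of the past to a later increment: they are independent and the increment is
    centered. *)
Lemma Ex_past_incr c t Y psi : 0 <= c -> c <= t -> test_function psi ->
  measurable_wrt (F c) Y -> sqint P Y ->
  Ex P (fun w => Y w * incr c t psi w) = 0.
Proof.
move=> c0 ct tpsi FY sY; have t0 := le_trans c0 ct.
have si := sqint_incr c0 t0 tpsi; have [mi _] := si.
rewrite (Ex_indep c0 FY (future_incr ct tpsi))//.
- by rewrite Ex_incr ?mulr0.
- exact: sqint_integrable.
- exact: sqint_integrable.
- exact: sqintM.
Qed.

Lemma Ex_past_incr2 c s t X phi psi : 0 <= c -> c <= s -> c <= t ->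
  test_function phi -> test_function psi ->
  measurable_wrt (F c) X -> (exists M : R, forall w, `|X w| <= M) ->
  Ex P (fun w => X w * (incr c s phi w * incr c t psi w)) =
  Ex P X * ((Num.min s t - c) * form K phi psi).
Proof.
move=> c0 cs ct tphi tpsi FX [M HM].
have s0 := le_trans c0 cs; have t0 := le_trans c0 ct.
have mX := measurable_wrt_fun (Fm c0) FX.
have s1 := sqint_incr c0 s0 tphi; have s2 := sqint_incr c0 t0 tpsi.
have sX : sqint P (fun w => X w * cst 1 w) by apply: sqintMb; [exact: sqint_cst| |exists M].
have fut : sigma_algebra setT (future c) by exact: smallest_sigma_algebra.
rewrite (Ex_indep (Y := fun w => incr c s phi w * incr c t psi w) c0 FX).
- by rewrite Ex_incr2.
- by apply: measurable_wrtM => //; exact: future_incr.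
- by apply: measurable_funM; [case: s1|case: s2].
- rewrite (_ : X = fun w => X w * cst 1 w); first exact: sqint_integrable sX.
  by apply/funext => w; rewrite mulr1.
- exact: sqintM.
- have sXi : sqint P (fun w => X w * incr c s phi w) by apply: sqintMb => //; exists M.
  have := sqintM sXi s2.
  by rewrite (_ : (fun w => _) = (fun w => X w * (incr c s phi w * incr c t psi w)))//;
    apply/funext => w; rewrite mulrA.
Qed.

Definition block (a b : R) X phi w := X w * incr a b phi w.

(* A step starting after time t is truncated to the empty interval ]t, t], where
   its weight need not be known: hence the guard a < b. *)
Definition known (a b : R) X := [/\ measurable_fun setT X,
  exists M : R, forall w, `|X w| <= M & a < b -> measurable_wrt (F a) X].

Lemma sqint_block a b X phi : 0 <= a -> a <= b -> known a b X ->
  test_function phi -> sqint P (block a b X phi).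
Proof.
move=> a0 ab [mX bX _] tphi; apply: sqintMb => //.
by apply: sqint_incr => //; exact: le_trans ab.
Qed.

Lemma Ex_block a b X phi : 0 <= a -> a <= b -> known a b X ->
  test_function phi -> Ex P (block a b X phi) = 0.
Proof.
move=> a0 ab [mX [M bX] FX] tphi; have [ab'|ba] := ltP a b.
  apply: Ex_past_incr => //; first exact: FX.
  have : sqint P (fun w => X w * cst 1 w) by apply: sqintMb; [exact: sqint_cst| |exists M].
  by rewrite (_ : (fun w => _) = X)//; apply/funext => w; rewrite mulr1.
rewrite /Ex (_ : block a b X phi = cst 0) ?Rintegral_cst ?mul0r//.
by apply/funext => w; rewrite /block /incr (@le_anti _ _ a b) ?ab// subrr mulr0.
Qed.

(** Say a <= a'. The earlier increment is cut at a': its first part, with both weights, is known at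
    time a' and orthogonal to the later increment; its second part starts at a' like the later one,
    and [Ex_past_incr2] gives the length of the overlap. *)
Lemma Ex_block2 a b X phi a' b' X' phi' :
  0 <= a -> a <= b -> known a b X -> test_function phi ->
  0 <= a' -> a' <= b' -> known a' b' X' -> test_function phi' ->
  Ex P (fun w => block a b X phi w * block a' b' X' phi' w) =
  Ex P (fun w => X w * X' w) *
    (Num.max 0 (Num.min b b' - Num.max a a') * form K phi phi').
Proof.
wlog aa : a b X phi a' b' X' phi' / a <= a'.
  move=> wl a0 ab kX tphi a'0 ab' kX' tphi'.
  have [aa|] := boolP (a <= a'); first exact: (wl a b X phi a' b' X' phi' aa).
  rewrite -ltNge => /ltW aa.
  rewrite (noise_formC tphi tphi') (minC b) (maxC a).
  rewrite (_ : (fun w => X w * X' w) = (fun w => X' w * X w)); last first.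
    by apply/funext => w; rewrite mulrC.
  rewrite -(wl a' b' X' phi' a b X phi aa)//.
  by congr Ex; apply/funext => w; rewrite mulrC.
move=> a0 ab kX tphi a'0 ab' kX' tphi'.
have triv (f : Omega -> R) : (forall w, f w = 0) -> Ex P f = 0.
  by move=> f0; rewrite /Ex (_ : f = cst 0) ?Rintegral_cst ?mul0r//; apply/funext.
rewrite (max_r aa).
have [a'b'|b'a'] := ltP a' b'; last first.
  rewrite triv; last first.
    move=> w; rewrite /block /incr (_ : b' = a') ?subrr ?mulr0//.
    by apply/le_anti; rewrite b'a' ab'.
  by rewrite max_l ?mul0r ?mulr0// subr_le0 ge_min b'a' orbT.
have [ab_|ba] := ltP a b; last first.
  rewrite triv; last first.
    move=> w; rewrite /block /incr (_ : b = a) ?subrr ?mulr0 ?mul0r//.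
    by apply/le_anti; rewrite ba ab.
  by rewrite max_l ?mul0r ?mulr0// subr_le0 ge_min (le_trans ba aa).
have [mX [M HM] FX] := kX; have [mX' [M' HM'] FX'] := kX'.
have b0 := le_trans a0 ab.
have FaX := FX ab_; have Fa'X' := FX' a'b'.
have sub : F a `<=` F a' by exact: (filtration_monotone Ffilt).
have Fa'X := measurable_wrt_sub sub FaX.
have FXX : measurable_wrt (F a') (fun w => X w * X' w).
  by apply: measurable_wrtM => //; exact: Fs.
have bXX : exists N : R, forall w, `|X w * X' w| <= N.
  by exists (M * M') => w; rewrite normrM ler_pM.
have past e : 0 <= e -> e <= a' ->
    measurable_wrt (F a') (fun w => X w * X' w * incr a e phi w).
  move=> e0 ea'; apply: measurable_wrtM => //; first exact: Fs.
  apply: measurable_wrtB; first exact: Fs.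
    have := noise_adapted HW e0 tphi; apply: measurable_wrt_sub.
    exact: (filtration_monotone Ffilt).
  have := noise_adapted HW a0 tphi; exact: measurable_wrt_sub.
have spast e : 0 <= e -> sqint P (fun w => X w * X' w * incr a e phi w).
  by move=> e0; apply: sqintMb => //; [exact: sqint_incr|exact: measurable_funM].
have [ba'|a'b] := leP b a'.
  rewrite max_l ?mul0r ?mulr0; last by rewrite subr_le0 ge_min ba'.
  rewrite -(Ex_past_incr a'0 ab' tphi' (past b b0 ba') (spast b b0)).
  by congr Ex; apply/funext => w; rewrite /block; ring.
rewrite max_r; last by rewrite subr_ge0 le_min (ltW a'b) ab'.
rewrite -(Ex_past_incr2 a'0 (ltW a'b) ab' tphi tphi' FXX bXX).
rewrite -[RHS]addr0 -(Ex_past_incr a'0 ab' tphi' (past a' a'0 (lexx _)) (spast a' a'0)).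
rewrite -ExD.
- by congr Ex; apply/funext => w; rewrite /block /incr; ring.
- have s1 : sqint P (fun w => X w * X' w * incr a' b phi w).
    by apply: sqintMb => //; [exact: sqint_incr|exact: measurable_funM].
  have s2 : sqint P (incr a' b' phi') by apply: sqint_incr => //; exact: le_trans ab'.
  have := sqintM s1 s2.
  by rewrite (_ : (fun w => _) = (fun w => X w * X' w * (incr a' b phi w * incr a' b' phi' w)))//;
    apply/funext => w; rewrite !mulrA.
- exact: sqintM (spast a' a'0) (sqint_incr a'0 (le_trans a'0 ab') tphi').
Qed.

End isometry.

(** * Finite sums and tensor products of integrable functions *)

Section finite_sums.
Context {R : realType} {disp : measure_display} {T : measurableType disp}.
Variable m : {measure set T -> \bar R}.

Lemma integrable_Rsum (I : Type) (l : seq I) (f : I -> T -> R) :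
  (forall i, List.In i l -> m.-integrable setT (EFin \o f i)) ->
  m.-integrable setT (EFin \o (fun x => \sum_(i <- l) f i x)) /\
  \int[m]_x (\sum_(i <- l) f i x) = \sum_(i <- l) \int[m]_x f i x.
Proof.
elim: l => [_|i l IH h].
  rewrite big_nil (_ : (fun x => _) = cst 0); last first.
    by apply/funext => x; rewrite big_nil.
  split; last by rewrite /Rintegral integral0.
  exact: integrable0.
have [il El] := IH (fun j jl => h j (or_intror jl)).
have ii := h i (or_introl erefl).
rewrite big_cons -El (_ : (fun x => _) = (fun x => f i x + \sum_(j <- l) f j x)); last first.
  by apply/funext => x; rewrite big_cons.
split; last by rewrite RintegralD.
by rewrite (_ : _ \o _ = ((EFin \o f i) \+ (EFin \o (fun x => (\sum_(j <- l) f j x)%R)))%E)//;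
  exact: integrableD.
Qed.

Lemma integrable_Rsum2 (I J : Type) (l : seq I) (l' : seq J) (f : I -> J -> T -> R) :
  (forall i j, List.In i l -> List.In j l' -> m.-integrable setT (EFin \o f i j)) ->
  m.-integrable setT (EFin \o (fun x => \sum_(i <- l) \sum_(j <- l') f i j x)) /\
  \int[m]_x (\sum_(i <- l) \sum_(j <- l') f i j x) =
    \sum_(i <- l) \sum_(j <- l') \int[m]_x f i j x.
Proof.
move=> h.
have h1 i : List.In i l -> m.-integrable setT (EFin \o (fun x => \sum_(j <- l') f i j x)) /\
    \int[m]_x (\sum_(j <- l') f i j x) = \sum_(j <- l') \int[m]_x f i j x.
  by move=> il; apply: integrable_Rsum => j jl; exact: h.
have [i1 ->] := @integrable_Rsum _ l (fun i x => \sum_(j <- l') f i j x)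
  (fun i il => (h1 i il).1).
split => //; clear -h1; elim: l h1 => [|i l IH] h1; first by rewrite !big_nil.
rewrite !big_cons; congr (_ + _); first exact: (h1 i (or_introl erefl)).2.
by apply: IH => j jl; apply: h1; right.
Qed.

End finite_sums.

Section product_integral.
Context {d1 d2 : measure_display} {T1 : measurableType d1} {T2 : measurableType d2}.
Context {R : realType}.
Variables (m1 : {sigma_finite_measure set T1 -> \bar R})
  (m2 : {sigma_finite_measure set T2 -> \bar R}).

Lemma integrable_sigma_prod (f1 : T1 -> R) (f2 : T2 -> R) :
  m1.-integrable setT (EFin \o f1) -> m2.-integrable setT (EFin \o f2) ->
  (sigma_prod m1 m2).-integrable setT (EFin \o (fun z => f1 z.1 * f2 z.2)) /\
  \int[sigma_prod m1 m2]_z (f1 z.1 * f2 z.2) = (\int[m1]_x f1 x) * (\int[m2]_y f2 y).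
Proof.
move=> i1 i2; have /integrableP[mf1 lt1] := i1; have /integrableP[mf2 lt2] := i2.
have mf : measurable_fun setT (EFin \o (fun z : T1 * T2 => f1 z.1 * f2 z.2)).
  apply/measurable_EFinP; apply: measurable_funM.
    by apply: (measurableT_comp (f := f1)) => //; exact/measurable_EFinP.
  by apply: (measurableT_comp (f := f2)) => //; exact/measurable_EFinP.
have mabs1 : measurable_fun setT (abse \o (EFin \o f1)) by exact: measurableT_comp.
have mabs2 : measurable_fun setT (abse \o (EFin \o f2)) by exact: measurableT_comp.
have fin1 : (\int[m1]_x (f1 x)%:E)%E \is a fin_num by exact: integrable_fin_num i1.
have fin2 : (\int[m2]_x (f2 x)%:E)%E \is a fin_num by exact: integrable_fin_num i2.
have ii : (sigma_prod m1 m2).-integrable setT (EFin \o (fun z => f1 z.1 * f2 z.2)).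
  apply/integrableP; split => //; rewrite tonelli1//; last exact: measurableT_comp.
  rewrite (_ : (\int[m1]_x _)%E = (\int[m1]_x (`|(f1 x)%:E| * \int[m2]_y `|(f2 y)%:E|))%E).
    rewrite ge0_integralZr//; last by apply: integral_ge0.
    rewrite lte_mul_pinfty//; first by apply: integral_ge0.
    by rewrite ge0_fin_numE//; exact: integral_ge0.
  apply: eq_integral => x _; rewrite -ge0_integralZl//.
  by apply: eq_integral => y _ /=; rewrite -EFinM normrM.
split => //; rewrite /Rintegral fubini_sigma1//.
rewrite -fineM//; congr fine; rewrite -(fineK fin2) -integralZr//.
apply: eq_integral => x _ /=; rewrite (fineK fin2).
by under eq_integral do rewrite EFinM; rewrite integralZl.
Qed.

End product_integral.

(** * Random fields and their energy *)

Section fields.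
Context {R : realType} {d : nat} {disp : measure_display}.
Context {Omega : measurableType disp} (P : probability Omega R).
Context (K : euclidean R d -> R).
Hypotheses (mK : measurable_fun setT K) (K0 : forall x, 0 <= K x).
Notation V := (euclidean R d).
Notation field := (R -> V -> Omega -> R).
Implicit Types (f g h : field) (t : R).

Definition event_space := sigma_prod P (spacetime_measure (R := R) (d := d)).

(** [integrand_norm2] only sees times in []0, t[], and a mild solution is only known to be
    measurable at nonnegative times. *)
Definition cut t f s y w := if 0 < s < t then f s y w else 0.

Definition measurable_field t f := measurable_fun setT
  (fun q : measurableTypeR R * V * Omega => cut t f q.1.1 q.1.2 q.2).

(** The polarized integrand of [integrand_norm2], on a single product space: its integral is the
    right side of the isometry. *)
Definition bil t f g (q : Omega * spacetime R d) : R :=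
  cut t f q.2.1 q.2.2.1 q.1 * cut t g q.2.1 q.2.2.2 q.1 * K (vsub q.2.2.1 q.2.2.2).

Lemma measurable_cut1 t f : measurable_field t f ->
  measurable_fun setT (fun q : Omega * spacetime R d => cut t f q.2.1 q.2.2.1 q.1).
Proof.
move=> mf; apply: (measurableT_comp (f := fun q : measurableTypeR R * V * Omega =>
  cut t f q.1.1 q.1.2 q.2) mf (g := fun q : Omega * spacetime R d => (q.2.1, q.2.2.1, q.1))).
apply: measurable_fun_pair; last exact: measurable_fst.
apply: measurable_fun_pair; first exact: (measurableT_comp measurable_fst measurable_snd).
exact: (measurableT_comp measurable_spacetime1 measurable_snd).
Qed.

Lemma measurable_cut2 t f : measurable_field t f ->
  measurable_fun setT (fun q : Omega * spacetime R d => cut t f q.2.1 q.2.2.2 q.1).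
Proof.
move=> mf; apply: (measurableT_comp (f := fun q : measurableTypeR R * V * Omega =>
  cut t f q.1.1 q.1.2 q.2) mf (g := fun q : Omega * spacetime R d => (q.2.1, q.2.2.2, q.1))).
apply: measurable_fun_pair; last exact: measurable_fst.
apply: measurable_fun_pair; first exact: (measurableT_comp measurable_fst measurable_snd).
exact: (measurableT_comp measurable_spacetime2 measurable_snd).
Qed.

Lemma measurable_bil t f g : measurable_field t f -> measurable_field t g ->
  measurable_fun setT (bil t f g).
Proof.
move=> mf mg; apply: measurable_funM.
  by apply: measurable_funM; [exact: measurable_cut1|exact: measurable_cut2].
apply: (measurableT_comp mK); apply: measurable_vsub.
  exact: (measurableT_comp measurable_spacetime1 measurable_snd).
exact: (measurableT_comp measurable_spacetime2 measurable_snd).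
Qed.

Definition sqnorm_field t f : \bar R := (\int[event_space]_q `|bil t f f q|%:E)%E.

Lemma event_tonelli (h : Omega * spacetime R d -> \bar R) :
  measurable_fun setT h -> (forall q, 0 <= h q)%E ->
  (\int[event_space]_q h q =
   \int[P]_w \int[@lebesgue_measure R]_s \int[lebesgue_space R d]_y
     \int[lebesgue_space R d]_y' h (w, (s, (y, y'))))%E.
Proof.
move=> mh h0; rewrite (tonelli1 _ _ mh h0); apply: eq_integral => w _.
have mw : measurable_fun setT (fun z => h (w, z)).
  by apply: (measurableT_comp mh); exact: pair1_measurable.
rewrite (tonelli1 _ _ mw (fun z => h0 (w, z))); apply: eq_integral => s _.
have ms : measurable_fun setT (fun z => h (w, (s, z))).
  by apply: (measurableT_comp mw); exact: pair1_measurable.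
by rewrite (tonelli1 _ _ ms (fun z => h0 (w, (s, z)))).
Qed.

Lemma integrand_norm2E t f : measurable_field t f ->
  integrand_norm2 P K t f = sqnorm_field t f.
Proof.
move=> mf; have mb : measurable_fun setT (fun q => `|bil t f f q|%:E).
  by apply/measurable_EFinP; apply: measurableT_comp => //; exact: measurable_bil.
have b0 q : (0 <= `|bil t f f q|%:E)%E by rewrite lee_fin.
rewrite /sqnorm_field (event_tonelli mb b0).
apply: eq_integral => w _; rewrite [LHS]integral_mkcond; apply: eq_integral => s _.
rewrite patchE /bil/= /cut; case: ifPn => [|].
  rewrite inE/= in_itv/= => st; rewrite st.
  by apply: eq_integral => y _; apply: eq_integral.
rewrite notin_setE/= in_itv/= => /negP/negbTE ->.
rewrite integral0_eq// => y _; rewrite integral0_eq// => y' _.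
by rewrite !mul0r normr0.
Qed.

(** The kernel form of |f| and |g| at a fixed event and time. The absolute values, those of
    [integrand_norm2], are what makes [tensor_young] applicable without integrability. *)
Definition slice t f g (p : Omega * measurableTypeR R) : \bar R :=
  (\int[space2_measure (R := R) (d := d)]_z (tensor K (fun y => `|cut t f p.2 y p.1|)
     (fun y => `|cut t g p.2 y p.1|) z)%:E)%E.

Lemma measurable_slice t f g : measurable_field t f -> measurable_field t g ->
  measurable_fun setT (slice t f g) /\
  (\int[event_space]_q `|bil t f g q|%:E =
   \int[sigma_prod P (@lebesgue_measure R)]_p slice t f g p)%E.
Proof.
move=> mf mg.
have mb : measurable_fun setT (fun q => `|bil t f g q|%:E).
  by apply/measurable_EFinP; apply: measurableT_comp => //; exact: measurable_bil.
pose h (r : (Omega * measurableTypeR R) * (V * V)) := `|bil t f g (r.1.1, (r.1.2, r.2))|%:E.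
have mh : measurable_fun setT h.
  apply: (measurableT_comp mb (g := fun r : (Omega * measurableTypeR R) * (V * V) =>
    (r.1.1, (r.1.2, r.2)))).
  apply: measurable_fun_pair; first exact: (measurableT_comp measurable_fst measurable_fst).
  apply: measurable_fun_pair; last exact: measurable_snd.
  exact: (measurableT_comp measurable_snd measurable_fst).
have h0 r : (0 <= h r)%E by rewrite lee_fin.
have E p : slice t f g p = (\int[space2_measure (R := R) (d := d)]_z h (p, z))%E.
  apply: eq_integral => z _; rewrite /tensor /h /bil/=.
  by rewrite !normrM (ger0_norm (K0 _)).
have ms : measurable_fun setT (slice t f g).
  rewrite (_ : slice t f g = fun p => (\int[space2_measure (R := R) (d := d)]_z h (p, z))%E).
    exact: (measurable_tonelli1 _ mh h0).
  exact/funext.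
have b0 q : (0 <= `|bil t f g q|%:E)%E by rewrite lee_fin.
have s0 p : (0 <= slice t f g p)%E.
  by rewrite E; apply: integral_ge0 => z _; exact: h0.
split => //; rewrite (tonelli1 _ _ mb b0) [RHS](tonelli1 _ _ ms s0).
apply: eq_integral => w _.
have mw : measurable_fun setT (fun z => `|bil t f g (w, z)|%:E).
  by apply: (measurableT_comp mb); exact: pair1_measurable.
rewrite (tonelli1 _ _ mw (fun z => b0 (w, z))).
by apply: eq_integral => s _; rewrite E.
Qed.

Lemma slice_ge0 t f g p : (0 <= slice t f g p)%E.
Proof.
by apply: integral_ge0 => z _; rewrite lee_fin; apply: tensor_ge0 => // y; exact: normr_ge0.
Qed.

Variable B : R.
Hypothesis KB : forall x, K x <= B.
Hypothesis formC : forall phi psi, test_function phi -> test_function psi ->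
  form K phi psi = form K psi phi.
Hypothesis form_ge0 : forall phi, test_function phi -> 0 <= form K phi phi.

Lemma measurable_cut_slice t f s w : measurable_field t f ->
  measurable_fun setT (fun y => `|cut t f s y w|).
Proof.
move=> mf; apply: measurableT_comp => //.
apply: (measurableT_comp (f := fun q : measurableTypeR R * V * Omega =>
  cut t f q.1.1 q.1.2 q.2) mf (g := fun y => ((s, y), w))).
by apply: measurable_fun_pair => //; exact: pair1_measurable.
Qed.

Lemma bil_young t f g (e : R) : 0 < e -> measurable_field t f -> measurable_field t g ->
  (2%:E * \int[event_space]_q `|bil t f g q|%:E <=
   e%:E * sqnorm_field t f + e^-1%:E * sqnorm_field t g)%E.
Proof.
move=> e0 mf mg; rewrite /sqnorm_field.
have [mfg ->] := measurable_slice mf mg.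
have [mff ->] := measurable_slice mf mf.
have [mgg ->] := measurable_slice mg mg.
have ei0 : 0 <= e^-1 by rewrite invr_ge0 ltW.
rewrite -!ge0_integralZl_EFin ?(ltW e0)//; try (by move=> p _; exact: slice_ge0).
rewrite -ge0_integralD//; last 4 first.
- by move=> p _; apply: mule_ge0; [rewrite lee_fin ltW|exact: slice_ge0].
- exact: measurable_funeM.
- by move=> p _; apply: mule_ge0; [rewrite lee_fin|exact: slice_ge0].
- exact: measurable_funeM.
apply: ge0_le_integral; first exact: measurableT.
- by move=> p _; apply: mule_ge0; [rewrite lee_fin|exact: slice_ge0].
- exact: measurable_funeM.
- by apply: emeasurable_funD; exact: measurable_funeM.
- move=> [w s] _; apply: (tensor_young mK K0 KB formC form_ge0 e0).
  + exact: measurable_cut_slice.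
  + exact: measurable_cut_slice.
  + by move=> y; exact: normr_ge0.
  + by move=> y; exact: normr_ge0.
Qed.

End fields.

(** * The isometry for simple integrands *)

Section simple_isometry.
Context {R : realType} {d : nat} {disp : measure_display}.
Context {Omega : measurableType disp} (P : probability Omega R).
Context (K : euclidean R d -> R) (B : R).
Context (F : R -> set (set Omega)) (W : R -> (euclidean R d -> R) -> Omega -> R).
Hypotheses (mK : measurable_fun setT K) (K0 : forall x, 0 <= K x)
  (KB : forall x, K x <= B) (Ffilt : filtration F) (HW : spatial_noise P K F W).
Notation V := (euclidean R d).
Notation step := (@step R d disp Omega).
Implicit Types (p q : step) (l : seq step) (t : R).

Definition step_field p s y w :=
  step_weight p w * \1_(`]step_start p, step_end p]) s * step_profile p y.

Definition step_time p q t (s : R) : R := (if 0 < s < t then 1 else 0) *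
  \1_(`]step_start p, step_end p]) s * \1_(`]step_start q, step_end q]) s.

(** Nested minima reproduce the endpoints of the truncated blocks, so that this is the overlap
    length appearing in [Ex_block2]. *)
Definition overlap p q t : R :=
  Num.max 0 (Num.min (Num.min t (step_end p)) (Num.min t (step_end q)) -
             Num.max (Num.min t (step_start p)) (Num.min t (step_start q))).

Lemma step_time_indic p q t : 0 <= step_start p ->
  exists2 i : interval R, step_time p q t = \1_[set` i] &
    (@lebesgue_measure R [set` i] = (overlap p q t)%:E)%E.
Proof.
move=> p0; rewrite /overlap /step_time.
set a := step_start p in p0 *; set b := step_end p.
set a' := step_start q; set b' := step_end q.
have mm : Num.min (Num.min t b) (Num.min t b') = Num.min t (Num.min b b').
  by rewrite minACA minxx.
have mx : Num.max (Num.min t a) (Num.min t a') = Num.min t (Num.max a a').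
  by rewrite -min_maxr.
rewrite mm mx; set A := Num.max a a'; set C := Num.min b b'.
have A0 : 0 <= A by rewrite /A le_max p0.
have E s : (if 0 < s < t then 1 else 0) * \1_`]a, b] s * \1_`]a', b'] s =
    ((s < t) && (A < s <= C))%:R :> R.
  rewrite !indicE !mem_setE !in_itv/= /A /C gt_max le_min.
  have [as_|sa] := ltP a s; last by rewrite /= ?mulr0 ?mul0r andbF.
  have s0 : 0 < s := le_lt_trans p0 as_.
  by rewrite s0/=; case: (s < t); case: (s <= b); case: (a' < s); case: (s <= b');
    rewrite /= ?mulr0 ?mulr1 ?mul0r.
(* The common interval ends with one of the steps, endpoint included, or is cut at t, endpoint
   excluded; its length is the same either way. *)
have [Ct|tC] := ltP C t.
  exists `]A, C].
    apply/funext => s; rewrite E indicE mem_setE in_itv/=; congr (_%:R).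
    case: (boolP (A < s <= C)) => [/andP[_ sC]|_]; last by rewrite andbF.
    by rewrite (le_lt_trans sC).
  rewrite lebesgue_measure_itv/= lte_fin.
  have [AC|CA] := ltP A C; last by rewrite max_l// subr_le0 le_min CA ltW.
  rewrite (min_r (le_trans (ltW AC) (ltW Ct))).
  by rewrite max_r -?EFinB// subr_ge0 ltW.
exists `]A, t[.
  apply/funext => s; rewrite E indicE mem_setE in_itv/=; congr (_%:R).
  rewrite andbC; case: (A < s) => //=; have [st|] := ltP s t; last by rewrite andbF.
  by rewrite (le_trans (ltW st)).
rewrite lebesgue_measure_itv/= lte_fin.
have [At|tA] := ltP A t; last by rewrite subrr maxxx.
by rewrite max_r -?EFinB// subr_ge0 ltW.
Qed.

Lemma integral_step_time p q t : 0 <= step_start p ->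
  (@lebesgue_measure R).-integrable setT (EFin \o step_time p q t) /\
  \int[@lebesgue_measure R]_s step_time p q t s = overlap p q t.
Proof.
move=> p0; have [i Ei li] := step_time_indic q t p0.
have mi : measurable [set` i] by exact: measurable_itv.
split; last first.
  by rewrite /Rintegral Ei integral_indic// setIT; exact: (congr1 fine li).
apply/integrableP; rewrite Ei; split.
  by apply/measurable_EFinP; exact: measurable_indic.
under eq_integral do rewrite gee0_abs ?lee_fin//.
rewrite integral_indic// setIT.
by apply: (@le_lt_trans _ _ (overlap p q t)%:E); [rewrite -li|rewrite ltry].
Qed.

Lemma bil_step p q t u : bil K t (step_field p) (step_field q) u =
  (step_weight p u.1 * step_weight q u.1) *
  (step_time p q t u.2.1 * tensor K (step_profile p) (step_profile q) u.2.2).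
Proof.
rewrite /bil /cut /step_field /step_time /tensor.
by case: ifP => _; [ring|rewrite !mul0r mulr0].
Qed.

Lemma step_measurable p : predictable_step F p -> measurable_fun setT (step_weight p).
Proof.
by move=> [p0 _ pF _ _]; exact: measurable_wrt_fun (filtration_measurable Ffilt p0) pF.
Qed.

Lemma step_weight_integrable p q : predictable_step F p -> predictable_step F q ->
  P.-integrable setT (EFin \o (fun w => step_weight p w * step_weight q w)).
Proof.
move=> pp pq.
have s (r : step) : predictable_step F r -> sqint P (step_weight r).
  move=> pr; have [_ _ _ [M HM] _] := pr.
  have : sqint P (fun w => step_weight r w * cst 1 w).
    by apply: sqintMb; [exact: sqint_cst|exact: (step_measurable pr)|exists M].
  by rewrite (_ : (fun w => _) = step_weight r)//; apply/funext => w; rewrite mulr1.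
by apply: sqintM; exact: s.
Qed.

Lemma integral_bil_step p q t : predictable_step F p -> predictable_step F q ->
  (event_space P).-integrable setT (EFin \o bil K t (step_field p) (step_field q)) /\
  \int[event_space P]_u bil K t (step_field p) (step_field q) u =
    Ex P (fun w => step_weight p w * step_weight q w) *
    (overlap p q t * form K (step_profile p) (step_profile q)).
Proof.
move=> pp pq; have [p0 _ _ _ tp] := pp; have [_ _ _ _ tq] := pq.
have [i1 e1] := integral_step_time q t p0.
have i2 := integrable_tensor mK K0 KB tp tq.
have [i12 e12] := integrable_sigma_prod i1 i2.
have [i3 e3] := integrable_sigma_prod (step_weight_integrable pp pq) i12.
have -> : bil K t (step_field p) (step_field q) = (fun u =>
    (step_weight p u.1 * step_weight q u.1) *
    (step_time p q t u.2.1 * tensor K (step_profile p) (step_profile q) u.2.2)).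
  by apply/funext => u; exact: bil_step.
by split => //; rewrite [LHS]e3 e12 e1.
Qed.

Definition step_integral t p w := block W (Num.min t (step_start p))
  (Num.min t (step_end p)) (step_weight p) (step_profile p) w.

Lemma step_known t p : predictable_step F p -> 0 <= t ->
  [/\ 0 <= Num.min t (step_start p),
      Num.min t (step_start p) <= Num.min t (step_end p),
      known F (Num.min t (step_start p)) (Num.min t (step_end p)) (step_weight p) &
      test_function (step_profile p)].
Proof.
move=> pp t0; have [p0 pe pF pb tp] := pp; split => //.
- by rewrite le_min t0.
- by rewrite le_min !ge_min lexx pe orbT.
- split => //; first exact: step_measurable.
  have [ta|at_] := leP t (step_start p); last by [].
  by rewrite min_l ?ltxx// (le_trans ta).
Qed.

Lemma sqint_step t p : predictable_step F p -> 0 <= t -> sqint P (step_integral t p).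
Proof.
by move=> pp t0; have [h1 h2 h3 h4] := step_known pp t0; exact: (sqint_block Ffilt HW).
Qed.

Lemma step_isometry t p q : predictable_step F p -> predictable_step F q -> 0 <= t ->
  Ex P (fun w => step_integral t p w * step_integral t q w) =
  \int[event_space P]_u bil K t (step_field p) (step_field q) u.
Proof.
move=> pp pq t0; have [h1 h2 h3 h4] := step_known pp t0.
have [k1 k2 k3 k4] := step_known pq t0.
rewrite (integral_bil_step t pp pq).2.
by rewrite (Ex_block2 mK K0 KB Ffilt HW).
Qed.

Definition predictable l := forall p, List.In p l -> predictable_step F p.

Lemma simple_integralE l t :
  simple_integral W l t = fun w => \sum_(p <- l) step_integral t p w.
Proof. by []. Qed.

Lemma sqint_simple l t : predictable l -> 0 <= t -> sqint P (simple_integral W l t).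
Proof. by move=> pl t0; apply: sqint_sum => p pin; apply: sqint_step => //; exact: pl. Qed.

Lemma Ex_simple l t : predictable l -> 0 <= t -> Ex P (simple_integral W l t) = 0.
Proof.
move=> pl t0; rewrite simple_integralE.
have ii p : List.In p l -> P.-integrable setT (EFin \o step_integral t p).
  by move=> pin; apply: sqint_integrable; apply: sqint_step => //; exact: pl.
have [_ E] := integrable_Rsum ii; rewrite /Ex E.
have : forall p, List.In p l -> Ex P (step_integral t p) = 0.
  move=> p /pl pp; have [h1 h2 h3 h4] := step_known pp t0.
  exact: (Ex_block Ffilt HW).
rewrite /Ex; elim: l {pl ii E} => [|p l IH] h; first by rewrite big_nil.
by rewrite big_cons (h p (or_introl erefl)) add0r IH// => q qin; apply: h; right.
Qed.

Lemma bil_simple l l' t u :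
  bil K t (simple_integrand l) (simple_integrand l') u =
  \sum_(p <- l) \sum_(q <- l') bil K t (step_field p) (step_field q) u.
Proof.
transitivity (\sum_(p <- l) bil K t (step_field p) (simple_integrand l') u).
  rewrite /bil /cut; case: ifP => _; last first.
    by rewrite !mul0r big1// => p _; rewrite !mul0r.
  by rewrite /simple_integrand -!mulr_suml.
apply: eq_bigr => p _; rewrite /bil /cut; case: ifP => _; last first.
  by rewrite !mul0r big1// => q _; rewrite !mul0r.
by rewrite /simple_integrand mulr_sumr mulr_suml.
Qed.

Lemma simple_isometry l l' t : predictable l -> predictable l' -> 0 <= t ->
  (event_space P).-integrable setT
    (EFin \o bil K t (simple_integrand l) (simple_integrand l')) /\
  Ex P (fun w => simple_integral W l t w * simple_integral W l' t w) =
  \int[event_space P]_u bil K t (simple_integrand l) (simple_integrand l') u.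
Proof.
move=> pl pl' t0.
have i1 p q : List.In p l -> List.In q l' -> (event_space P).-integrable setT
    (EFin \o bil K t (step_field p) (step_field q)).
  by move=> /pl pp /pl' pq; exact: (integral_bil_step t pp pq).1.
have i2 p q : List.In p l -> List.In q l' -> P.-integrable setT
    (EFin \o (fun w => step_integral t p w * step_integral t q w)).
  by move=> /pl pp /pl' pq; apply: sqintM; exact: sqint_step.
have [j1 e1] := integrable_Rsum2 i1; have [j2 e2] := integrable_Rsum2 i2.
have bE : bil K t (simple_integrand l) (simple_integrand l') = fun u =>
    \sum_(p <- l) \sum_(q <- l') bil K t (step_field p) (step_field q) u.
  by apply/funext => u; exact: bil_simple.
rewrite bE; split => //; rewrite e1.
have -> : (fun w => simple_integral W l t w * simple_integral W l' t w) = fun w =>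
    \sum_(p <- l) \sum_(q <- l') step_integral t p w * step_integral t q w.
  apply/funext => w; rewrite simple_integralE mulr_suml; apply: eq_bigr => p _.
  by rewrite simple_integralE mulr_sumr.
rewrite [LHS]e2.
have : forall p q, List.In p l -> List.In q l' ->
    Ex P (fun w => step_integral t p w * step_integral t q w) =
    \int[event_space P]_u bil K t (step_field p) (step_field q) u.
  by move=> p q /pl pp /pl' pq; exact: step_isometry.
rewrite /Ex; clear; elim: l => [|p l IH] h; first by rewrite !big_nil.
rewrite !big_cons IH; last by move=> r q rl ql; apply: h => //; right.
congr (_ + _); have {h} := fun q => h p q (or_introl erefl).
elim: l' {IH} => [|q l' IH] h; first by rewrite !big_nil.
rewrite !big_cons IH; last by move=> r rl; apply: h; right.
by rewrite (h q (or_introl erefl)).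
Qed.

Lemma measurable_simple l t : predictable l -> measurable_field t (simple_integrand l).
Proof.
move=> pl; apply: measurable_fun_ifT => //.
  have mfst : measurable_fun setT (fun q : measurableTypeR R * V * Omega => q.1.1).
    exact: (measurableT_comp measurable_fst measurable_fst).
  apply: measurable_and.
    by apply: (@measurable_fun_ltr _ _ _ setT (cst 0)).
  by apply: (@measurable_fun_ltr _ _ _ setT _ (cst t)).
rewrite /simple_integrand; elim: l pl => [|p l IH] pl.
  rewrite (_ : (fun _ => _) = cst 0)//.
  by apply/funext => q; rewrite big_nil.
under eq_fun do rewrite big_cons.
have pp := pl p (or_introl erefl); have [_ _ _ _ [mp _]] := pp.
apply: measurable_funD; last by apply: IH => q qin; apply: pl; right.
apply: measurable_funM.
  apply: measurable_funM.
    by apply: (measurableT_comp (step_measurable pp)); exact: measurable_snd.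
  apply: (measurableT_comp (f := \1_(`]step_start p, step_end p]) : R -> R)).
    exact: measurable_indic.
  exact: (measurableT_comp measurable_fst measurable_fst).
apply: (measurableT_comp mp).
exact: (measurableT_comp measurable_snd measurable_fst).
Qed.

End simple_isometry.

(** * Passage to the limit in the isometry *)

(** The order of choices matters: e first, to make [e c] small, and then n, to make the error small
    against 1 + 1/e. *)
Lemma eq_of_young_limit (R : realType) (A A' c : R) (a : nat -> \bar R) : 0 <= c ->
  (a @ \oo --> 0%E) ->
  (forall (n : nat) (e : R), 0 < e ->
    (`|A - A'|%:E <= (e * c)%:E + (1 + e^-1)%:E * a n)%E) ->
  A = A'.
Proof.
move=> c0 acv h.
suff : `|A - A'| <= 0 by rewrite normr_le0 subr_eq0 => /eqP.
apply/ler_addgt0Pr => eps eps0; rewrite add0r.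
pose e := eps / 2 / (c + 1).
have e0 : 0 < e by rewrite !divr_gt0// ltr_wpDl.
pose del := eps / 2 / (1 + e^-1).
have k0 : 0 < 1 + e^-1 by rewrite addr_gt0// invr_gt0.
have del0 : 0 < del by rewrite !divr_gt0.
have [n an] : exists n, (a n <= del%:E)%E.
  have /fine_cvgP[afin acv'] := acv.
  have /cvgrPdist_lt /(_ del del0) H := acv'.
  have [N _ HN] : \forall n \near \oo, (a n <= del%:E)%E.
    near=> n.
    have fn : a n \is a fin_num by near: n.
    have : `|0 - (fine \o a) n| < del by near: n.
    rewrite sub0r normrN => /ltW /(le_trans (ler_norm _)) /=.
    by rewrite -lee_fin fineK.
  by exists N; apply: HN => /=.
have := h n e e0; move=> /le_trans /(_ (leeD2l _ (lee_wpmul2l _ an))).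
rewrite lee_fin (ltW k0) => /(_ isT); rewrite -EFinM -EFinD lee_fin => /le_trans; apply.
have -> : (1 + e^-1) * del = eps / 2 by rewrite /del mulrC divfK// gt_eqF.
have : e * c <= eps / 2.
  rewrite /e mulrAC ler_pdivrMr ?ltr_wpDl// ler_wpM2l ?divr_ge0 ?(ltW eps0)//.
  by rewrite lerDl.
by move=> ?; rewrite [leRHS](splitr eps) lerD.
Unshelve. all: by end_near. Qed.

Lemma young_norm (R : realType) (e a b : R) : 0 < e ->
  2 * `|a * b| <= e * a ^+ 2 + e^-1 * b ^+ 2.
Proof.
move=> e0; rewrite normrM.
have -> : e * a ^+ 2 + e^-1 * b ^+ 2 = e^-1 * ((e * `|a|) ^+ 2 + `|b| ^+ 2).
  by rewrite exprMn !real_normK ?num_real//; field; rewrite gt_eqF.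
rewrite -ler_pdivrMl ?invr_gt0// invrK.
have := sqr_ge0 (e * `|a| - `|b|); nra.
Qed.

(** The bookkeeping of [bil_diff_le] in the extended reals, where distributivity rests on
    nonnegativity. *)
Lemma young_sum (R : realType) (e : R) (i1 i2 i3 a b D D' : \bar R) : 0 < e ->
  (2%:E * i1 <= e^-1%:E * D + e%:E * b)%E ->
  (2%:E * i2 <= e%:E * a + e^-1%:E * D')%E ->
  (2%:E * i3 <= D + D')%E ->
  (0 <= i1)%E -> (0 <= i2)%E -> (0 <= i3)%E ->
  (0 <= a)%E -> (0 <= b)%E -> (0 <= D)%E -> (0 <= D')%E ->
  (2%:E * (i1 + i2 + i3) <= e%:E * (a + b) + (1 + e^-1)%:E * (D + D'))%E.
Proof.
move=> e0 y1 y2 y3 z1 z2 z3 n1 n2 n3 n4.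
have ei0 : 0 <= e^-1 by rewrite invr_ge0 ltW.
rewrite ge0_muleDr ?adde_ge0// ge0_muleDr//.
apply: le_trans (leeD (leeD y1 y2) y3) _.
rewrite EFinD ge0_muleDl ?lee_fin// mul1e.
rewrite (ge0_muleDr _ n1 n2) (ge0_muleDr _ n3 n4).
set x := (e^-1%:E * D)%E; set y := (e%:E * b)%E; set z := (e%:E * a)%E.
set w := (e^-1%:E * D')%E; set v := (D + D')%E.
by rewrite (addeC x y) (addeACA y x z w) (addeC y z) (addeC v) -[leLHS]addeA.
Qed.

Section limit.
Context {R : realType} {d : nat} {disp : measure_display}.
Context {Omega : measurableType disp} (P : probability Omega R).
Context (K : euclidean R d -> R) (B : R).
Context (F : R -> set (set Omega)) (W : R -> (euclidean R d -> R) -> Omega -> R).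
Hypotheses (mK : measurable_fun setT K) (K0 : forall x, 0 <= K x)
  (KB : forall x, K x <= B) (Ffilt : filtration F) (HW : spatial_noise P K F W).
Notation V := (euclidean R d).
Notation field := (R -> V -> Omega -> R).
Implicit Types (f g : field) (X Y Z : Omega -> R).

Definition sqmean X : \bar R := (\int[P]_w (X w ^+ 2)%:E)%E.

Lemma sqmean_ge0 X : (0 <= sqmean X)%E.
Proof. by apply: integral_ge0 => w _; rewrite lee_fin sqr_ge0. Qed.

Lemma sqint_sqmean X : sqint P X -> sqmean X \is a fin_num.
Proof. by move=> [_ iX]; exact: integrable_fin_num iX. Qed.

Lemma sqmean_sqint X : measurable_fun setT X -> (sqmean X < +oo)%E -> sqint P X.
Proof.
move=> mX Xoo; split => //; apply/integrableP; split.
  by apply/measurable_EFinP; exact: measurable_funX.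
by under eq_integral do rewrite gee0_abs ?lee_fin ?sqr_ge0//.
Qed.

(** Z Z' - X Y is a sum of products of differences with Z, Z' or one another. Expanding around the
    limits keeps the norms of the approximants X and Y out of the bound. *)
Lemma Ex_diff_le (X Y Z Z' : Omega -> R) (e : R) : 0 < e ->
  sqint P X -> sqint P Y -> sqint P Z -> sqint P Z' ->
  2 * `|Ex P (fun w => Z w * Z' w) - Ex P (fun w => X w * Y w)| <=
   e * (fine (sqmean Z) + fine (sqmean Z')) +
   (1 + e^-1) * (fine (sqmean (fun w => Z w - X w)) + fine (sqmean (fun w => Z' w - Y w))).
Proof.
move=> e0 sX sY sZ sZ'.
have sD := sqintB sZ sX; have sD' := sqintB sZ' sY.
have iZZ := sqintM sZ sZ'; have iXY := sqintM sX sY.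
have i2 U : sqint P U -> P.-integrable setT (EFin \o (fun w => U w ^+ 2)) by case.
have iZ (c : R) (U : Omega -> R) : P.-integrable setT (EFin \o U) ->
    P.-integrable setT (EFin \o (fun w => c * U w)).
  by move=> iU; rewrite (_ : _ \o _ = fun w => (c%:E * (EFin \o U) w)%E)//;
    exact: integrableZl.
have iD (U U' : Omega -> R) : P.-integrable setT (EFin \o U) ->
    P.-integrable setT (EFin \o U') ->
    P.-integrable setT (EFin \o (fun w => U w + U' w)).
  by move=> iU iU'; rewrite (_ : _ \o _ = ((EFin \o U) \+ (EFin \o U'))%E)//;
    exact: integrableD.
have iB : P.-integrable setT (EFin \o (fun w => Z w * Z' w - X w * Y w)).
  by rewrite (_ : _ \o _ = ((EFin \o (fun w => (Z w * Z' w)%R)) \-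
    (EFin \o (fun w => (X w * Y w)%R)))%E)//; exact: integrableB.
rewrite -(ExB iZZ iXY).
pose M w := e * (Z w ^+ 2 + Z' w ^+ 2) +
  (1 + e^-1) * ((Z w - X w) ^+ 2 + (Z' w - Y w) ^+ 2).
have iM1 := iD _ _ (i2 _ sZ) (i2 _ sZ').
have iM2 := iD _ _ (i2 _ sD) (i2 _ sD').
have iM : P.-integrable setT (EFin \o M) by apply: iD; apply: iZ.
have -> : e * (fine (sqmean Z) + fine (sqmean Z')) + (1 + e^-1) *
    (fine (sqmean (fun w => Z w - X w)) + fine (sqmean (fun w => Z' w - Y w))) = Ex P M.
  rewrite /Ex RintegralD//; [|exact: iZ|exact: iZ].
  rewrite !RintegralZl// !RintegralD//; by [exact: i2|].
apply: (@le_trans _ _ (2 * \int[P]_w `|Z w * Z' w - X w * Y w|)).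
  by rewrite ler_pM2l//; exact: le_normr_Rintegral.
have iN := integrable_norm iB.
rewrite -RintegralZl//; apply: le_Rintegral => //; first exact: iZ.
move=> w _; rewrite /M.
have -> : Z w * Z' w - X w * Y w = Z' w * (Z w - X w) + Z w * (Z' w - Y w)
   - (Z w - X w) * (Z' w - Y w) by ring.
have y1 := young_norm (Z' w) (Z w - X w) e0.
have y2 := young_norm (Z w) (Z' w - Y w) e0.
have y3 := young_norm (Z w - X w) (Z' w - Y w) (@ltr01 R).
rewrite invr1 !mul1r in y3.
have n1 := ler_normB (Z' w * (Z w - X w) + Z w * (Z' w - Y w)) ((Z w - X w) * (Z' w - Y w)).
have n2 := ler_normD (Z' w * (Z w - X w)) (Z w * (Z' w - Y w)).
move: n1 n2 y1 y2 y3; lra.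
Qed.

Notation NN t f := (sqnorm_field P K t f).
Notation fdiff f g := (fun s y w => f s y w - g s y w).

Lemma measurable_fdiff t f g : measurable_field t f -> measurable_field t g ->
  measurable_field t (fdiff f g).
Proof.
move=> mf mg; rewrite /measurable_field.
rewrite (_ : (fun q : _ => _) = (fun q : measurableTypeR R * V * Omega =>
  cut t f q.1.1 q.1.2 q.2 - cut t g q.1.1 q.1.2 q.2)); first exact: measurable_funB.
by apply/funext => q; rewrite /cut; case: ifP => _; rewrite ?subr0.
Qed.

Lemma integrable_bil t f g : measurable_field t f -> measurable_field t g ->
  (NN t f < +oo)%E -> (NN t g < +oo)%E ->
  (event_space P).-integrable setT (EFin \o bil K t f g).
Proof.
move=> mf mg Nf Ng; apply/integrableP; split.
  by apply/measurable_EFinP; exact: measurable_bil.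
have := bil_young P mK K0 KB (noise_formC mK K0 KB HW) (noise_form_ge0 mK K0 KB HW)
  (@ltr01 R) mf mg.
rewrite invr1 !mul1e => h.
rewrite -(@lte_pmul2l _ 2%:E)// mulr_infty gtr0_sg// mul1e.
by apply: le_lt_trans h _; rewrite lte_add_pinfty.
Qed.

(** The counterpart of [Ex_diff_le] for fields, with the same expansion and with [bil_young] for the
    three products. *)
Lemma bil_diff_le t f g f' g' (e : R) : 0 < e ->
  measurable_field t f -> measurable_field t g ->
  measurable_field t f' -> measurable_field t g' ->
  (NN t f < +oo)%E -> (NN t g < +oo)%E ->
  (event_space P).-integrable setT (EFin \o bil K t f' g') ->
  ((2 * `|\int[event_space P]_q bil K t f g q - \int[event_space P]_q bil K t f' g' q|)%:E <=
    e%:E * (NN t f + NN t g) +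
    (1 + e^-1)%:E * (NN t (fdiff f f') + NN t (fdiff g g')))%E.
Proof.
move=> e0 mf mg mf' mg' Nf Ng i'.
have md := measurable_fdiff mf mf'; have md' := measurable_fdiff mg mg'.
have ifg := integrable_bil mf mg Nf Ng.
have NN0 h : (0 <= NN t h)%E by apply: integral_ge0 => q _; rewrite lee_fin.
have ei0 : 0 < e^-1 by rewrite invr_gt0.
pose I h1 h2 := (\int[event_space P]_q `|bil K t h1 h2 q|%:E)%E.
have mI h1 h2 : measurable_field t h1 -> measurable_field t h2 ->
    measurable_fun setT (fun q => `|bil K t h1 h2 q|%:E).
  move=> m1 m2; apply/measurable_EFinP; apply: measurableT_comp => //.
  exact: measurable_bil.
have Y a h1 h2 := @bil_young R d _ _ P K mK K0 B KB (noise_formC mK K0 KB HW)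
  (noise_form_ge0 mK K0 KB HW) t h1 h2 a.
have step1 : (`|\int[event_space P]_q bil K t f g q -
      \int[event_space P]_q bil K t f' g' q|%:E <=
    I (fdiff f f') g + I f (fdiff g g') + I (fdiff f f') (fdiff g g'))%E.
  rewrite -RintegralB//.
  have iB : (event_space P).-integrable setT
      (EFin \o (fun q => bil K t f g q - bil K t f' g' q)).
    rewrite (_ : _ \o _ = ((EFin \o bil K t f g) \- (EFin \o bil K t f' g'))%E)//.
    exact: integrableB.
  rewrite (EFin_normr_Rintegral measurableT iB).
  apply: le_trans (le_abse_integral _ _ _) _ => //; first by case/integrableP: iB.
  have b0 h1 h2 q : (0 <= `|bil K t h1 h2 q|%:E)%E by rewrite lee_fin.
  rewrite /I -ge0_integralD; [|exact: measurableT|by move=> q _|exact: mI|by move=> q _|exact: mI].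
  rewrite -ge0_integralD; [|exact: measurableT|by move=> q _; exact: adde_ge0|
    by apply: emeasurable_funD; exact: mI|by move=> q _|exact: mI].
  apply: ge0_le_integral; first exact: measurableT.
  - by move=> q _; exact: abse_ge0.
  - by apply: measurableT_comp => //; case/integrableP: iB.
  - by apply: emeasurable_funD; [apply: emeasurable_funD|]; exact: mI.
  - move=> q _; rewrite abse_EFin -!EFinD lee_fin.
    have -> : bil K t f g q - bil K t f' g' q =
      bil K t (fdiff f f') g q + bil K t f (fdiff g g') q - bil K t (fdiff f f') (fdiff g g') q.
      by rewrite /bil /cut; case: ifP => _; ring.
    by apply: le_trans (ler_normB _ _) _; rewrite lerD2r; exact: ler_normD.
rewrite EFinM; apply: le_trans (lee_wpmul2l _ step1) _ => //.
have I0 h1 h2 : (0 <= I h1 h2)%E by apply: integral_ge0 => q _; rewrite lee_fin.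
have y1 : (2%:E * I (fdiff f f') g <=
    e^-1%:E * NN t (fdiff f f') + e%:E * NN t g)%E.
  by have := Y e^-1 _ _ ei0 md mg; rewrite invrK.
have y2 : (2%:E * I f (fdiff g g') <= e%:E * NN t f + e^-1%:E * NN t (fdiff g g'))%E.
  exact: Y e _ _ e0 mf md'.
have y3 : (2%:E * I (fdiff f f') (fdiff g g') <= NN t (fdiff f f') + NN t (fdiff g g'))%E.
  by have := Y 1 _ _ ltr01 md md'; rewrite invr1 !mul1e.
have z1 := I0 (fdiff f f') g; have z2 := I0 f (fdiff g g').
have z3 := I0 (fdiff f f') (fdiff g g').
have n1 := NN0 f; have n2 := NN0 g; have n3 := NN0 (fdiff f f'); have n4 := NN0 (fdiff g g').
exact: young_sum e0 y1 y2 y3 z1 z2 z3 n1 n2 n3 n4.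
Qed.

(** Both sides are close to the common value given by [simple_isometry], in the sense of
    [eq_of_young_limit]. *)
Lemma stochastic_isometry t f g Z Z' : 0 <= t ->
  measurable_field t f -> measurable_field t g ->
  (NN t f < +oo)%E -> (NN t g < +oo)%E ->
  stochastic_integral P K F W t f Z -> stochastic_integral P K F W t g Z' ->
  [/\ sqint P Z, Ex P Z = 0 &
      Ex P (fun w => Z w * Z' w) = \int[event_space P]_q bil K t f g q].
Proof.
move=> t0 mf mg Nf Ng [mZ [l [pl fl Zl]]] [mZ' [l' [pl' gl' Zl']]].
have sqE (U : Omega -> R) : ('E_P[(fun w => `|U w| ^+ 2)%R])%E = sqmean U.
  rewrite unlock; apply: eq_integral => w _ /=.
  by rewrite real_normK ?num_real.
have sq0 (U : Omega -> R) (k : nat -> seq (@step R d _ Omega)) : measurable_fun setT U ->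
    (forall n, predictable F (k n)) ->
    (fun n => 'E_P[(fun w => `|U w - simple_integral W (k n) t w| ^+ 2)%R])%E
      @ \oo --> 0%E -> sqint P U.
  move=> mU pk Uk.
  (* Convergence to 0 makes the distances eventually finite, so U is a square-integrable simple
     integral plus a square-integrable error. *)
  have /fine_cvgP[[N _ HN] _] := Uk.
  have fN := HN N (leqnn N); rewrite /= sqE in fN.
  have sI := sqint_simple Ffilt HW (pk N) t0; have [mI _] := sI.
  have sD : sqint P (fun w => U w - simple_integral W (k N) t w).
    apply: sqmean_sqint; first exact: measurable_funB.
    by rewrite -ge0_fin_numE ?sqmean_ge0.
  have := sqintD sD sI; rewrite (_ : (fun w => _) = U)//.
  by apply/funext => w; rewrite subrK.
have sZ : sqint P Z by exact: sq0 mZ pl Zl.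
have sZ' : sqint P Z' by exact: sq0 mZ' pl' Zl'.
have sI n := sqint_simple Ffilt HW (pl n) t0.
have sI' n := sqint_simple Ffilt HW (pl' n) t0.
have dcv (U : Omega -> R) (k : nat -> seq (@step R d _ Omega)) :
    (fun n => 'E_P[(fun w => `|U w - simple_integral W (k n) t w| ^+ 2)%R])%E
      @ \oo --> 0%E ->
    (fun n => sqmean (fun w => U w - simple_integral W (k n) t w)) @ \oo --> 0%E.
  by under eq_fun do rewrite (sqE (fun w => U w - simple_integral W (k _) t w)).
have zl := dcv _ _ Zl; have zl' := dcv _ _ Zl'.
have ncv (h : field) (k : nat -> seq (@step R d _ Omega)) : measurable_field t h ->
    (forall n, predictable F (k n)) ->
    (fun n => integrand_norm2 P K t (fun s y w => h s y w - simple_integrand (k n) s y w))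
      @ \oo --> 0%E ->
    (fun n => NN t (fdiff h (simple_integrand (k n)))) @ \oo --> 0%E.
  move=> mh pk; rewrite (_ : (fun n => integrand_norm2 _ _ _ _) =
    (fun n => NN t (fdiff h (simple_integrand (k n)))))//.
  apply/funext => n; rewrite integrand_norm2E//; apply: measurable_fdiff => //.
  exact: (measurable_simple Ffilt t (pk n)).
have fl' := ncv _ _ mf pl fl; have gl := ncv _ _ mg pl' gl'.
have NN0 h : (0 <= NN t h)%E by apply: integral_ge0 => q _; rewrite lee_fin.
split => //.
  (* The mean is the product with the constant 1, which is its own approximation and accounts for
     the summand 1. *)
  apply: (@eq_of_young_limit _ _ _ (1 + fine (sqmean Z) )
    (fun n => sqmean (fun w => Z w - simple_integral W (l n) t w))) => //.
    by rewrite addr_ge0// fine_ge0// sqmean_ge0.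
  move=> n e e0.
  have sD := sqintB sZ (sI n).
  have fD := sqint_sqmean sD.
  have s1 := sqint_cst P (1 : R).
  have h := Ex_diff_le e0 (sI n) s1 sZ s1.
  have E1 U : Ex P (fun w => U w * cst 1 w) = Ex P U.
    by congr Ex; apply/funext => w; rewrite mulr1.
  rewrite !E1 (Ex_simple Ffilt HW (pl n) t0) in h.
  rewrite -(fineK fD) -EFinM -EFinD lee_fin.
  have E2 : fine (sqmean (cst 1)) = 1.
    rewrite /sqmean; under eq_integral do rewrite expr1n.
    by rewrite integral_cst// mul1e; exact: (congr1 fine (probability_setT P)).
  have E3 : fine (sqmean (fun w => cst 1 w - cst 1 w)) = 0 :> R.
    rewrite /sqmean; under eq_integral do rewrite subrr expr0n.
    by rewrite integral0.
  rewrite E2 E3 addr0 in h.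
  have c0 := normr_ge0 (Ex P Z - 0); rewrite (addrC 1).
  by move: h c0; lra.
apply: (@eq_of_young_limit _ _ _ ((fine (sqmean Z) + fine (sqmean Z')) +
    (fine (NN t f) + fine (NN t g)))
  (fun n => (sqmean (fun w => Z w - simple_integral W (l n) t w)%R +
    sqmean (fun w => Z' w - simple_integral W (l' n) t w)%R +
    (NN t (fdiff f (simple_integrand (l n))) +
     NN t (fdiff g (simple_integrand (l' n)))))%E)).
- by rewrite !addr_ge0// fine_ge0// ?sqmean_ge0.
- rewrite -[X in _ --> X]adde0 -[X in _ --> (_ + X)%E]adde0 -[X in _ --> (X + _)%E]adde0.
  by apply: cvgeD => //; apply: cvgeD.
move=> n e e0.
have [ibn isom] := simple_isometry mK K0 KB Ffilt HW (pl n) (pl' n) t0.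
have h1 := Ex_diff_le e0 (sI n) (sI' n) sZ sZ'; rewrite isom in h1.
have h2 := bil_diff_le e0 mf mg (measurable_simple Ffilt t (pl n))
  (measurable_simple Ffilt t (pl' n)) Nf Ng ibn.
set X := Ex P _ in h1 *; set Y := \int[_]_q bil K t f g q in h2 *.
set A := \int[_]_q _ in h1 h2.
set a := fine (sqmean (fun w => Z w - _)) in h1.
set a' := fine (sqmean (fun w => Z' w - _)) in h1.
have fa : sqmean (fun w => Z w - simple_integral W (l n) t w) = a%:E.
  by rewrite fineK//; apply: sqint_sqmean; exact: sqintB.
have fa' : sqmean (fun w => Z' w - simple_integral W (l' n) t w) = a'%:E.
  by rewrite fineK//; apply: sqint_sqmean; exact: sqintB.
rewrite fa fa'.
have fNf : NN t f \is a fin_num by rewrite ge0_fin_numE.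
have fNg : NN t g \is a fin_num by rewrite ge0_fin_numE.
rewrite -(fineK fNf) -(fineK fNg) in h2 *.
set nf := fine (NN t f) in h2 *; set ng := fine (NN t g) in h2 *.
set u := (NN t _ + NN t _)%E in h2 *.
have u0 : (0 <= u)%E by exact: adde_ge0.
have a0 : 0 <= a + a' by rewrite addr_ge0// fine_ge0// sqmean_ge0.
have ei0 : 0 <= 1 + e^-1 by rewrite addr_ge0// invr_ge0 ltW.
(* If the field error is infinite for this n, so is the right side. *)
have [uf|] := boolP (u \is a fin_num); last first.
  rewrite ge0_fin_numE// -leNgt leye_eq => /eqP ->.
  by rewrite addey// gt0_muley ?addey// ?leey// lte_fin ltr_wpDr// invr_ge0 ltW.
have {}h2 : 2 * `|Y - A| <= e * (nf + ng) + (1 + e^-1) * fine u.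
  by rewrite -lee_fin [leRHS]EFinD [X in (_ <= X + _)%E]EFinM
    [X in (_ <= _ + X)%E]EFinM (EFinD nf) (fineK uf).
rewrite (_ : (_ + _)%E = (e * (fine (sqmean Z) + fine (sqmean Z') + (nf + ng)) +
    (1 + e^-1) * (a + a' + fine u))%:E); last first.
  by rewrite [RHS]EFinD [X in (_ = _ + X)%E]EFinM (EFinD (a + a')) (EFinD a) (fineK uf).
rewrite lee_fin.
have tri := ler_distD A X Y.
rewrite (distrC A Y) in tri.
have : 0 <= e * (nf + ng + (fine (sqmean Z) + fine (sqmean Z'))).
  by rewrite mulr_ge0 ?(ltW e0)// !addr_ge0// fine_ge0// ?sqmean_ge0.
have : 0 <= (1 + e^-1) * (a + a' + fine u).
  by rewrite mulr_ge0// addr_ge0// fine_ge0.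
move: h1 h2 tri.
set p := fine (sqmean Z); set q := fine (sqmean Z').
rewrite !mulrDr; lra.
Qed.

End limit.

(** * The integral inequality for the two-point function *)

Section mild_moment_inequality.
Context {R : realType} {d : nat} (hd : (3 <= d)%N) {disp : measure_display}.
Context {Omega : measurableType disp} (P : probability Omega R).
Context (rho beta : R) (rho_gt0 : 0 < rho) (rho_lt1 : rho < 1).
Context (F : R -> set (set Omega)) (W : R -> (euclidean R d -> R) -> Omega -> R).
Context (u : R -> euclidean R d -> Omega -> R).
Hypotheses (Ffilt : filtration F) (HW : spatial_noise P (riesz_reg rho) F W)
  (Hu : mild_solution P rho beta F W (fun=> 1) u).
Notation V := (euclidean R d).
Notation K := (@riesz_reg R d rho).
Implicit Types (t s : R) (x y : V).

Let mK : measurable_fun setT K := measurable_riesz_reg rho.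
Let K0 (x : V) : 0 <= K x := riesz_reg_ge0 rho x.
Let KB (x : V) : K x <= heat_rpow_const d / rho := riesz_reg_le_cst hd rho_gt0 x.

(** Extension by 0 to negative times, which makes the solution measurable on the whole product
    space. *)
Definition upos s y w : R := if 0 <= s then u s y w else 0.

Lemma measurable_upos : measurable_fun setT
  (fun q : measurableTypeR R * V * Omega => upos q.1.1 q.1.2 q.2).
Proof.
have mD : measurable [set q : measurableTypeR R * V * Omega | 0 <= q.1.1].
  have mfst : measurable_fun setT (fun q : measurableTypeR R * V * Omega => 0 <= q.1.1).
    apply: (@measurable_fun_ler _ _ _ setT (cst 0)) => //.
    exact: (measurableT_comp measurable_fst measurable_fst).
  by have := mfst measurableT [set true] I; rewrite setTI.
have := (measurable_restrictT _ mD).1 (mild_measurable Hu).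
congr measurable_fun; apply/funext => q.
by rewrite patchE /upos mem_setE.
Qed.

Lemma measurable_upos_pair : measurable_fun setT
    (fun r : spacetime R d * Omega => upos r.1.1 r.1.2.1 r.2) /\
  measurable_fun setT (fun r : spacetime R d * Omega => upos r.1.1 r.1.2.2 r.2).
Proof.
have m1 := measurable_upos.
split.
  apply: (measurableT_comp m1 (g := fun r : spacetime R d * Omega => (r.1.1, r.1.2.1, r.2))).
  apply: measurable_fun_pair; last exact: measurable_snd.
  apply: measurable_fun_pair; first exact: (measurableT_comp measurable_fst measurable_fst).
  exact: (measurableT_comp measurable_spacetime1 measurable_fst).
apply: (measurableT_comp m1 (g := fun r : spacetime R d * Omega => (r.1.1, r.1.2.2, r.2))).
apply: measurable_fun_pair; last exact: measurable_snd.
apply: measurable_fun_pair; first exact: (measurableT_comp measurable_fst measurable_fst).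
exact: (measurableT_comp measurable_spacetime2 measurable_fst).
Qed.

Lemma measurable_upos_slice s y : measurable_fun setT (upos s y).
Proof.
apply: (measurableT_comp measurable_upos (g := fun w => ((s, y), w))).
exact: pair1_measurable.
Qed.

(** M may depend on rho; it serves only for finiteness and as the starting bound of [comparison]. *)
Lemma upos_moment T : exists2 M : R, 0 <= M &
  forall s y, s <= T -> sqint P (upos s y) /\ (sqmean P (upos s y) <= M%:E)%E.
Proof.
have [M HM] := mild_moment Hu T; exists `|M|; first exact: normr_ge0.
move=> s y sT.
have le : (sqmean P (upos s y) <= `|M|%:E)%E.
  rewrite /sqmean /upos; have [s0|s0] := leP 0 s; last first.
    by under eq_integral do rewrite expr0n; rewrite integral0.
  have := HM s y; rewrite s0 sT => /(_ isT); rewrite unlock => h.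
  apply: (@le_trans _ _ M%:E); last by rewrite lee_fin ler_norm.
  apply: le_trans h; rewrite le_eqVlt; apply/orP; left; apply/eqP.
  by apply: eq_integral => w _ /=; rewrite real_normK ?num_real.
split => //; apply: sqmean_sqint; first exact: measurable_upos_slice.
by apply: le_lt_trans le _; rewrite ltry.
Qed.

Definition covar (z : spacetime R d) : R :=
  Ex P (fun w => upos z.1 z.2.1 w * upos z.1 z.2.2 w).

(** Measurability of a partial integral comes from Tonelli, hence the separate treatment of positive
    and negative parts. *)
Lemma measurable_covar : measurable_fun setT covar.
Proof.
have [m1 m2] := measurable_upos_pair.
pose h (r : spacetime R d * Omega) : \bar R :=
  (upos r.1.1 r.1.2.1 r.2 * upos r.1.1 r.1.2.2 r.2)%:E.
have mh : measurable_fun setT h by apply/measurable_EFinP; exact: measurable_funM.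
rewrite (_ : covar = fun z => fine (\int[P]_w (h^\+)%E (z, w) - \int[P]_w (h^\-)%E (z, w))%E).
  apply: (@measurableT_comp _ _ _ _ _ _ fine) => //.
  apply: emeasurable_funB; apply: measurable_tonelli1.
  - exact: measurable_funepos.
  - by move=> r; exact: funepos_ge0.
  - exact: measurable_funeneg.
  - by move=> r; exact: funeneg_ge0.
apply/funext => z; rewrite /covar /Ex /Rintegral; congr fine.
rewrite [LHS]integralE; congr (_ - _)%E; apply: eq_integral => w _.
  by rewrite !funeposE.
by rewrite !funenegE.
Qed.

Lemma covar_le T (M : R) : (forall s y, s <= T -> sqint P (upos s y) /\
    (sqmean P (upos s y) <= M%:E)%E) ->
  forall s y y', s <= T ->
  (\int[P]_w `|upos s y w * upos s y' w|%:E <= M%:E)%E.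
Proof.
move=> HM s y y' sT; have [s1 l1] := HM s y sT; have [s2 l2] := HM s y' sT.
have [m1 _] := s1; have [m2 _] := s2.
have i12 := sqintM s1 s2.
have := sqint_sqmean s1; have := sqint_sqmean s2 => f2 f1.
pose g w : \bar R := ((2^-1)%:E * ((upos s y w ^+ 2)%:E + (upos s y' w ^+ 2)%:E))%E.
have mg1 : measurable_fun setT (fun w => (upos s y w ^+ 2)%:E).
  by apply/measurable_EFinP; exact: measurable_funX.
have mg2 : measurable_fun setT (fun w => (upos s y' w ^+ 2)%:E).
  by apply/measurable_EFinP; exact: measurable_funX.
apply: (@le_trans _ _ (\int[P]_w g w)%E).
  apply: ge0_le_integral; first exact: measurableT.
  - by move=> w _; rewrite lee_fin.
  - by apply/measurable_EFinP; apply: measurableT_comp => //; exact: measurable_funM.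
  - by apply: measurable_funeM; exact: emeasurable_funD.
  - move=> w _; rewrite /g -EFinD -EFinM lee_fin.
    have := young_norm (upos s y w) (upos s y' w) (@ltr01 R).
    by rewrite invr1 !mul1r; lra.
rewrite ge0_integralZl_EFin//; last 2 first.
  by move=> w _; rewrite adde_ge0// lee_fin sqr_ge0.
  exact: emeasurable_funD.
rewrite ge0_integralD//; try (by move=> w _; rewrite lee_fin sqr_ge0).
apply: (@le_trans _ _ ((2^-1)%:E * (M%:E + M%:E))%E).
  by apply: lee_wpmul2l; [rewrite lee_fin invr_ge0|exact: leeD].
by rewrite -EFinD -EFinM lee_fin; lra.
Qed.

Definition mild_field t x s y w : R := heat_kernel (t - s) (vsub x y) * (beta * u s y w).

Lemma measurable_mild_field t x : measurable_field t (mild_field t x).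
Proof.
rewrite /measurable_field.
have mq : measurable_fun setT (fun q : measurableTypeR R * V * Omega => (q.1.1 : R)).
  exact: (measurableT_comp measurable_fst measurable_fst).
rewrite (_ : (fun q : _ => _) = (fun q : measurableTypeR R * V * Omega =>
  if 0 < (q.1.1 : R) < t then heat_kernel (t - q.1.1) (vsub x q.1.2) *
    (beta * upos q.1.1 q.1.2 q.2) else 0)); last first.
  apply/funext => q; rewrite /cut /mild_field /upos.
  by case: ifP => // /andP[/ltW -> _].
apply: measurable_fun_ifT => //.
  apply: measurable_and.
    by apply: (@measurable_fun_ltr _ _ _ setT (cst 0)).
  by apply: (@measurable_fun_ltr _ _ _ setT _ (cst t)).
apply: measurable_funM; last by apply: measurable_funM => //; exact: measurable_upos.
apply: measurable_heat_kernel; first exact: measurable_funB.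
by apply: measurable_vsub => //; exact: (measurableT_comp measurable_snd measurable_fst).
Qed.

(** Separates the deterministic kernel of [duhamel] from the random factor, whose expectation is
    [covar]. *)
Lemma bil_mild t x x' (q : Omega * spacetime R d) :
  bil K t (mild_field t x) (mild_field t x') q =
  (beta ^+ 2 * pair_kernel rho t x x' q.2) *
    (upos q.2.1 q.2.2.1 q.1 * upos q.2.1 q.2.2.2 q.1).
Proof.
rewrite /bil /cut /pair_kernel /mild_field /upos.
by case: ifP => [/andP[/ltW -> _]|_]; [ring|rewrite !(mul0r, mulr0)].
Qed.

Lemma duhamel_cst_fin t x x' : 0 <= t ->
  (duhamel rho t x x' (cst 1%R) < +oo)%E.
Proof.
(* [duhamel_power_le] wants a positive exponent, and [1 + s] dominates 1. *)
move=> t0; apply: (@le_lt_trans _ _ (duhamel rho t x x' (growth 1))).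
  apply: le_duhamel => //; first exact: measurable_growth.
  move=> z /andP[z0 _]; rewrite /growth /cst ler01/= powRr1; last by rewrite addr_ge0// ltW.
  by rewrite lerDl ltW.
by apply: le_lt_trans (duhamel_power_le hd rho_gt0 x x' ltr01 t0) _; rewrite ltry.
Qed.

(** A qualitative fact at fixed rho: the second moments are bounded up to time t, so the energy is
    at most a multiple of the Duhamel integral of 1. *)
Lemma mild_field_fin t x : 0 <= t ->
  (sqnorm_field P K t (mild_field t x) < +oo)%E.
Proof.
move=> t0; have [M M0 HM] := upos_moment t.
have mb := measurable_bil mK (measurable_mild_field t x) (measurable_mild_field t x).
have mk := measurable_pair_kernel rho t x x.
have mbE : measurable_fun setT (fun q => `|bil K t (mild_field t x) (mild_field t x) q|%:E).
  by apply/measurable_EFinP; exact: measurableT_comp.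
have b0 q : (0 <= `|bil K t (mild_field t x) (mild_field t x) q|%:E)%E by rewrite lee_fin.
rewrite /sqnorm_field (tonelli2 _ _ mbE b0).
apply: (@le_lt_trans _ _ (\int[spacetime_measure (R := R) (d := d)]_z
   ((beta ^+ 2 * M)%:E * (pair_kernel rho t x x z * cst 1 z)%:E))%E).
  apply: ge0_le_integral; first exact: measurableT.
  - by move=> z _; apply: integral_ge0 => w _; exact: (b0 (w, z)).
  - apply: (@measurable_fun_fubini_tonelli_G _ _ _ _ _ P _ mbE b0).
  - by apply: measurable_funeM; apply/measurable_EFinP; exact: measurable_funM.
  - move=> z _; under eq_integral do rewrite bil_mild/=.
    have k0 := pair_kernel_ge0 rho t x x z.
    have bk0 : 0 <= beta ^+ 2 * pair_kernel rho t x x z by rewrite mulr_ge0 ?sqr_ge0.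
    have m1 := measurable_upos_slice z.1 z.2.1; have m2 := measurable_upos_slice z.1 z.2.2.
    under eq_integral do rewrite normrM (ger0_norm bk0) EFinM.
    rewrite ge0_integralZl_EFin//; last first.
      by apply/measurable_EFinP; apply: measurableT_comp => //; exact: measurable_funM.
    rewrite [leRHS](_ : _ = (beta ^+ 2 * pair_kernel rho t x x z)%:E * M%:E)%E; last first.
      by rewrite /cst mulr1 -!EFinM mulrAC.
    have [zt|tz] := leP z.1 t.
      by apply: lee_wpmul2l; [rewrite lee_fin|exact: covar_le HM _ _ _ zt].
    rewrite /pair_kernel (_ : 0 < z.1 < t = false) ?mulr0 ?mul0e//.
    by apply/negbTE; rewrite negb_and -!leNgt (ltW tz) orbT.
rewrite ge0_integralZl_EFin//; last 3 first.
- by move=> z _; rewrite lee_fin mulr_ge0 ?pair_kernel_ge0.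
- by apply/measurable_EFinP; exact: measurable_funM.
- by rewrite mulr_ge0 ?sqr_ge0.
have := duhamel_cst_fin x x t0; rewrite /duhamel => h.
rewrite lte_mul_pinfty//; first by rewrite lee_fin mulr_ge0 ?sqr_ge0.
Qed.

Lemma heat_semigroup1 t x : 0 <= t ->
  0 <= heat_semigroup t (fun=> 1) x <= 1.
Proof.
move=> t0; rewrite /heat_semigroup; case: ifPn => [_|tn0]; first by rewrite ler01 lexx.
have tp : 0 < t by rewrite lt_neqAle eq_sym tn0.
have h := integral_heat_kernel_le1 x tp.
rewrite Rintegral_ge0 /=; last by move=> y _; rewrite mulr1 heat_kernel_ge0.
under eq_Rintegral do rewrite mulr1.
rewrite -lee_fin fineK// ge0_fin_numE; first by apply: le_lt_trans h _; rewrite ltry.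
by apply: integral_ge0 => y _; rewrite lee_fin heat_kernel_ge0.
Qed.

(** Multiply the mild equations at x and x': the linear terms vanish since the stochastic integrals
    are centered, and the isometry followed by Fubini turns the quadratic term into the Duhamel
    integral of the covariance. *)
Lemma covar_duhamel t x x' : 0 <= t ->
  (`|covar (t, (x, x'))|%:E <=
   1 + (beta ^+ 2 / ln rho^-1)%:E * duhamel rho t x x' (fun z => `|covar z|%R))%E.
Proof.
move=> t0.
have [Z SZ uZ] := mild_equation Hu x t0.
have [Z' SZ' uZ'] := mild_equation Hu x' t0.
have mf := measurable_mild_field t x; have mf' := measurable_mild_field t x'.
have Nf := mild_field_fin x t0; have Nf' := mild_field_fin x' t0.
have [sZ EZ EZZ] := stochastic_isometry mK K0 KB Ffilt HW t0 mf mf' Nf Nf' SZ SZ'.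
have [sZ' EZ' _] := stochastic_isometry mK K0 KB Ffilt HW t0 mf' mf Nf' Nf SZ' SZ.
set h := heat_semigroup t _ x in uZ; set h' := heat_semigroup t _ x' in uZ'.
have /andP[h0 h1] : 0 <= h <= 1 := heat_semigroup1 x t0.
have /andP[h'0 h'1] : 0 <= h' <= 1 := heat_semigroup1 x' t0.
set c := (Num.sqrt (ln rho^-1))^-1 in uZ uZ'.
have ln0 : 0 < ln rho^-1 by rewrite ln_gt0// invf_gt1.
have cc : c * c = (ln rho^-1)^-1.
  by rewrite -invfM -expr2 sqr_sqrtr// ltW.
pose k := (ln rho^-1)^-1.
have k0 : 0 <= k by rewrite invr_ge0 ltW.
have iZ := sqint_integrable sZ; have iZ' := sqint_integrable sZ'.
have iZZ := sqintM sZ sZ'.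
have covE : covar (t, (x, x')) = h * h' + k * Ex P (fun w => Z w * Z' w).
  have sA : sqint P (fun w => h + c * Z w).
    by apply: sqintD; [exact: (sqint_cst P h)|exact: sqintZ].
  have sA' : sqint P (fun w => h' + c * Z' w).
    by apply: sqintD; [exact: (sqint_cst P h')|exact: sqintZ].
  rewrite /covar /= /Ex /Rintegral.
  rewrite (@ae_eq_integral _ _ _ _ _ (fun w => ((h + c * Z w) * (h' + c * Z' w))%:E))//.
  - have iD (U U' : Omega -> R) : P.-integrable setT (EFin \o U) ->
        P.-integrable setT (EFin \o U') ->
        P.-integrable setT (EFin \o (fun w => U w + U' w)).
      by move=> iU iU'; rewrite (_ : _ \o _ = ((EFin \o U) \+ (EFin \o U'))%E)//;
        exact: integrableD.
    have iC (a : R) (U : Omega -> R) : P.-integrable setT (EFin \o U) ->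
        P.-integrable setT (EFin \o (fun w => a * U w)).
      by move=> iU; rewrite (_ : _ \o _ = fun w => (a%:E * (EFin \o U) w)%E)//;
        exact: integrableZl.
    have i1 : P.-integrable setT (EFin \o (cst (h * h'))).
      exact: finite_measure_integrable_cst.
    have -> : (fun w => ((h + c * Z w) * (h' + c * Z' w))%:E) = EFin \o (fun w =>
        (cst (h * h') w + (h * c) * Z' w) + ((c * h') * Z w + k * (Z w * Z' w))).
      by apply/funext => w; rewrite /= /k -cc; congr EFin; ring.
    rewrite -[LHS]/(\int[P]_w ((cst (h * h') w + (h * c) * Z' w) +
      ((c * h') * Z w + k * (Z w * Z' w)))).
    rewrite RintegralD//; [|by apply: iD => //; exact: iC|by apply: iD; exact: iC].
    rewrite RintegralD//; [|exact: iC].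
    rewrite RintegralD//; [|exact: iC|exact: iC].
    rewrite (RintegralZl _ measurableT iZ') (RintegralZl _ measurableT iZ).
    rewrite (RintegralZl _ measurableT iZZ).
    rewrite -[X in _ + h * c * X]/(Ex P Z') -[X in c * h' * X]/(Ex P Z) EZ EZ' !mulr0 addr0 add0r.
    have P1 : fine (P setT) = 1 := congr1 fine (probability_setT P).
    by rewrite (Rintegral_cst P measurableT (h * h')) P1 mulr1.
  - apply/measurable_EFinP; apply: measurable_funM; exact: measurable_upos_slice.
  - by apply/measurable_EFinP; apply: measurable_funM; [case: sA|case: sA'].
  - apply: filterS2 uZ uZ' => w Hw Hw' _.
    by rewrite /upos t0 Hw Hw'.
have ib := integrable_bil mK K0 KB HW mf mf' Nf Nf'.
have Dle : (`|Ex P (fun w => Z w * Z' w)|%:E <=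
    (beta ^+ 2)%:E * duhamel rho t x x' (fun z => `|covar z|%R))%E.
  rewrite EZZ (EFin_normr_Rintegral measurableT ib) (fubini_sigma2 ib).
  have inner (z : spacetime R d) : (\int[P]_w (bil K t (mild_field t x) (mild_field t x') (w, z))%:E =
      ((beta ^+ 2 * pair_kernel rho t x x' z) * covar z)%:E)%E.
    under eq_integral do rewrite bil_mild/= EFinM.
    have [M M0 HM] := upos_moment z.1.
    have i12 := sqintM (HM z.1 z.2.1 (lexx _)).1 (HM z.1 z.2.2 (lexx _)).1.
    by rewrite integralZl// -(Ex_EFin i12) -EFinM.
  have mk := measurable_pair_kernel rho t x x'.
  have mc := measurable_covar.
  under eq_integral do rewrite inner.
  have mg : measurable_fun setT (fun z => ((beta ^+ 2 * pair_kernel rho t x x' z) * covar z)%:E).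
    by apply/measurable_EFinP; apply: measurable_funM => //; exact: measurable_funM.
  apply: le_trans (le_abse_integral _ measurableT mg) _.
  rewrite /duhamel -ge0_integralZl_EFin ?sqr_ge0//; last 2 first.
    by move=> z _; rewrite lee_fin mulr_ge0 ?pair_kernel_ge0.
    apply/measurable_EFinP; apply: measurable_funM => //.
    exact: measurableT_comp.
  rewrite le_eqVlt; apply/orP; left; apply/eqP; apply: eq_integral => z _.
  rewrite abse_EFin -EFinM mulrA normrM; congr (_ * _)%:E.
  by rewrite ger0_norm// mulr_ge0 ?sqr_ge0 ?pair_kernel_ge0.
rewrite covE.
apply: (@le_trans _ _ (1 + k * `|Ex P (fun w => Z w * Z' w)|)%:E).
  rewrite lee_fin; apply: le_trans (ler_normD _ _) _; apply: lerD.
    rewrite (ger0_norm (mulr_ge0 h0 h'0)); exact: mulr_ile1 h0 h'0 h1 h'1.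
  by rewrite normrM (ger0_norm k0).
rewrite EFinD leeD2l// EFinM (mulrC (beta ^+ 2)) EFinM -muleA.
by apply: lee_wpmul2l; [rewrite lee_fin|exact: Dle].
Qed.

End mild_moment_inequality.

(** The strength of the noise blows up as rho tends to 1, where log(1/rho) vanishes; uniformity is
    therefore claimed on []0, rho0]] with rho0 < 1. The constant is chosen before rho, the
    probability space and the solution. *)
Theorem theorem1p5 (R : realType) (d : nat) (hd : (3 <= d)%N)
    (beta : R) (hbeta : 0 < beta) (T : R) (hT : 0 < T)
    (rho0 : R) (hrho0 : 0 < rho0 < 1) :
  exists C : R,
    forall (rho : R), 0 < rho <= rho0 ->
    forall (disp : measure_display) (Omega : measurableType disp)
      (P : probability Omega R) (F : R -> set (set Omega))
      (W : R -> (euclidean R d -> R) -> Omega -> R)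
      (u : R -> euclidean R d -> Omega -> R),
      filtration F ->
      spatial_noise P (riesz_reg rho) F W ->
      mild_solution P rho beta F W (fun=> 1) u ->
      (ereal_sup [set m | exists (t : R) (x : euclidean R d),
                    (0 <= t <= T)%R /\
                    m = 'E_P[(fun w => `|u t x w| ^+ 2)%R]] <= C%:E)%E.
Proof.
have /andP[rho0_gt0 rho0_lt1] := hrho0.
have [B HB] := moment_bound hd hbeta hT hrho0; exists B => rho /andP[rho_gt0 rho_le].
move=> disp Omega P F W u Ffilt HW Hu.
have rho_lt1 : rho < 1 := le_lt_trans rho_le rho0_lt1.
have [M M0 HM] := upos_moment Hu T.
have bound : forall t x, 0 <= t <= T -> `|covar P u (t, (x, x))| <= B.
  apply: (HB rho _ (fun z => `|covar P u z|) M).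
  - by rewrite rho_gt0.
  - by apply: measurableT_comp => //; exact: measurable_covar Hu.
  - by move=> z; exact: normr_ge0.
  - move=> t x x' /andP[t0 tT].
    have ii := sqintM (HM t x tT).1 (HM t x' tT).1.
    rewrite -lee_fin (EFin_normr_Rintegral measurableT ii).
    apply: le_trans (le_abse_integral P measurableT (measurable_int _ ii)) _.
    exact: (covar_le HM x x' tT).
  - by move=> t x x' /andP[t0 _]; exact: (covar_duhamel hd rho_gt0 rho_lt1 Ffilt HW Hu).
apply: ge_ereal_sup => _ [t [x [tT ->]]]; have /andP[t0 t1] := tT.
apply: le_trans (_ : (`|covar P u (t, (x, x))|%:E <= B%:E)%E); last first.
  by rewrite lee_fin bound.
have ii := sqintM (HM t x t1).1 (HM t x t1).1.
apply: (@le_trans _ _ (covar P u (t, (x, x)))%:E); last by rewrite lee_fin ler_norm.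
rewrite (Ex_EFin ii) unlock le_eqVlt; apply/orP; left; apply/eqP.
by apply: eq_integral => w _ /=; rewrite /upos t0 -expr2 real_normK ?num_real.
Qed.
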